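(* Let $G$ be a finite simple connected graph with $|G|\ge 2$ vertices such that $G\in\mathcal{C}$ and $G$ is not isomorphic to any graph in $\mathcal{F}=\{C_4,K_{2,3},W_4,W_4',K_6',K_8'\}$. Then $$\ell(G)+br(G)\ \geq\ |G|,$$ where $\ell(G)$ is the number of distinct lines of $G$ and $br(G)$ is the number of bridges of $G$.
   Context: All graphs are finite and simple; $|G|$ is the number of vertices of $G$. Lines: $d(a,b)$ is the length of a shortest path between $a$ and $b$ in $G$ (infinite if $a,b$ lie in different connected components). For three distinct vertices $a,b,c$, write $[abc]$ when $d(a,b)+d(b,c)=d(a,c)<\infty$. For two distinct vertices $a,b$ the line induced by $a,b$ is the vertex set $\overline{ab}=\{a,b\}\cup\{x: [abx]\text{ or }[axb]\text{ or }[xab]\}$. $\ell(G)$ is the number of distinct sets of the form $\overline{ab}$, with $a\ne b$ vertices of $G$. A bridge is an edge whose deletion disconnects the (connected) graph; $br(G)$ is the number of bridges of $G$. A set $M$ of vertices of a graph with vertex set $V$ and edge set $E$ is a module if for all $a,b\in M$ and $u\in V\setminus M$, $au\in E$ if and only if $bu\in E$. It is non-trivial if $|V|>|M|\ge 2$. $\mathcal{C}$ is the class of graphs $G$ such that every induced subgraph of $G$ is chordal, or has a cut-vertex, or has a non-trivial module. The graphs in $\mathcal{F}$ (considered up to isomorphism): $C_4$ is the cycle on 4 vertices; $K_{2,3}$ is the complete bipartite graph with parts of sizes 2 and 3; $W_4$ is the wheel obtained from $C_4$ by adding a vertex adjacent to all four vertices of the cycle; $W_4'$ is obtained from $C_4$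 by adding a vertex adjacent to exactly three vertices of the cycle; $K_6'$ is the complete graph $K_6$ minus a perfect matching; $K_8'$ is the complete graph $K_8$ minus a perfect matching. *)

(* Defs.v *)
From mathcomp Require Import all_boot.

Set Implicit Arguments.
Unset Strict Implicit.
Unset Printing Implicit Defensive.

(* A finite simple graph is a symmetric irreflexive [e : rel T] over a
   [T : finType]; both properties are hypotheses where they are needed. *)

Section Graphs.
Variables (T : finType) (e : rel T).
Implicit Types (a b c u v x y : T) (M f : {set T}).

Definition connected : bool := [forall x, forall y, connect e x y].

Definition has_walk a b n : bool :=
  [exists p : n.-tuple T, path e a p && (last a p == b)].

(* A shortest path has fewer than [#|T|] edges, so the search below finds its
   length; the value is [#|T|], standing for infinity, exactly when [a] and [b]
   lie in different components. *)
Definition dist a b : nat := find (has_walk a b) (iota 0 #|T|).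

(* The [connect] conditions say that the three distances are finite. *)
Definition between a b c : bool :=
  [&& uniq [:: a; b; c], connect e a b, connect e b c, connect e a c
    & dist a b + dist b c == dist a c].

Definition line a b : {set T} :=
  [set a; b] :|: [set x | [|| between a b x, between a x b | between x a b]].

Definition lines : {set {set T}} :=
  [set line p.1 p.2 | p : T * T & p.1 != p.2].

(* Edges are unordered pairs, so that each bridge is counted once. *)
Definition edges : {set {set T}} :=
  [set [set p.1; p.2] | p : T * T & e p.1 p.2].

Definition del_edge f : rel T := [rel x y | e x y && ([set x; y] != f)].

Definition is_module M : bool :=
  [forall a in M, forall b in M, forall u in ~: M, e a u == e b u].

Definition has_nontrivial_module : Prop :=
  exists M : {set T}, is_module M /\ 2 <= #|M| < #|T|.

(* The edge [x y] is a chord: its ends are not consecutive on the cycle. *)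
Definition chordal : Prop :=
  forall s : seq T, ucycle e s -> 4 <= size s ->
  exists x y, [/\ x \in s, y \in s, e x y, y != next s x & x != next s y].

Definition num_components : nat := n_comp e T.

(* The vertex set of the induced subgraph is a type of its own. *)
Definition induced (S : {set T}) : rel {x : T | x \in S} :=
  [rel x y | e (val x) (val y)].

End Graphs.

Arguments induced {T} e S.

Definition bridges (T : finType) (e : rel T) : {set {set T}} :=
  [set f in edges e | ~~ connected (del_edge e f)].

Definition num_lines (T : finType) (e : rel T) : nat := #|lines e|.

Definition num_bridges (T : finType) (e : rel T) : nat := #|bridges e|.

Definition has_cut_vertex (T : finType) (e : rel T) : Prop :=
  exists v : T, num_components e < num_components (induced e [set~ v]).

Definition in_class_C (T : finType) (e : rel T) : Prop :=
  forall S : {set T},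
    [\/ chordal (induced e S), has_cut_vertex (induced e S)
      | has_nontrivial_module (induced e S)].

Definition isomorphic (T U : finType) (e : rel T) (e' : rel U) : Prop :=
  exists2 h : T -> U, bijective h & forall x y, e' (h x) (h y) = e x y.

Definition add_vertex (T : finType) (e : rel T) (P : pred T) :
    rel (option T) :=
  fun x y => match x, y with
             | Some i, Some j => e i j
             | Some i, None | None, Some i => P i
             | None, None => false
             end.

Definition C4 : rel 'I_4 := [rel i j | (j == ordS i) || (i == ordS j)].

Definition K23 : rel ('I_2 + 'I_3)%type :=
  fun x y => match x, y with
             | inl _, inr _ | inr _, inl _ => true
             | _, _ => false
             end.

Definition W4 : rel (option 'I_4) := add_vertex C4 predT.

Definition W4' : rel (option 'I_4) := add_vertex C4 [pred i : 'I_4 | i != 3 :> nat].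

(* The removed perfect matching is [{0, 1}, {2, 3}, ...]; distinct halves
   already force the ends to be distinct. *)
Definition complete_minus_matching n : rel 'I_n :=
  [rel i j : 'I_n | i./2 != j./2].

Arguments complete_minus_matching n : clear implicits.

Definition K6' : rel 'I_6 := complete_minus_matching 6.

Definition K8' : rel 'I_8 := complete_minus_matching 8.

Definition in_family_F (T : finType) (e : rel T) : Prop :=
  isomorphic e C4 \/ isomorphic e K23 \/ isomorphic e W4 \/
  isomorphic e W4' \/ isomorphic e K6' \/ isomorphic e K8'.

(* Main.v *)
(* Induction on the number of vertices.  Two sides of a cut vertex share at most
   the universal line and their bridges add up; the few lines missing when a side
   is exceptional are induced by a vertex of each side.  Otherwise there is no
   cut vertex, and as many lines as vertices are needed.  If the graph is
   chordal, the lines through a simplicial vertex are distinct, and two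
   neighbours of it induce one more.  If not, it has a non-trivial module.

   When x, y are false twins and c is not adjacent to them, the line xc contains
   x but not y, unlike every line of G - x.  When each such pair is complete to
   the rest, G is the join of p pairs and of a graph without false twins, and its
   lines are counted directly.  Without false twins, a module M is contracted to
   one of its vertices y: this graph and M + u, for a neighbour u of M, are
   isometric in G, have |G| + 2 vertices in total, and at most two lines of G
   extend lines of both.  The remaining case is that of a universal vertex u with
   a cut vertex c in G - u, where G is split along {u, c}. *)

Require Import Defs.
From mathcomp Require Import all_boot zify.

Set Implicit Arguments.
Unset Strict Implicit.
Unset Printing Implicit Defensive.

(** The contraction count has no slack: every defect of a part must be repaid by a line of the whole
    graph lying in neither of the two families compared. Defects have two sources. A part may be
    exceptional; as the six exceptional graphs have diameter at most two, the lines of the whole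
    graph that their vertices induce can be read off an adjacency table, and finite checks show how
    few are missing and which vertices induce new ones. Or a part may have bridges although the
    whole graph, having no cut vertex and at least three vertices, has none; a bridge of a
    contraction joins the contracted vertex to a vertex whose neighbourhood is exactly [M], so
    without false twins there is at most one. The list of exceptions arises mostly from the direct
    count for joins with pairs of false twins: [C4], [K6'], [K8'] and [W4] are where the binomial
    count falls short of the number of vertices, and [W4'] is what remains with a single pair. [K23]
    is [C4] with one more false twin. *)

Ltac nlia :=
  repeat match goal with
  | H : ?P |- _ => lazymatch P with
      | context [leq _ _] => fail
      | context [@eq nat _ _] => fail
      | context [@eq (Equality.sort Datatypes_nat__canonical__eqtype_Equality) _ _] => fail
      | context [@eq_op Datatypes_nat__canonical__eqtype_Equality _ _] => fail
      | _ => clear H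
      end
  end; lia.

(* [set] identifies convertible cardinals that [lia] would keep apart. *)
Ltac card_lia := rewrite /=; repeat (let n := fresh "n" in set n := #|_|; clearbody n); clear; lia.

(** * Distances *)

Section Walks.
Variables (T : finType) (e : rel T).
Implicit Types (a b c x y z : T).

Lemma has_walkP a b n :
  reflect (exists p, [/\ size p = n, path e a p & last a p = b])
          (has_walk e a b n).
Proof.
apply: (iffP existsP) => [[p /andP[pp /eqP lp]]|[p [sp pp lp]]].
  by exists p; rewrite size_tuple.
have sp' : size p == n by apply/eqP.
by exists (Tuple sp'); rewrite /= pp lp eqxx.
Qed.

Lemma connect_walk a b : connect e a b -> exists2 n, n < #|T| & has_walk e a b n.
Proof.
case/connectP=> p /shortenP[q pq uq _] ->; exists (size q).
  by rewrite -[(size q).+1]/(size (a :: q)) -(card_uniqP uq) max_card.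
by apply/has_walkP; exists q.
Qed.

Lemma dist_walk a b : connect e a b -> has_walk e a b (dist e a b).
Proof.
case/connect_walk=> n ltn wn.
have hs : has (has_walk e a b) (iota 0 #|T|).
  by apply/hasP; exists n => //; rewrite mem_iota.
have := nth_find 0 hs; rewrite nth_iota //.
by move: hs; rewrite has_find size_iota.
Qed.

Lemma dist_le_walk a b n : has_walk e a b n -> dist e a b <= n.
Proof.
move=> wn; rewrite leqNgt; apply/negP=> ltn.
have := before_find 0 ltn; rewrite nth_iota ?wn //.
by apply: leq_trans ltn _; rewrite /dist (leq_trans (find_size _ _)) ?size_iota.
Qed.

Lemma dist_le_path a p : path e a p -> dist e a (last a p) <= size p.
Proof. by move=> pp; apply/dist_le_walk/has_walkP; exists p. Qed.

(** Every prefix of a shortest walk is shortest: a shorter walk to its end, followed by the rest,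
    would beat the whole. The hypothesis is only [connect e a b] because [link] takes geodesics in a
    relation confined to a few vertices. *)
Lemma geodesic a b : connect e a b ->
  exists p, [/\ path e a p, last a p = b &
    forall i, i <= size p -> dist e a (nth a (a :: p) i) = i].
Proof.
move=> cab; have /has_walkP[p [sp pp lp]] := dist_walk cab.
exists p; split=> // i lei.
have nthE : nth a (a :: p) i = last a (take i p).
  by rewrite (last_nth a) size_takel //; case: i lei => //= i lei; rewrite nth_take.
have pti : path e a (take i p) /\ path e (last a (take i p)) (drop i p).
  by apply/andP; rewrite -cat_path cat_take_drop.
apply/eqP; rewrite eqn_leq nthE.
have := dist_le_path pti.1; rewrite size_takel // => -> /=.
have cai : connect e a (last a (take i p)).
  by apply/connectP; exists (take i p) => //; case: pti.
have /has_walkP[q [sq pq lq]] := dist_walk cai.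
have : dist e a (last a (q ++ drop i p)) <= size (q ++ drop i p).
  by apply: dist_le_path; rewrite cat_path pq lq; case: pti.
rewrite last_cat lq -last_cat cat_take_drop lp size_cat size_drop sq -sp; lia.
Qed.

Lemma dist_step_le a x y : connect e a x -> e x y -> dist e a y <= (dist e a x).+1.
Proof.
move=> /dist_walk/has_walkP[p [sp pp lp]] exy.
apply/dist_le_walk/has_walkP; exists (rcons p y).
by rewrite size_rcons sp rcons_path pp lp last_rcons.
Qed.

Lemma connect_first a b : connect e a b -> a != b ->
  exists2 c, e a c & connect e c b.
Proof.
case/connectP=> [[|c p]] /= => [_ ->|/andP[eac pp] ->]; first by rewrite eqxx.
by move=> _; exists c => //; apply/connectP; exists p.
Qed.

End Walks.

Lemma connect_homo (T U : finType) (r : rel T) (r' : rel U) (g : T -> U) :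
  (forall x y, r x y -> connect r' (g x) (g y)) ->
  forall x y, connect r x y -> connect r' (g x) (g y).
Proof.
move=> h x y /connectP[p]; elim: p x => [|z p IH] x /=; first by move=> _ ->.
by case/andP=> rxz pp yE; apply: connect_trans (h _ _ rxz) (IH _ pp yE).
Qed.

Lemma connect_ind (T : finType) (r : rel T) (P : T -> Prop) a b :
  (forall x y, r x y -> P x -> P y) -> connect r a b -> P a -> P b.
Proof.
move=> h /connectP[p]; elim: p a => [|z p IH] a /=; first by move=> _ ->.
by case/andP=> raz pp yE Pa; apply: IH pp yE (h _ _ raz Pa).
Qed.

Lemma connectedP (T : finType) (e : rel T) :
  reflect (forall x y, connect e x y) (connected e).
Proof. exact: 'forall_forallP. Qed.

Section Metric.
Variables (T : finType) (e : rel T).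
Hypotheses (e_sym : symmetric e) (e_irr : irreflexive e) (e_conn : connected e).
Implicit Types (a b c x y z : T).
Local Notation d := (dist e).

Let cn x y : connect e x y.
Proof. exact/connectedP. Qed.

Lemma dist_xx a : d a a = 0.
Proof. by apply/eqP; rewrite -leqn0 -[X in _ <= X]/(size (Nil T)); exact: (@dist_le_path _ e a [::]). Qed.

Lemma dist_eq0 a b : (d a b == 0) = (a == b).
Proof.
apply/eqP/eqP=> [d0|->]; last exact: dist_xx.
have /has_walkP[p [sp _ lp]] := dist_walk (cn a b).
by move: sp lp; rewrite d0; case: p.
Qed.

Lemma dist_gt0 a b : (0 < d a b) = (a != b).
Proof. by rewrite lt0n dist_eq0. Qed.

Lemma dist_sym a b : d a b = d b a.
Proof.
have le x y : d x y <= d y x.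
  have /has_walkP[p [sp pp lp]] := dist_walk (cn y x).
  apply/dist_le_walk/has_walkP; exists (rev (belast y p)).
  rewrite size_rev size_belast sp -lp; split=> //.
    by rewrite rev_path; rewrite (eq_path (e' := e)) // => u v; rewrite e_sym.
  by case: p {sp pp lp} => //= z p; rewrite rev_cons last_rcons.
by apply/eqP; rewrite eqn_leq !le.
Qed.

Lemma dist_triangle a b c : d a c <= d a b + d b c.
Proof.
have /has_walkP[p [sp pp lp]] := dist_walk (cn a b).
have /has_walkP[q [sq pq lq]] := dist_walk (cn b c).
apply/dist_le_walk/has_walkP; exists (p ++ q).
by rewrite size_cat sp sq cat_path pp lp pq last_cat lp.
Qed.

Lemma dist_eq1 a b : (d a b == 1) = e a b.
Proof.
apply/eqP/idP=> [d1|eab].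
  have /has_walkP[p [sp pp lp]] := dist_walk (cn a b).
  by move: sp pp lp; rewrite d1; case: p => [|x [|//]] //= _ /andP[+ _] => + <-.
apply/eqP; rewrite eqn_leq dist_gt0; apply/andP; split.
  by apply/dist_le_walk/has_walkP; exists [:: b]; rewrite /= eab.
by apply: contraTneq eab => ->; rewrite e_irr.
Qed.

Lemma dist_edge a b : e a b -> d a b = 1.
Proof. by rewrite -dist_eq1 => /eqP. Qed.

Lemma dist_step a b : a != b -> exists2 c, e a c & d a b = (d c b).+1.
Proof.
move=> nab; have /has_walkP[p [sp pp lp]] := dist_walk (cn a b).
case: p sp pp lp => [_ _ /= ab|c p /= sp /andP[eac pp] lp].
  by rewrite ab eqxx in nab.
exists c => //; apply/eqP; rewrite eqn_leq; apply/andP; split.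
  by have := dist_triangle a c b; rewrite (dist_edge eac).
by have := dist_le_path pp; rewrite lp -sp.
Qed.

Lemma dist_ge2 a b : a != b -> ~~ e a b -> 2 <= d a b.
Proof. by move=> nab; rewrite -dist_eq1; move: nab; rewrite -dist_gt0; lia. Qed.

Lemma dist_eq2 a b c : a != b -> ~~ e a b -> e a c -> e c b -> d a b = 2.
Proof.
move=> nab neab /dist_edge dac /dist_edge dcb.
have := dist_ge2 nab neab; have := dist_triangle a c b; lia.
Qed.

Lemma betweenE a b c :
  between e a b c = [&& a != b, b != c, a != c & d a b + d b c == d a c].
Proof. by rewrite /between /= !inE !cn /= negb_or andbT -!andbA; do !bool_congr. Qed.

(** The distinctness conditions of [between] disappear: for [x = a] or [x = b] one of the three
    equations holds trivially, and both ends do belong to the line. *)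
Lemma in_line a b x : a != b ->
  (x \in line e a b) =
  [|| d a b + d b x == d a x, d a x + d x b == d a b | d x a + d a b == d x b].
Proof.
move=> nab; rewrite !inE !betweenE.
have [->|nxa] := eqVneq x a; first by rewrite !dist_xx add0n eqxx !orbT.
have [->|nxb] := eqVneq x b; first by rewrite !dist_xx addn0 eqxx !orbT.
by rewrite /= nab.
Qed.

Lemma line_sym a b : line e a b = line e b a.
Proof.
have [->//|nab] := eqVneq a b.
apply/setP=> x; rewrite !in_line // 1?eq_sym // ![d b _]dist_sym ![d a _]dist_sym.
have := dist_sym a b; lia.
Qed.

Lemma in_line_l a b : a \in line e a b.
Proof. by rewrite !inE eqxx. Qed.

Lemma in_line_r a b : b \in line e a b.
Proof. by rewrite !inE eqxx !orbT. Qed.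

End Metric.

(** * Cut vertices, and a hereditary form of the class *)

(** Deleting [v] is modelled by isolating it, so that walks before and after the deletion live on
    the same type. *)
Definition avoid (T : finType) (e : rel T) v : rel T :=
  [rel x y | [&& e x y, x != v & y != v]].

Definition nocut (T : finType) (e : rel T) : Prop :=
  forall v a b, a != v -> b != v -> connect (avoid e v) a b.

(** The right-hand side is a boolean read as a number: the empty graph has no component, which
    matters when the only vertex is deleted. *)
Lemma connected_n_comp (T : finType) (e : rel T) :
  symmetric e -> connected e -> n_comp e T = (0 < #|T|).
Proof.
move=> e_sym /connectedP cn; have cs : connect_sym e by apply: sym_connect_sym.
case: (posnP #|T|) => [T0|/card_gt0P[x _]].
  by rewrite /n_comp_mem (eq_card0) // => x; have := card0_eq T0 x.
rewrite -[RHS]/1 -(n_comp_connect cs x); apply: eq_n_comp_r => y.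
by rewrite !inE cn.
Qed.

Lemma nocut_connected (T : finType) (e : rel T) v :
  nocut e -> connected (induced e [set~ v]).
Proof.
move=> nc; apply/connectedP=> -[a av] [b bv].
have av' : a != v by rewrite !inE in av.
have bv' : b != v by rewrite !inE in bv.
pose g := insubd (Sub a av : {x | x \in [set~ v]}).
have h := @connect_homo T _ (avoid e v) (induced e [set~ v]) g _ _ _ (nc v a b av' bv').
suff [ga gb] : g a = Sub a av /\ g b = Sub b bv.
  rewrite -/(Sub a av) -/(Sub b bv) -ga -gb; apply: h => x y /and3P[exy xv yv].
  by apply: connect1; rewrite /induced /= !val_insubd !inE xv yv.
by split; apply: val_inj; rewrite val_insubd ?av ?bv.
Qed.

Lemma cut_vertex_not_nocut (T : finType) (e : rel T) :
  symmetric e -> connected e -> has_cut_vertex e -> ~ nocut e.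
Proof.
move=> e_sym cn [v]; rewrite /num_components connected_n_comp // => ltv nc.
have T0 : 0 < #|T| by apply/card_gt0P; exists v.
move: ltv; rewrite T0 connected_n_comp //; first by case: (0 < _).
  by move=> x y; apply: e_sym.
exact: nocut_connected.
Qed.

(** The class as the induction uses it. Induced subgraphs are pulled back along injections, so
    heredity is composition of maps instead of subsets of a subtype. For connected subgraphs a cut
    vertex implies the failure of [nocut]. *)
Definition hclass (T : finType) (e : rel T) : Prop :=
  forall (U : finType) (h : U -> T), injective h -> connected (relpre h e) ->
  [\/ chordal (relpre h e), ~ nocut (relpre h e)
    | has_nontrivial_module (relpre h e)].

Lemma chordal_embed (T U : finType) (e : rel T) (e' : rel U) (h : U -> T) :
  injective h -> (forall x y, e (h x) (h y) = e' x y) -> chordal e -> chordal e'.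
Proof.
move=> hi he ch s /andP[cs us] ss.
have [||x [y [xs ys exy n1 n2]]] := ch (map h s).
- rewrite /ucycle (map_inj_uniq hi) us andbT.
  by rewrite (mono_cycle (e := e')) // => x y; apply: he.
- by rewrite size_map.
case/mapP: xs exy n1 n2 => x' x's ->; case/mapP: ys => y' y's ->.
rewrite he !(next_map hi us) !(inj_eq hi) => *.
by exists x', y'.
Qed.

Lemma hclass_embed (T U : finType) (e : rel T) (h : U -> T) :
  injective h -> hclass e -> hclass (relpre h e).
Proof.
by move=> hi hc V g gi; apply: (hc V (h \o g)); apply: inj_comp.
Qed.

Lemma in_class_C_hclass (T : finType) (e : rel T) :
  symmetric e -> in_class_C e -> hclass e.
Proof.
move=> e_sym eC U h hi cn.
pose S := [set h u | u in U].
have hS u : h u \in S by apply: imset_f.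
pose g u : {x | x \in S} := Sub (h u) (hS u).
have gi : injective g by move=> u v /(congr1 val) /hi.
have [|g' gK g'K] := inj_card_bij gi.
  by rewrite card_sig; apply: leq_imset_card.
have ge x y : induced e S (g x) (g y) = relpre h e x y by [].
have ge' x y : relpre h e (g' x) (g' y) = induced e S x y.
  by rewrite -ge !g'K.
have e_sym' : symmetric (induced e S) by move=> x y; apply: e_sym.
case: (eC S) => [ch|cv|[M [mM cM]]].
- by constructor 1; apply: (chordal_embed gi) ch.
- constructor 2 => nc.
  apply: cut_vertex_not_nocut cv _ => //.
    apply/connectedP=> x y; rewrite -(g'K x) -(g'K y).
    apply: (connect_homo (g := g)) ((connectedP _ cn) (g' x) (g' y)) => u v uv.
    exact: connect1.
  move=> v a b av bv; rewrite -(g'K a) -(g'K b).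
  have hh x : x != v -> g' x != g' v by rewrite (can_eq g'K).
  apply: (connect_homo (g := g)) (nc _ _ _ (hh _ av) (hh _ bv)) => x y /and3P[exy xv yv].
  by apply: connect1; apply/and3P; split=> //; rewrite -(can_eq g'K) gK.
- constructor 3; exists (g @^-1: M).
  have cM' : #|g @^-1: M| = #|M|.
    by apply: on_card_preimset; exists g' => x _; [apply: gK|apply: g'K].
  have cU : #|U| = #|{: {x | x \in S}}|.
    by rewrite card_sig card_imset.
  split; last by rewrite cM' cU.
  apply/forall_inP=> a; rewrite inE => aM; apply/forall_inP=> b; rewrite inE => bM.
  apply/forall_inP=> u; rewrite !inE => uM.
  move/forall_inP/(_ _ aM)/forall_inP/(_ _ bM)/forall_inP: mM => /(_ (g u)).
  by rewrite inE; apply.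
Qed.

(** * Retracts *)

(* Collapsing the complement of [S] onto the vertex [y] of [S] maps edges to
   edges or to points, so that [S] is isometric in the whole graph. *)
Definition retract (T : finType) (e : rel T) (S : {set T}) (y : T) : Prop :=
  y \in S /\ (forall x z, x \in S -> z \notin S -> e x z -> x = y \/ e x y).

Definition lines_in (T : finType) (e : rel T) (S : {set T}) : {set {set T}} :=
  [set line e p.1 p.2 | p : T * T & [&& p.1 \in S, p.2 \in S & p.1 != p.2]].

Section Retract.
Variables (T : finType) (e : rel T).
Hypotheses (e_sym : symmetric e) (e_irr : irreflexive e) (e_conn : connected e).
Implicit Types (a b c x y z : T) (S : {set T}).
Local Notation d := (dist e).

Lemma lines_inP S (X : {set T}) :
  reflect (exists a b, [/\ a \in S, b \in S, a != b & X = line e a b])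
          (X \in lines_in e S).
Proof.
apply: (iffP imsetP) => [[[a b]]|[a [b [aS bS nab ->]]]].
  by rewrite inE /= => /and3P[aS bS nab] ->; exists a, b.
by exists (a, b) => //; rewrite inE /= aS bS.
Qed.

Lemma mem_lines_in S a b : a \in S -> b \in S -> a != b -> line e a b \in lines_in e S.
Proof. by move=> *; apply/lines_inP; exists a, b. Qed.

Lemma mem_lines a b : a != b -> line e a b \in lines e.
Proof. by move=> nab; apply/imsetP; exists (a, b); rewrite // inE. Qed.

Lemma lines_in_sub S : lines_in e S \subset lines e.
Proof. by apply/subsetP=> X /lines_inP[a [b [_ _ nab ->]]]; apply: mem_lines. Qed.

Lemma induced_sym S : symmetric (induced e S).
Proof. by move=> x y; apply: e_sym. Qed.

Lemma induced_irr S : irreflexive (induced e S).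
Proof. by move=> x; apply: e_irr. Qed.

Variables (S : {set T}) (y : T).
Hypothesis rS : retract e S y.

Let yS : y \in S. Proof. by case: rS. Qed.

(** The collapsing map itself: [insubd] sends everything outside of [S] to its default, which is
    [y]. *)
Definition to_retract x : {x | x \in S} := insubd (Sub y yS) x.

Lemma to_retract_val (x : {x | x \in S}) : to_retract (val x) = x.
Proof. exact: valKd. Qed.

Lemma val_to_retract x : x \in S -> val (to_retract x) = x.
Proof. by move=> xS; rewrite val_insubd xS. Qed.

Lemma to_retract_out x : x \notin S -> val (to_retract x) = y.
Proof. by move=> xS; rewrite val_insubd (negbTE xS). Qed.

Lemma to_retract_edge x z : e x z ->
  to_retract x = to_retract z \/ induced e S (to_retract x) (to_retract z).
Proof.
move=> exz; have [xS|xS] := boolP (x \in S); have [zS|zS] := boolP (z \in S).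
- by right; rewrite /induced /= !val_to_retract.
- case: rS => _ /(_ x z xS zS exz)[xy|exy].
    by left; apply: val_inj; rewrite val_to_retract // to_retract_out.
  by right; rewrite /induced /= val_to_retract // to_retract_out.
- case: rS => _ /(_ z x zS xS); rewrite e_sym exz => /(_ isT)[zy|ezy].
    by left; apply: val_inj; rewrite [RHS]val_to_retract // to_retract_out.
  by right; rewrite /induced /= (val_to_retract zS) to_retract_out // e_sym.
- by left; apply: val_inj; rewrite !to_retract_out.
Qed.

Lemma retract_connected : connected (induced e S).
Proof.
apply/connectedP=> a b; rewrite -(to_retract_val a) -(to_retract_val b).
apply: connect_homo ((connectedP _ e_conn) (val a) (val b)) => x z exz.
by case: (to_retract_edge exz) => [->//|]; apply: connect1.
Qed.

(** Walks inside [S] are walks of the whole graph; conversely the retraction fixes [S] and shortens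
    or preserves walks. *)
Lemma retract_dist (a b : {x | x \in S}) :
  dist (induced e S) a b = dist e (val a) (val b).
Proof.
have cS := retract_connected.
apply/eqP; rewrite eqn_leq; apply/andP; split; last first.
  have /has_walkP[p [sp pp lp]] := dist_walk ((connectedP _ cS) a b).
  rewrite -sp -(size_map val) -lp -last_map; apply: dist_le_path.
  by rewrite path_map.
have /has_walkP[p [sp pp lp]] := dist_walk ((connectedP _ e_conn) (val a) (val b)).
rewrite -sp -{1}(to_retract_val a) -{1}(to_retract_val b) -lp.
elim: p (val a) pp {sp lp} => [|z p IH] x /=; first by rewrite dist_xx.
case/andP=> exz pp; have := IH _ pp.
case: (to_retract_edge exz) => [->|exz']; first exact: leqW.
move=> le; apply: leq_trans (dist_triangle cS _ (to_retract z) _) _.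
by rewrite (dist_edge (@induced_irr S) cS exz').
Qed.

Lemma retract_le a b : dist e (val (to_retract a)) (val (to_retract b)) <= dist e a b.
Proof.
have /has_walkP[p [sp pp lp]] := dist_walk ((connectedP _ e_conn) a b).
rewrite -sp -lp; elim: p a pp {sp lp} => [|z p IH] x /=; first by rewrite dist_xx.
case/andP=> exz pp; have := IH _ pp.
case: (to_retract_edge exz) => [->|exz']; first exact: leqW.
move=> le; apply: leq_trans (dist_triangle e_conn _ (val (to_retract z)) _) _.
by rewrite (dist_edge e_irr e_conn exz').
Qed.

(** Intersecting with [S] sends [lines_in e S] onto the lines of the subgraph, since distances agree
    on [S]. *)
Lemma retract_lines : num_lines (induced e S) <= #|lines_in e S|.
Proof.
pose f (X : {set T}) := [set x : {x | x \in S} | val x \in X].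
have cS := retract_connected.
apply: leq_trans (leq_imset_card f (mem (lines_in e S))).
apply/subset_leq_card/subsetP=> X /imsetP[[a b]]; rewrite inE /= => nab ->.
apply/imsetP; exists (line e (val a) (val b)).
  by apply: mem_lines_in; rewrite ?(inj_eq val_inj) //; apply: valP.
apply/setP=> x; by rewrite /= [RHS]in_set !in_line ?(inj_eq val_inj) // !retract_dist.
Qed.

End Retract.

Lemma card_induced (T : finType) (S : {set T}) : #|{: {x | x \in S}}| = #|S|.
Proof. exact: card_sig. Qed.

(** * Adjacency tables of the exceptional graphs *)

(* A table lists, for each vertex, its neighbours. *)
Definition adj (A : seq (seq nat)) i j := j \in nth [::] A i.

(** An isomorphism with a concrete graph, given as an enumeration of [S] in the order of the table:
    facts about exceptional graphs then become boolean checks on [A]. *)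
Definition tab (T : finType) (e : rel T) (S : {set T}) (t : seq T) A : Prop :=
  [/\ uniq t, t =i S, size t = size A &
   forall x0 i j, i < size A -> j < size A -> e (nth x0 t i) (nth x0 t j) = adj A i j].

Definition adjC4 := [:: [:: 1; 3]; [:: 0; 2]; [:: 1; 3]; [:: 0; 2]].
Definition adjK23 := [:: [:: 2; 3; 4]; [:: 2; 3; 4]; [:: 0; 1]; [:: 0; 1]; [:: 0; 1]].
Definition adjW4 :=
  [:: [:: 1; 3; 4]; [:: 0; 2; 4]; [:: 1; 3; 4]; [:: 0; 2; 4]; [:: 0; 1; 2; 3]].
Definition adjW4' :=
  [:: [:: 1; 3; 4]; [:: 0; 2; 4]; [:: 1; 3; 4]; [:: 0; 2]; [:: 0; 1; 2]].
Definition adj_matching n :=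
  [seq [seq j <- iota 0 n | i./2 != j./2] | i <- iota 0 n].
Definition adjF :=
  [:: adjC4; adjK23; adjW4; adjW4'; adj_matching 6; adj_matching 8].

Definition allpair n (P : nat -> nat -> bool) :=
  all (fun i => all (P i) (iota 0 n)) (iota 0 n).

Lemma allpairP n (P : nat -> nat -> bool) : reflect (forall i j, i < n -> j < n -> P i j) (allpair n P).
Proof.
apply: (iffP allP) => [h i j ltin ltjn|h i]; last first.
  rewrite mem_iota => ltin; apply/allP=> j; rewrite mem_iota; exact: h.
have /allP : all (P i) (iota 0 n) by apply: h; rewrite mem_iota.
by apply; rewrite mem_iota.
Qed.

Section Tables.
Variables (T : finType) (e : rel T).

Lemma make_tab u0 (us : seq T) A :
  uniq us -> #|T| = size us -> size us = size A ->
  allpair (size A) (fun i j => e (nth u0 us i) (nth u0 us j) == adj A i j) ->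
  tab e setT us A.
Proof.
move=> uus cT sA /allpairP h; split=> // [|x0 i j lti ltj].
  have c : #|us| = #|[set: T]| by rewrite cardsT cT; apply/card_uniqP.
  by apply/(subset_cardP c)/subsetP=> x; rewrite inE.
by rewrite !(set_nth_default u0 x0) ?sA //; apply/eqP/h.
Qed.

Lemma isomorphic_tab (U : finType) (e' : rel U) us A :
  tab e' setT us A -> isomorphic e e' -> exists t, tab e setT t A.
Proof.
case=> uus cus sus aus [h [g hK gK] he]; exists (map g us); split.
- by rewrite map_inj_uniq //; apply: can_inj gK.
- by move=> x; rewrite inE -[x]hK map_f // cus inE.
- by rewrite size_map.
move=> x0 i j lti ltj; rewrite !(nth_map (h x0)) ?sus // -he !gK; exact: aus.
Qed.

Lemma tab_isomorphic (U : finType) (e' : rel U) us t A :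
  tab e' setT us A -> tab e setT t A -> isomorphic e e'.
Proof.
case=> uus cus sus aus [ut ct st at_].
have x0U (x : T) : U.
  have : 0 < size us by rewrite sus -st; case: (t) (ct x); rewrite inE.
  by case: (us).
pose h x := nth (x0U x) us (index x t).
have tin x : x \in t by rewrite ct inE.
have uin x : x \in us by rewrite cus inE.
have idx x : index x t < size A by rewrite -st index_mem.
have hE u0 x : h x = nth u0 us (index x t).
  by rewrite /h (set_nth_default u0) // sus.
exists h; last by move=> x y; rewrite (hE (h x)) (hE (h x) y) aus // -(at_ x) // !nth_index.
apply: inj_card_bij.
  move=> x y; rewrite (hE (h x)) (hE (h x) y) => /eqP; rewrite nth_uniq ?sus // => /eqP xy.
  by rewrite -(nth_index x (tin x)) xy nth_index.
have -> : #|T| = size t by rewrite -(card_uniqP ut) -cardsT; apply: eq_card => x; rewrite ct inE.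
rewrite st -sus -(card_uniqP uus) -cardsT; apply: subset_leq_card.
by apply/subsetP=> u _; apply: uin.
Qed.

(** The distance read off the table. All remaining pairs get 2, which is right under [diam2]. *)
Definition dd A i j := if i == j then 0 else if adj A i j then 1 else 2.

Definition diam2 A := allpair (size A) (fun i j =>
  [|| i == j, adj A i j | has (fun k => adj A i k && adj A k j) (iota 0 (size A))]).

Definition ldd A i j k :=
  [|| dd A i j + dd A j k == dd A i k, dd A i k + dd A k j == dd A i j
    | dd A k i + dd A i j == dd A k j].

Definition distinct_pairs n :=
  [seq p <- [seq (i, j) | i <- iota 0 n, j <- iota 0 n] | p.1 != p.2].

Definition line_code A (p : nat * nat) := [seq ldd A p.1 p.2 k | k <- iota 0 (size A)].

Definition line_codes A := undup [seq line_code A p | p <- distinct_pairs (size A)].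

Lemma mem_distinct_pairs n p :
  (p \in distinct_pairs n) = [&& p.1 < n, p.2 < n & p.1 != p.2].
Proof.
rewrite mem_filter andbC andbA; congr (_ && _); case: p => i j /=.
apply/allpairsP/andP=> [[[x y] /=]|[lti ltj]].
  by rewrite !mem_iota => -[lx ly [-> ->]]; split.
by exists (i, j); rewrite /= !mem_iota.
Qed.

(** Different codes come from different sets, so a lower bound on a number of lines reduces to the
    length of a list that computes. *)
Lemma codes_card (I : finType) (LL : {set I}) (c : I -> seq bool) cs :
  uniq cs -> (forall w, w \in cs -> exists2 X, X \in LL & c X = w) ->
  size cs <= #|LL|.
Proof.
move=> ucs h; rewrite cardE -(size_map c); apply: uniq_leq_size => // w /h[X XL <-].
by apply: map_f; rewrite mem_enum.
Qed.

Hypotheses (e_sym : symmetric e) (e_irr : irreflexive e) (e_conn : connected e).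
Variables (S : {set T}) (t : seq T) (A : seq (seq nat)) (x0 : T).
Hypotheses (tA : tab e S t A) (dA : diam2 A).
Local Notation f i := (nth x0 t i).
Local Notation n := (size A).

Lemma tab_in i : i < n -> f i \in S.
Proof. by case: tA => _ <- <- _; apply: mem_nth. Qed.

Lemma tab_eq i j : i < n -> j < n -> (f i == f j) = (i == j).
Proof. by case: tA => ut _ <- _ lti ltj; apply: nth_uniq. Qed.

Lemma tab_adj i j : i < n -> j < n -> e (f i) (f j) = adj A i j.
Proof. by case: tA => _ _ _ h; apply: h. Qed.

Lemma tab_ex x : x \in S -> exists2 i, i < n & x = f i.
Proof.
by case: tA => _ <- <- _ xt; exists (index x t); rewrite ?index_mem ?nth_index.
Qed.

Lemma tab_card : #|S| = n.
Proof. by case: tA => ut ct <- _; rewrite -(card_uniqP ut); apply: eq_card => x; rewrite ct. Qed.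

(** This is the distance in the whole graph: [diam2] provides a common neighbour inside [S] for each
    nonadjacent pair, so a set with such a table is isometric. *)
Lemma tab_dist i j : i < n -> j < n -> dist e (f i) (f j) = dd A i j.
Proof.
move=> lti ltj; rewrite /dd; have [->|nij] := eqVneq i j; first exact: dist_xx.
have [aij|naij] := boolP (adj A i j).
  by apply: dist_edge; rewrite ?tab_adj.
move/allpairP: dA => /(_ i j lti ltj); rewrite (negbTE nij) (negbTE naij) /=.
case/hasP=> k; rewrite mem_iota => ltk /andP[ik kj].
by apply: (@dist_eq2 _ _ _ _ _ _ (f k)); rewrite ?tab_adj ?tab_eq.
Qed.

Lemma tab_line i j k : i < n -> j < n -> k < n -> i != j ->
  (f k \in line e (f i) (f j)) = ldd A i j k.
Proof. by move=> lti ltj ltk nij; rewrite in_line ?tab_eq // !tab_dist. Qed.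

Definition trace_code (X : {set T}) := [seq f k \in X | k <- iota 0 n].

Lemma trace_code_line i j : i < n -> j < n -> i != j ->
  trace_code (line e (f i) (f j)) = line_code A (i, j).
Proof.
by move=> lti ltj nij; apply/eq_in_map => k; rewrite mem_iota => ltk; apply: tab_line.
Qed.

Lemma trace_code_lines_in X : X \in lines_in e S -> trace_code X \in line_codes A.
Proof.
case/lines_inP=> a [b [/tab_ex[i lti ->] /tab_ex[j ltj ->]]].
rewrite tab_eq // => nij ->; rewrite mem_undup trace_code_line //.
by apply: map_f; rewrite mem_distinct_pairs lti ltj.
Qed.

Lemma line_codes_card : size (line_codes A) <= #|lines_in e S|.
Proof.
apply: (codes_card (c := trace_code)); first exact: undup_uniq.
move=> w; rewrite mem_undup => /mapP[[i j]].
rewrite mem_distinct_pairs /= => /and3P[lti ltj nij] ->.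
exists (line e (f i) (f j)); last exact: trace_code_line.
by apply: mem_lines_in; rewrite ?tab_in ?tab_eq.
Qed.

End Tables.

Lemma tab_val (T : finType) (e : rel T) (S : {set T}) t A :
  tab (induced e S) setT t A -> tab e S (map val t) A.
Proof.
case=> ut ct st at_; split.
- by rewrite map_inj_uniq //; apply: val_inj.
- move=> x; apply/mapP/idP=> [[y _ ->]|xS]; first exact: valP.
  by exists (Sub x xS); rewrite // ct inE.
- by rewrite size_map.
move=> x0 i j lti ltj; have lti' : i < size t by rewrite st.
have [y0 _] : exists y0, y0 \in t.
  by exists (tnth (in_tuple t) (Ordinal lti')); apply: mem_tnth.
by rewrite !(nth_map y0) ?st //; apply: at_.
Qed.

Lemma tab_C4 : exists us, tab C4 setT us adjC4.
Proof.
exists [:: @Ordinal 4 0 isT; @Ordinal 4 1 isT; @Ordinal 4 2 isT; @Ordinal 4 3 isT].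
by apply: (@make_tab _ _ (@Ordinal 4 0 isT)); rewrite ?card_ord //; vm_compute.
Qed.

Lemma tab_K23 : exists us, tab K23 setT us adjK23.
Proof.
exists [:: inl (@Ordinal 2 0 isT); inl (@Ordinal 2 1 isT);
  inr (@Ordinal 3 0 isT); inr (@Ordinal 3 1 isT); inr (@Ordinal 3 2 isT)].
by apply: (@make_tab _ _ (inl (@Ordinal 2 0 isT))); rewrite ?card_sum ?card_ord //; vm_compute.
Qed.

Lemma tab_W4 : exists us, tab W4 setT us adjW4.
Proof.
exists [:: Some (@Ordinal 4 0 isT); Some (@Ordinal 4 1 isT);
  Some (@Ordinal 4 2 isT); Some (@Ordinal 4 3 isT); None].
by apply: (@make_tab _ _ None); rewrite ?card_option ?card_ord //; vm_compute.
Qed.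

Lemma tab_W4' : exists us, tab W4' setT us adjW4'.
Proof.
exists [:: Some (@Ordinal 4 0 isT); Some (@Ordinal 4 1 isT);
  Some (@Ordinal 4 2 isT); Some (@Ordinal 4 3 isT); None].
by apply: (@make_tab _ _ None); rewrite ?card_option ?card_ord //; vm_compute.
Qed.

Lemma tab_K6' : exists us, tab K6' setT us (adj_matching 6).
Proof.
exists [:: @Ordinal 6 0 isT; @Ordinal 6 1 isT; @Ordinal 6 2 isT; @Ordinal 6 3 isT;
  @Ordinal 6 4 isT; @Ordinal 6 5 isT].
by apply: (@make_tab _ _ (@Ordinal 6 0 isT)); rewrite ?card_ord //; vm_compute.
Qed.

Lemma tab_K8' : exists us, tab K8' setT us (adj_matching 8).
Proof.
exists [:: @Ordinal 8 0 isT; @Ordinal 8 1 isT; @Ordinal 8 2 isT; @Ordinal 8 3 isT;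
  @Ordinal 8 4 isT; @Ordinal 8 5 isT; @Ordinal 8 6 isT; @Ordinal 8 7 isT].
by apply: (@make_tab _ _ (@Ordinal 8 0 isT)); rewrite ?card_ord //; vm_compute.
Qed.

Lemma in_family_F_tab (T : finType) (e : rel T) :
  in_family_F e <-> exists2 A, A \in adjF & exists t, tab e setT t A.
Proof.
have [u1 t1] := tab_C4; have [u2 t2] := tab_K23; have [u3 t3] := tab_W4.
have [u4 t4] := tab_W4'; have [u5 t5] := tab_K6'; have [u6 t6] := tab_K8'.
split.
  by case=> [|[|[|[|[|]]]]]
    => [/(isomorphic_tab t1)|/(isomorphic_tab t2)|/(isomorphic_tab t3)
       |/(isomorphic_tab t4)|/(isomorphic_tab t5)|/(isomorphic_tab t6)] h;
    eexists; try exact: h; rewrite !inE eqxx ?orbT.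
case=> A; rewrite !inE => /or4P[/eqP-> | /eqP-> | /eqP-> | /or3P[] /eqP->] [t h].
- by left; apply: tab_isomorphic t1 h.
- by right; left; apply: tab_isomorphic t2 h.
- by do 2 right; left; apply: tab_isomorphic t3 h.
- by do 3 right; left; apply: tab_isomorphic t4 h.
- by do 4 right; left; apply: tab_isomorphic t5 h.
- by do 5 right; apply: tab_isomorphic t6 h.
Qed.

Lemma adjF_diam2 A : A \in adjF -> diam2 A.
Proof. by move: A; apply/allP; vm_compute. Qed.

Lemma induced_family_tab (T : finType) (e : rel T) (S : {set T}) :
  in_family_F (induced e S) -> exists2 A, A \in adjF & exists t, tab e S t A.
Proof.
by case/in_family_F_tab=> A AF [t /tab_val h]; exists A => //; exists (map val t).
Qed.

(** * Gluing at a cut vertex *)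

(* The shape in which the induction hypothesis is used: the lines of an
   isometric subgraph are counted by the lines of the whole graph that they
   extend to. *)
Definition smaller_good (T : finType) (e : rel T) : Prop :=
  forall S y, retract e S y -> #|S| < #|T| -> 2 <= #|S| ->
    ~ in_family_F (induced e S) ->
    #|S| <= #|lines_in e S| + num_bridges (induced e S).

Definition separation (T : finType) (e : rel T) v (A B : {set T}) : Prop :=
  [/\ v \notin A, v \notin B, [disjoint A & B], forall x, x != v -> (x \in A) || (x \in B) &
      forall a b, a \in A -> b \in B -> ~~ e a b].

(** With [r] the cut vertex, this tells whether the line of [i] and [j] contains the other side,
    which it does entirely or not at all ([sep_line_out]). Lines that coincide on the exceptional
    side may differ by this flag. *)
Definition root_flag A r i j := (dd A i j + dd A j r == dd A i r) || (dd A j i + dd A i r == dd A j r).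

Definition root_codes A r :=
  undup [seq root_flag A r p.1 p.2 :: line_code A p | p <- distinct_pairs (size A)].

(** The trace, on the exceptional side, of the line from [i] to any vertex of the other side
    ([cross_trace]). *)
Definition cross_code A r i :=
  [seq (dd A i k + dd A k r == dd A i r) || (dd A k i + dd A i r == dd A k r) | k <- iota 0 (size A)].

Definition cross_ok A r i :=
  [&& i != r, cross_code A r i \notin line_codes A & ~~ all id (cross_code A r i)].

(** Whatever vertex of an exceptional side is the cut vertex, at most two lines are missing, and two
    vertices [i], [j] of this side induce lines with the other side whose traces are new and
    different. *)
Definition root_check A r :=
  (size A <= size (root_codes A r) + 2) &&
  has (fun i => has (fun j => [&& cross_ok A r i, cross_ok A r j & cross_code A r i != cross_code A r j])
     (iota 0 (size A))) (iota 0 (size A)).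

Lemma adjF_root_check A r : A \in adjF -> r < size A -> root_check A r.
Proof.
move=> AF ltr; suff /allP/(_ r) : all (root_check A) (iota 0 (size A)).
  by apply; rewrite mem_iota.
by move: A AF {r ltr}; apply/allP; vm_compute.
Qed.

Section Glue.
Variables (T : finType) (e : rel T).
Hypotheses (e_sym : symmetric e) (e_irr : irreflexive e) (e_conn : connected e).
Implicit Types (a b c v x y z : T) (A B S X : {set T}).
Local Notation d := (dist e).

Lemma separationC v A B : separation e v A B -> separation e v B A.
Proof.
case=> vA vB dis cov ne; split=> // [|x xv|a b aB bA].
- by rewrite disjoint_sym.
- by rewrite orbC cov.
- by rewrite e_sym ne.
Qed.

Section Side.
Variables (v : T) (A B : {set T}).
Hypothesis sep : separation e v A B.

Let dtri := dist_triangle e_conn.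
Let dsym := dist_sym e_sym e_conn.

Lemma sep_cases x : [\/ x = v, x \in A | x \in B].
Proof.
case: sep => _ _ _ cov _; have [->|/cov/orP[]] := eqVneq x v; first by constructor 1.
  by constructor 2.
by constructor 3.
Qed.

Lemma sep_notin x : x \in A -> x \notin B.
Proof. by case: sep => _ _ dis _ _ xA; rewrite (disjointFr dis). Qed.

Lemma sep_neqB b : b \in B -> b != v.
Proof. by case: sep => _ vB _ _ _; apply: contraTneq => ->. Qed.

Lemma sep_edge a z : a \in A -> z \notin v |: A -> ~~ e a z.
Proof.
case: sep => _ _ _ _ ne aA; rewrite !inE negb_or => /andP[zv zA].
case: (sep_cases z) => [zE|zE|zB]; last exact: ne.
  by rewrite zE eqxx in zv.
by rewrite zE in zA.
Qed.

Lemma sep_retract : retract e (v |: A) v.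
Proof.
split=> [|x z]; first by rewrite !inE eqxx.
rewrite {1}inE => /orP[/set1P->|xA]; first by left.
by move=> zS /idPn[]; apply: sep_edge.
Qed.

(** Induction along a geodesic from [a] to [z]: as long as [a] is not [v], its next vertex is still
    in [v |: A]. *)
Lemma sep_dist a z : a \in v |: A -> z \in v |: B -> d a z = d a v + d v z.
Proof.
move=> aS zS; apply/eqP; rewrite eqn_leq dtri /=.
move: {2}(d a z) (leqnn (d a z)) => n; elim: n a aS => [|n IH] a aS.
  rewrite leqn0 dist_eq0 // => /eqP az; rewrite -az in zS *.
  move: aS zS; rewrite !inE; have [->|_] := eqVneq a v; first by rewrite !dist_xx.
  by move=> /sep_notin/negbTE->.
have [->|nav] := eqVneq a v; first by rewrite dist_xx.
have aA : a \in A by move: aS; rewrite !inE (negbTE nav).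
have naz : a != z.
  apply: contraTneq zS => <-; rewrite !inE (negbTE nav) /=; exact: sep_notin.
case: (dist_step e_irr e_conn naz) => c eac -> le.
have cS : c \in v |: A by apply: contraLR eac => cS; apply: sep_edge.
have := IH c cS; have := dtri a c v; rewrite (dist_edge e_irr e_conn eac); lia.
Qed.

(** Distances to [z] pass through [v], so [d v z] cancels from the equations with [z] at an end, and
    the answer is the same for all [z]. That [z] lies between [a] and [b] would contradict the
    triangle inequality at [v]. *)
Lemma sep_line_out a b z : a \in v |: A -> b \in v |: A -> a != b -> z \in B ->
  (z \in line e a b) = (d a b + d b v == d a v) || (d b a + d a v == d b v).
Proof.
move=> aS bS nab zB; have zS : z \in v |: B by rewrite !inE zB orbT.
have := sep_neqB zB; rewrite -(dist_gt0 e_conn) (dsym z v) => dzv.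
rewrite in_line // (dsym z a) (dsym z b) (sep_dist aS zS) (sep_dist bS zS).
have := dtri a v b; rewrite (dsym b a) (dsym v b); lia.
Qed.

Lemma sep_line_sub X z : z \in B -> X \in lines_in e (v |: A) -> z \in X ->
  v |: B \subset X.
Proof.
move=> zB /lines_inP[p [q [pS qS npq ->]]]; rewrite sep_line_out // => h.
apply/subsetP=> w; rewrite in_setU1 => /orP[/eqP->|wB]; last by rewrite sep_line_out.
move: h; rewrite in_line // (dsym v p) (dsym q p) (dsym v q); lia.
Qed.

(** Again the distance from [v] to the far vertex cancels, so the trace on the side of [a] does not
    depend on [b]. *)
Lemma cross_trace a b x : a \in A -> b \in B -> x \in v |: A ->
  (x \in line e a b) = (d a x + d x v == d a v) || (d x a + d a v == d x v).
Proof.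
move=> aA bB xS; have nab : a != b by apply: contraTneq aA => ->; apply: contraL bB; exact: sep_notin.
have aS : a \in v |: A by rewrite !inE aA orbT.
have bS : b \in v |: B by rewrite !inE bB orbT.
have := sep_neqB bB; rewrite -(dist_gt0 e_conn) (dsym b v) => dbv.
rewrite in_line // (dsym b x) (sep_dist aS bS) (sep_dist xS bS).
have := dtri a v x; rewrite (dsym v x); lia.
Qed.

Lemma family_side : B != set0 -> in_family_F (induced e (v |: A)) ->
  #|v |: A| <= #|lines_in e (v |: A)| + 2 /\
  exists a1 a2, [/\ a1 \in A, a2 \in A &
    forall b, b \in B ->
     [/\ line e a1 b :&: (v |: A) != line e a2 b :&: (v |: A),
         forall X, X \in lines_in e (v |: A) -> line e a1 b :&: (v |: A) != X :&: (v |: A),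
         forall X, X \in lines_in e (v |: A) -> line e a2 b :&: (v |: A) != X :&: (v |: A),
         ~~ (v |: A \subset line e a1 b) & ~~ (v |: A \subset line e a2 b)]].
Proof.
move=> /set0Pn[z zB] /induced_family_tab[A' AF [t tA]].
have dA := adjF_diam2 AF.
have [r ltr vr] : exists2 r, r < size A' & v = nth v t r.
  by apply: (tab_ex v tA); rewrite !inE eqxx.
have /andP[ch1 /hasP[i + /hasP[j + /and3P[oi oj nij]]]] := adjF_root_check AF ltr.
rewrite !mem_iota /= => lti ltj.
have fin := tab_in v tA.
have feq := tab_eq v tA.
have fd := tab_dist e_irr e_conn v tA dA.
have fdr k : k < size A' -> d (nth v t k) v = dd A' k r by move=> ltk; rewrite {2}vr fd.
split.
  rewrite (tab_card tA); apply: leq_trans ch1 _; rewrite leq_add2r.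
  (* The leading bit realises [root_flag]: [z] is a fixed vertex of the other side. *)
  apply: (codes_card (c := fun X => (z \in X) :: trace_code t A' v X)).
    exact: undup_uniq.
  move=> w; rewrite mem_undup => /mapP[[p q]]; rewrite mem_distinct_pairs /= => /and3P[ltp ltq npq] ->.
  exists (line e (nth v t p) (nth v t q)).
    by apply: mem_lines_in; rewrite ?fin ?feq.
  rewrite (trace_code_line e_irr e_conn v tA dA) //; congr (_ :: _).
  by rewrite sep_line_out ?fin ?feq // !fdr // !fd.
have inA k : k < size A' -> k != r -> nth v t k \in A.
  by move=> ltk nkr; have := fin k ltk; rewrite !inE {2}vr feq // (negbTE nkr).
have code k b : k < size A' -> k != r -> b \in B ->
    trace_code t A' v (line e (nth v t k) b) = cross_code A' r k.
  move=> ltk nkr bB; apply/eq_in_map => m; rewrite mem_iota => ltm.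
  by rewrite cross_trace ?inA ?fin // !fdr // !fd.
have trI X Y : X :&: (v |: A) = Y :&: (v |: A) -> trace_code t A' v X = trace_code t A' v Y.
  move=> XY; apply/eq_in_map => m; rewrite mem_iota => ltm.
  by move/setP/(_ (nth v t m)): XY; rewrite !(in_setI, fin m ltm) !andbT.
have okP k b : k < size A' -> cross_ok A' r k -> b \in B ->
   (forall X, X \in lines_in e (v |: A) -> line e (nth v t k) b :&: (v |: A) != X :&: (v |: A))
   /\ ~~ (v |: A \subset line e (nth v t k) b).
  move=> ltk /and3P[kr kl ka] bB; split.
    move=> X XL; apply: contraNneq kl => /trI; rewrite code // => ->.
    exact: trace_code_lines_in XL.
  apply: contra ka => /subsetP sub; rewrite -(code k b) //.
  by apply/allP=> ? /mapP[m +  ->]; rewrite mem_iota => ltm; apply/sub/fin.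
have [ir jr] : i != r /\ j != r by case/and3P: oi => -> _ _; case/and3P: oj.
exists (nth v t i), (nth v t j); rewrite !inA //; split=> // b bB.
have [oi1 oi2] := okP i b lti oi bB; have [oj1 oj2] := okP j b ltj oj bB.
by split=> //; apply: contraNneq nij => /trI; rewrite !code // => ->.
Qed.

(** If the whole graph stays connected without the edge, the retraction onto the side carries its
    walks to walks of the side without the edge: edges leaving the side do so at [v] and collapse to
    a point. *)
Lemma bridge_image (f : {set {x | x \in v |: A}}) :
  f \in bridges (induced e (v |: A)) -> (val @: f) \in bridges e.
Proof.
rewrite !inE => /andP[/imsetP[[p q]]]; rewrite inE /= => epq ->.
have imE : val @: [set p; q] = [set val p; val q] by rewrite imsetU !imset_set1.
rewrite imE => /negP nb; apply/andP; split.
  by apply/imsetP; exists (val p, val q); rewrite ?inE.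
apply: contra_notN nb => /connectedP cn; apply/connectedP=> a b.
rewrite -(to_retract_val sep_retract a) -(to_retract_val sep_retract b).
apply: connect_homo (cn (val a) (val b)) => x y /andP[exy nxy].
have [xS|xS] := boolP (x \in v |: A); have [yS|yS] := boolP (y \in v |: A).
- apply: connect1; apply/andP; split; first by rewrite /induced /= !val_to_retract.
  apply: contraNneq nxy => /(congr1 (fun f : {set {x | x \in v |: A}} => val @: f)).
  by rewrite imE imsetU !imset_set1 !val_to_retract // => ->.
- have xv : x = v.
    by move: xS; rewrite in_setU1 => /orP[/eqP//|/sep_edge/(_ yS)]; rewrite exy.
  suff -> : to_retract sep_retract x = to_retract sep_retract y by [].
  by apply: val_inj; rewrite val_to_retract // to_retract_out.
- have yv : y = v.
    by move: yS; rewrite in_setU1 => /orP[/eqP//|/sep_edge/(_ xS)]; rewrite e_sym exy.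
  suff -> : to_retract sep_retract x = to_retract sep_retract y by [].
  by apply: val_inj; rewrite [RHS]val_to_retract // to_retract_out.
- suff -> : to_retract sep_retract x = to_retract sep_retract y by [].
  by apply: val_inj; rewrite !to_retract_out.
Qed.

End Side.

(** An edge in both sides would have both ends equal to [v], so the two images are disjoint. *)
Lemma separation_bridges v A B : separation e v A B ->
  num_bridges (induced e (v |: A)) + num_bridges (induced e (v |: B)) <= num_bridges e.
Proof.
move=> sep; pose im S := [set (val @: (f : {set {x | x \in S}})) | f in bridges (induced e S)].
have vi S : injective (fun f : {set {x | x \in S}} => val @: f : {set T}) by apply: imset_inj val_inj.
have cim S : num_bridges (induced e S) = #|im S| by rewrite card_imset //; apply: vi.
rewrite (cim (v |: A)) (cim (v |: B)) -cardsUI.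
have -> : im (v |: A) :&: im (v |: B) = set0.
  apply/setP=> X; rewrite !inE; apply/negP=> /andP[/imsetP[f fb ->] /imsetP[g gb fg]].
  move: fb; rewrite inE => /andP[/imsetP[[p q]]]; rewrite inE /= => epq fE _.
  have inI (x : {x | x \in v |: A}) : x \in f -> val x = v.
    move=> xf; have : val x \in v |: B.
      have : val x \in val @: f by apply: imset_f.
      by rewrite fg => /imsetP[y _ ->]; apply: valP.
    have := valP x; rewrite !in_setU1; case: eqP => //= _ /(sep_notin sep)/negbTE->.
    by [].
  have pv : val p = v by apply: inI; rewrite fE !inE eqxx.
  have qv : val q = v by apply: inI; rewrite fE !inE eqxx orbT.
  by move: epq; rewrite /induced /= pv qv e_irr.
rewrite cards0 addn0; apply/subset_leq_card; rewrite subUset.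
by apply/andP; split; apply/subsetP=> ? /imsetP[f fb ->];
  [apply: (bridge_image sep)|apply: (bridge_image (separationC sep))].
Qed.

End Glue.

(** * Counting lines and bridges across a cut vertex *)

Section CutVertex.
Variables (T : finType) (e : rel T).
Hypotheses (e_sym : symmetric e) (e_irr : irreflexive e) (e_conn : connected e).
Hypothesis IH : smaller_good e.
Implicit Types (a b c v x y z : T) (A B S X : {set T}).
Local Notation d := (dist e).

(** The bookkeeping common to the cut-vertex, twin, module and universal-vertex counts: two
    families, their overlap, and a list of lines outside both. *)
Lemma extra_lines (L1 L2 : {set {set T}}) (ls : seq {set T}) :
  L1 \subset lines e -> L2 \subset lines e -> uniq ls ->
  (forall X, X \in ls -> [/\ X \in lines e, X \notin L1 & X \notin L2]) ->
  #|L1| + #|L2| + size ls <= num_lines e + #|L1 :&: L2|.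
Proof.
move=> s1 s2 uls h; rewrite -cardsUI -addnAC leq_add2r -(card_uniqP uls).
have -> : #|ls| = #|[set X in ls]| by apply: eq_card => X; rewrite inE.
rewrite -cardsUI.
have -> : (L1 :|: L2) :&: [set X in ls] = set0.
  apply/setP=> X; rewrite !inE; apply/negP=> /andP[+ /h[_ n1 n2]].
  by rewrite (negbTE n1) (negbTE n2).
rewrite cards0 addn0; apply/subset_leq_card; rewrite !subUset s1 s2.
by apply/subsetP=> X; rewrite inE => /h[].
Qed.

Section Parts.
Variables (v : T) (A B : {set T}).
Hypothesis sep : separation e v A B.

Let sepC := separationC e_sym sep.

(** One of the two vertices inducing the line on a given side is not [v]; the line, seen from the
    opposite side, then contains the whole given side ([sep_line_sub]). By symmetry it is
    everything. *)
Lemma sep_overlap : #|lines_in e (v |: A) :&: lines_in e (v |: B)| <= 1.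
Proof.
rewrite -(cards1 [set: T]); apply/subset_leq_card/subsetP=> X.
rewrite in_setI in_set1 => /andP[X1 X2].
have sub C D : separation e v C D -> X \in lines_in e (v |: C) -> X \in lines_in e (v |: D) ->
    v |: D \subset X.
  move=> sCD XC /lines_inP[p [q [pS qS npq XE]]].
  have [z zD zX] : exists2 z, z \in D & z \in X.
    move: pS qS; rewrite !in_setU1 => /orP[/eqP pv|pD] => [|_]; last first.
      by exists p; rewrite // XE in_line_l.
    move=> /orP[/eqP qv|qD]; last by exists q; rewrite // XE in_line_r.
    by rewrite pv qv eqxx in npq.
  exact: (sep_line_sub e_sym e_irr e_conn sCD zD XC zX).
have s1 := sub _ _ sep X1 X2; have s2 := sub _ _ sepC X2 X1.
apply/eqP/setP=> x; rewrite inE; case: (sep_cases sep x) => [->|xA|xB].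
- by apply: (subsetP s1); rewrite !inE eqxx.
- by apply: (subsetP s2); rewrite !inE xA orbT.
- by apply: (subsetP s1); rewrite !inE xB orbT.
Qed.

Lemma sep_card : #|v |: A| + #|v |: B| = #|T|.+1.
Proof.
case: sep => vA vB dis _ _.
rewrite !cardsU1 vA vB -cardsT.
have -> : [set: T] = v |: (A :|: B).
  by apply/setP=> x; rewrite !inE; case: (sep_cases sep x) => [->|->|->]; rewrite ?eqxx ?orbT.
rewrite cardsU1 !inE (negbTE vA) (negbTE vB) cardsU.
have -> : A :&: B = set0 by apply/eqP; rewrite setI_eq0.
by rewrite cards0; lia.
Qed.

Hypotheses (A0 : A != set0) (B0 : B != set0).

Lemma sep_small : 2 <= #|v |: A| /\ #|v |: A| < #|T|.
Proof.
have := sep_card; case: sep => vA vB _ _ _.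
have := A0; have := B0; rewrite -!card_gt0 !cardsU1 vA vB; lia.
Qed.

Lemma sep_side_good : ~ in_family_F (induced e (v |: A)) ->
  #|v |: A| <= #|lines_in e (v |: A)| + num_bridges (induced e (v |: A)).
Proof. by have [g2 lt] := sep_small; apply: IH => //; apply: (sep_retract sep). Qed.

Lemma sep_cross_new a b : a \in A -> b \in B ->
  (forall X, X \in lines_in e (v |: A) -> line e a b :&: (v |: A) != X :&: (v |: A)) ->
  ~~ (v |: A \subset line e a b) ->
  [/\ line e a b \in lines e, line e a b \notin lines_in e (v |: A)
    & line e a b \notin lines_in e (v |: B)].
Proof.
move=> aA bB n1 n2; split.
- by apply: mem_lines; apply: contraTneq aA => ->; apply: contraL bB; apply: (sep_notin sep).
- by apply/negP=> /n1; rewrite eqxx.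
- apply: contra n2 => X2; apply: (sep_line_sub e_sym e_irr e_conn sepC aA X2).
  exact: in_line_l.
Qed.

Lemma sep_cross_trace a b b' : a \in A -> b \in B -> b' \in B ->
  line e a b :&: (v |: A) = line e a b' :&: (v |: A).
Proof.
move=> aA bB b'B; apply/setP=> x; rewrite !in_setI andbC [RHS]andbC; case xS: (x \in v |: A) => //=.
by rewrite !(cross_trace e_sym e_irr e_conn sep).
Qed.

End Parts.

Lemma cut_one v A B : separation e v A B -> A != set0 -> B != set0 ->
  in_family_F (induced e (v |: A)) -> ~ in_family_F (induced e (v |: B)) ->
  #|T| <= num_lines e + num_bridges e.
Proof.
move=> sep A0 B0 FA nFB; have sepC := separationC e_sym sep.
have [c1 [a1 [a2 [a1A a2A h]]]] := family_side e_sym e_irr e_conn sep B0 FA.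
have g2 := sep_side_good sepC B0 A0 nFB.
have /set0Pn[b bB] := B0; have [n12 n1 n2 s1 s2] := h b bB.
have uls : uniq [:: line e a1 b; line e a2 b].
  by rewrite /= inE andbT; apply: contraNneq n12 => ->.
have new X : X \in [:: line e a1 b; line e a2 b] ->
    [/\ X \in lines e, X \notin lines_in e (v |: A) & X \notin lines_in e (v |: B)].
  by rewrite !inE => /orP[]/eqP->; apply: sep_cross_new.
have := extra_lines (lines_in_sub e _) (lines_in_sub e _) uls new.
move: c1 g2; have := sep_overlap sep; have := sep_card sep; have := separation_bridges e_sym e_irr sep.
card_lia.
Qed.

(** Up to four lines are missing, two for each side, and the four lines from [a1], [a2] to [b1],
    [b2] replace them: those with different ends in [A] differ on [v |: A], those with the same end
    in [A] differ on [v |: B]. *)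
Lemma cut_both v A B : separation e v A B -> A != set0 -> B != set0 ->
  in_family_F (induced e (v |: A)) -> in_family_F (induced e (v |: B)) ->
  #|T| <= num_lines e + num_bridges e.
Proof.
move=> sep A0 B0 FA FB; have sepC := separationC e_sym sep.
have [c1 [a1 [a2 [a1A a2A ha]]]] := family_side e_sym e_irr e_conn sep B0 FA.
have [c2 [b1 [b2 [b1B b2B hb]]]] := family_side e_sym e_irr e_conn sepC A0 FB.
have [na1 n11 n21 s11 s21] := ha b1 b1B; have [na2 n12 n22 s12 s22] := ha b2 b2B.
have tr a : a \in A -> line e a b1 :&: (v |: A) = line e a b2 :&: (v |: A).
  by move=> aA; apply: (sep_cross_trace sep).
have nb a : a \in A -> line e a b1 != line e a b2.
  move=> aA; have [+ _ _ _ _] := hb a aA; apply: contraNneq.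
  by rewrite !(line_sym e_sym e_conn _ a) => ->.
have uls : uniq [:: line e a1 b1; line e a1 b2; line e a2 b1; line e a2 b2].
  have t1 := tr _ a1A; have t2 := tr _ a2A.
  have n1 X Y : X :&: (v |: A) = line e a1 b1 :&: (v |: A) ->
      Y :&: (v |: A) = line e a2 b1 :&: (v |: A) -> X != Y.
    by move=> XE YE; apply: contraNneq na1 => XY; rewrite -XE -YE XY.
  by rewrite /= !inE !negb_or !nb //= !n1.
have new X : X \in [:: line e a1 b1; line e a1 b2; line e a2 b1; line e a2 b2] ->
    [/\ X \in lines e, X \notin lines_in e (v |: A) & X \notin lines_in e (v |: B)].
  by rewrite !inE => /or4P[]/eqP->; apply: sep_cross_new.
have := extra_lines (lines_in_sub e _) (lines_in_sub e _) uls new.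
move: c1 c2; have := sep_overlap sep; have := sep_card sep.
card_lia.
Qed.

Lemma cut_vertex_case v A B : separation e v A B -> A != set0 -> B != set0 ->
  #|T| <= num_lines e + num_bridges e.
Proof.
move=> sep A0 B0; have sepC := separationC e_sym sep.
(* Membership in the family is not a boolean; the case distinction is allowed because the goal is
   one. *)
apply: (@classic_EM (in_family_F (induced e (v |: A)))) => -[FA|nFA];
apply: (@classic_EM (in_family_F (induced e (v |: B)))) => -[FB|nFB].
- exact: cut_both FA FB.
- exact: cut_one FA nFB.
- exact: cut_one sepC B0 A0 FB nFA.
have := sep_side_good sep A0 B0 nFA; have := sep_side_good sepC B0 A0 nFB.
have := sep_overlap sep; have := sep_card sep; have := separation_bridges e_sym e_irr sep.
have new X : X \in [::] ->
    [/\ X \in lines e, X \notin lines_in e (v |: A) & X \notin lines_in e (v |: B)] by [].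
have := extra_lines (lines_in_sub e _) (lines_in_sub e _) (ls := [::]) isT new.
card_lia.
Qed.
End CutVertex.

Lemma nocut_or_separation (T : finType) (e : rel T) : symmetric e ->
  nocut e \/ exists v A B, [/\ separation e v A B, A != set0 & B != set0].
Proof.
move=> e_sym.
pose P := [forall v, forall a, forall b, (a != v) ==> (b != v) ==> connect (avoid e v) a b].
have [h|] := boolP P.
  left=> v a b av bv; move/forallP/(_ v)/forallP/(_ a)/forallP/(_ b): h.
  by rewrite av bv.
rewrite !negb_forall => /existsP[v]; rewrite negb_forall => /existsP[a].
rewrite negb_forall => /existsP[b]; rewrite !negb_imply => /and3P[av bv nc]; right.
exists v, [set x | (x != v) && connect (avoid e v) a x], [set x | (x != v) && ~~ connect (avoid e v) a x].
split; first split.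
- by rewrite inE eqxx.
- by rewrite inE eqxx.
- by rewrite -setI_eq0; apply/eqP/setP=> x; rewrite !inE; case: connect; rewrite ?andbF.
- by move=> x xv; rewrite !inE xv; case: connect.
- move=> x y; rewrite !inE => /andP[xv cx] /andP[yv]; apply: contraNN => exy.
  by apply: connect_trans cx _; apply: connect1; apply/and3P.
- by apply/set0Pn; exists a; rewrite inE av connect0.
- by apply/set0Pn; exists b; rewrite inE bv nc.
Qed.

(** * Chordal graphs *)

Definition within (T : finType) (e : rel T) (C : {set T}) : rel T :=
  [rel x y | [&& x \in C, y \in C & e x y]].

Definition linked (T : finType) (e : rel T) (C : {set T}) : Prop :=
  forall a b, a \in C -> b \in C -> connect (within e C) a b.

Lemma within_sym (T : finType) (e : rel T) (C : {set T}) :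
  symmetric e -> symmetric (within e C).
Proof. by move=> e_sym x y; rewrite /within /= e_sym andbCA. Qed.

Lemma next_nth_uniq (T : eqType) (x0 : T) s i : uniq s -> i < size s ->
  next s (nth x0 s i) = nth x0 s (if i.+1 < size s then i.+1 else 0).
Proof.
move=> us lti; rewrite next_nth mem_nth // index_uniq //.
case: s us lti => //= y s us; rewrite !ltnS.
case: ltnP => [ltis _|]; first exact: set_nth_default.
by move=> le _; rewrite nth_default.
Qed.

Section Chordal.
Variables (T : finType) (e : rel T).
Hypotheses (e_sym : symmetric e) (e_irr : irreflexive e) (e_ch : chordal e).
Implicit Types (a b c p q s v w x y z : T) (A B C K S : {set T}) (l : seq T).

(** Chordality in terms of positions: the second alternative is the edge that closes the cycle. *)
Lemma no_hole x0 l : ucycle e l -> 4 <= size l ->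
  (forall i j, i < j < size l -> e (nth x0 l i) (nth x0 l j) ->
     j = i.+1 \/ i = 0 /\ j.+1 = size l) -> False.
Proof.
move=> cl sl h; have [x [y [xl yl exy n1 n2]]] := e_ch cl sl.
have ul := ucycle_uniq cl.
have wlog_lt u v : u \in l -> v \in l -> e u v -> index u l < index v l ->
    v = next l u \/ u = next l v.
  move=> ul' vl euv lt; have ltv : index v l < size l by rewrite index_mem.
  have ltu : index u l < size l by rewrite index_mem.
  have := h (index u l) (index v l); rewrite lt ltv !nth_index // => /(_ isT euv).
  case=> [E|[E1 E2]]; [left|right].
    by rewrite -{1}(nth_index x0 ul') next_nth_uniq // -E ltv nth_index.
  by rewrite -{1}(nth_index x0 vl) next_nth_uniq // E2 ltnn -E1 nth_index.
case: (ltngtP (index x l) (index y l)) => lt.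
- by case: (wlog_lt _ _ xl yl exy lt) => E; [rewrite E eqxx in n1|rewrite -E eqxx in n2].
- rewrite e_sym in exy.
  by case: (wlog_lt _ _ yl xl exy lt) => E; [rewrite E eqxx in n2|rewrite -E eqxx in n1].
by move: exy; rewrite -(nth_index x0 xl) lt nth_index // e_irr.
Qed.

(** A geodesic of the subgraph on [p], [q] and [C] with the possible edge [pq] removed: the removal
    forces an interior vertex, and apart from that edge the path is induced. *)
Lemma link C p q : p != q -> p \notin C -> q \notin C ->
  (exists2 a, a \in C & e p a) -> (exists2 b, b \in C & e q b) -> linked e C ->
  exists l, [/\ 0 < size l, {subset l <= C}, path e p (rcons l q),
    uniq (p :: rcons l q) &
    forall i j, i < j <= (size l).+1 ->
      e (nth p (p :: rcons l q) i) (nth p (p :: rcons l q) j) ->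
      j = i.+1 \/ i = 0 /\ j = (size l).+1].
Proof.
move=> npq pC qC [a aC epa] [b bC eqb] lC.
pose D := p |: (q |: C).
pose r := [rel x y | within e D x y && ([set x; y] != [set p; q])].
have npx x y : x \in C -> [set x; y] != [set p; q].
  move=> xC; apply: contraTneq xC => /setP/(_ x); rewrite !inE eqxx /=.
  by case/esym/orP=> /eqP->.
have DC x : x \in C -> x \in D by move=> xC; rewrite !inE xC !orbT.
have [pD qD] : p \in D /\ q \in D by rewrite !inE !eqxx orbT.
have rI x y : x \in D -> y \in D -> e x y -> [set x; y] != [set p; q] -> r x y.
  by move=> xD yD exy nxy; apply/andP; split=> //; apply/and3P.
have cpq : connect r p q.
  apply: (@connect_trans _ _ a).
    by apply: connect1; apply: rI => //; [apply: DC|rewrite setUC npx].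
  apply: (@connect_trans _ _ b); last first.
    by apply: connect1; apply: rI => //; [apply: DC|rewrite e_sym|rewrite npx].
  apply: connect_sub (lC a b aC bC) => x y /and3P[xC yC exy].
  by apply: connect1; apply: rI => //; [apply: DC|apply: DC|rewrite npx].
have [m [rm lm dm]] := geodesic cpq.
case/lastP: m rm lm dm => [|l q']; first by move=> _ /= pq; rewrite pq eqxx in npq.
rewrite last_rcons => + qE; rewrite {q'}qE => rl dm.
have em : path e p (rcons l q) by apply: sub_path rl => x y /andP[/and3P[]].
have um : uniq (p :: rcons l q).
  apply/(uniqP p) => i j; rewrite !inE /= !ltnS => lei lej E.
  by rewrite -(dm _ lei) -(dm _ lej) E.
have inD x : x \in rcons l q -> x \in D.
  move=> xl; elim: (rcons l q) (p) rl xl => //= y k IH z /andP[/andP[/and3P[_ yD _] _] pk].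
  by rewrite inE => /orP[/eqP->//|]; apply: IH pk.
have lC' : {subset l <= C}.
  move=> x xl; have := inD x; rewrite mem_rcons inE xl orbT => /(_ isT).
  move: um; rewrite /= mem_rcons inE negb_or rcons_uniq => /and3P[/andP[_ pl] ql _].
  by rewrite !inE; case: eqP => [E|_]; [rewrite -E xl in pl|case: eqP => [E|_ //]; rewrite -E xl in ql].
exists l; split=> //.
  by case: l rl {dm em um inD lC'} => //=; rewrite eqxx andbF.
move=> i j /andP[lij lej] eij.
have [/andP[/eqP i0 /eqP jl]|nij] := boolP ((i == 0) && (j == (size l).+1)).
  by right; rewrite i0 jl.
left; have lei : i <= size (rcons l q) by rewrite size_rcons; nlia.
have lej' : j <= size (rcons l q) by rewrite size_rcons.
have mD k : k <= size (rcons l q) -> nth p (p :: rcons l q) k \in D.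
  by case: k => [//|k] ltk /=; apply/inD/mem_nth.
have rij : r (nth p (p :: rcons l q) i) (nth p (p :: rcons l q) j).
  apply: rI; rewrite ?mD //; apply: contra nij => /eqP/setP E.
  have ltj : j < size (p :: rcons l q) by rewrite /= ltnS.
  have lti : i < size (p :: rcons l q) by rewrite /= ltnS.
  have nl : nth p (p :: rcons l q) (size l).+1 = q by rewrite /= nth_rcons ltnn eqxx.
  have pk k : k < size (p :: rcons l q) -> (p == nth p (p :: rcons l q) k) = (0 == k).
    by move=> ltk; apply: (nth_uniq p (i := 0) _ ltk um).
  have qk k : k < size (p :: rcons l q) -> (q == nth p (p :: rcons l q) k) = ((size l).+1 == k).
    by move=> ltk; rewrite -(nth_uniq p _ ltk um) ?nl //= size_rcons.
  have := E p; have := E q; rewrite !in_set2 !pk // !qk // !eqxx orbT /=; nlia.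
have ci : connect r p (nth p (p :: rcons l q) i).
  apply/connectP; exists (take i (rcons l q)); first exact: take_path.
  by rewrite (last_nth p) size_takel //; case: (i) lei => //= k ltk; rewrite nth_take.
(* Positions on a geodesic are distances from [p], and these grow by at most one along an edge. *)
have := dist_step_le ci rij; rewrite !dm //; nlia.
Qed.

(** The argument behind Dirac's theorem that minimal separators of chordal graphs are cliques: if
    [p] and [q] were not adjacent, induced paths through [B] and through [C] would close up to a
    cycle of length at least 4 without a chord. *)
Lemma separator_clique B C p q : p != q -> p \notin B -> q \notin B -> p \notin C -> q \notin C ->
  (forall b c, b \in B -> c \in C -> b != c /\ ~~ e b c) ->
  (exists2 a, a \in B & e p a) -> (exists2 b, b \in B & e q b) -> linked e B ->
  (exists2 a, a \in C & e p a) -> (exists2 b, b \in C & e q b) -> linked e C ->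
  e p q.
Proof.
move=> npq pB qB pC qC nBC pb qb lB pc qc lC; apply/negPn/negP => nepq.
have [l1 [s1 sub1 p1 u1 h1]] := link npq pB qB pb qb lB.
have nqp : q != p by rewrite eq_sym.
have [l2 [s2 sub2 p2 u2 h2]] := link nqp qC pC qc pc lC.
(* On this cycle [p] has position 0 and [q] position [(size l1).+1]; [n1] reads the first path from
   it and [n2] the second, shifted by the position of [q]. *)
pose s := (p :: l1) ++ q :: l2.
have sE : s = (p :: rcons l1 q) ++ l2 by rewrite /s /= cat_rcons.
have ss : size s = (size l1 + size l2).+2 by rewrite /s size_cat /=; nlia.
have n1 i : i <= (size l1).+1 -> nth p s i = nth p (p :: rcons l1 q) i.
  by move=> le; rewrite sE nth_cat /= size_rcons ltnS le.
have n2 i : i <= size l2 -> nth p s (i + (size l1).+1) = nth q (q :: rcons l2 p) i.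
  move=> le; rewrite /s nth_cat /= ltnNge leq_addl /= addnK.
  case: i le => //= i lt; rewrite nth_rcons lt; exact: set_nth_default.
have n2p : nth q (q :: rcons l2 p) (size l2).+1 = p by rewrite /= nth_rcons ltnn eqxx.
apply: (@no_hole p s); last first.
- move=> i j /andP[lij]; rewrite ss => ltj.
  have [lej|ltj'] := leqP j (size l1).+1.
    rewrite !n1 //; last nlia.
    move=> eij; have [|->//|[i0 jl]] := h1 i j _ eij; [by rewrite lij|by left|].
    by move: eij nepq; rewrite i0 jl /= nth_rcons ltnn eqxx => ->.
  have jE : j = (j - (size l1).+1) + (size l1).+1 by nlia.
  have lej2 : j - (size l1).+1 <= size l2 by nlia.
  have [lei|lti] := leqP (size l1).+1 i.
    have iE : i = (i - (size l1).+1) + (size l1).+1 by nlia.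
    rewrite {1}iE {1}jE !n2 //; last nlia.
    by move/h2; nlia.
  have jC : nth p s j \in C.
    rewrite jE n2 //; case: (j - _) lej2 (ltj') jE => [|k] lek ? ?; first nlia.
    by rewrite /= nth_rcons lek; apply/sub2/mem_nth.
  have [i0|i0] := posnP i.
    rewrite i0 {1}jE n2 // => epj; right; split=> //.
    have := h2 (j - (size l1).+1) (size l2).+1; rewrite n2p e_sym.
    by move=> /(_ _ epj); nlia.
  have iB : nth p s i \in B.
    rewrite n1; last exact: ltnW.
    case: (i) i0 lti => //= k _ ltk; rewrite nth_rcons.
    by rewrite -ltnS ltk; apply/sub1/mem_nth.
  by move=> eij; have [_ /negP[]] := nBC _ _ iB jC.
- by rewrite ss; nlia.
rewrite /ucycle; apply/andP; split.
  by rewrite /s /= rcons_cat rcons_cons -cat_rcons cat_path last_rcons p1.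
rewrite sE cat_uniq u1; move: u2; rewrite /= rcons_uniq mem_rcons inE !negb_or.
case/and3P=> /andP[_ ql] pl ->; rewrite andbT /=.
apply/hasPn=> x xl2; rewrite !inE mem_rcons inE !negb_or.
apply/and3P; split; try by apply: contraTneq xl2 => ->.
apply/negP=> xl1; by have [/eqP] := nBC _ _ (sub1 _ xl1) (sub2 _ xl2).
Qed.

(** The path of [link] together with the edge [pq] is a cycle without chords, hence a triangle. *)
Lemma edge_apex C p q : e p q -> p \notin C -> q \notin C ->
  (exists2 a, a \in C & e p a) -> (exists2 b, b \in C & e q b) -> linked e C ->
  exists c, [/\ c \in C, e p c & e q c].
Proof.
move=> epq pC qC pc qc lC; have npq : p != q by apply: contraTneq epq => ->; rewrite e_irr.
have [l [sl sub pl ul h]] := link npq pC qC pc qc lC.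
have [s1|s1] := eqVneq (size l) 1.
  case: l s1 {sl h ul} sub pl => [|c [|//]] //= _ sub /and3P[epc ecq _].
  by exists c; rewrite sub ?inE // epc e_sym ecq.
exfalso; apply: (@no_hole p (p :: rcons l q)).
- by rewrite /ucycle ul andbT /= rcons_path last_rcons pl e_sym.
- by rewrite /= size_rcons; nlia.
move=> i j; rewrite /= size_rcons !ltnS => lij /(h _ _ lij); nlia.
Qed.

Lemma connect_within_mem C x y : connect (within e C) x y -> x \in C -> y \in C.
Proof. by move=> cxy; apply: (connect_ind (P := fun z => z \in C)) cxy => u v /and3P[]. Qed.

(* The component [K] of [S] minus the closed neighbourhood of [v], chosen as
   large as possible over all [v]: every vertex of the rest is then complete to
   the clique [N(K)], and a simplicial vertex of the rest is one of [S]. *)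
Lemma simplicial_in S : S != set0 ->
  exists2 s, s \in S & forall a b, a \in S -> b \in S -> e s a -> e s b -> a != b -> e a b.
Proof.
move: {2}#|S| (leqnn #|S|) => n; elim: n S => [|n IH] S.
  by rewrite leqn0 cards_eq0 => ->.
move=> leS /set0Pn[s0 s0S].
pose bad (p : T * T) := [&& p.1 \in S, p.2 \in S, p.1 != p.2 & ~~ e p.1 p.2].
have [/existsP[p0 bad0]|] := boolP [exists p, bad p]; last first.
  rewrite negb_exists => /forallP ok; exists s0 => // a b aS bS _ _ nab.
  by have := ok (a, b); rewrite /bad /= aS bS nab /= negbK.
pose far v := [set x in S | (x != v) && ~~ e v x].
pose K v w := [set z | connect (within e (far v)) w z].
case: (@arg_maxnP _ p0 bad (fun p : T * T => #|K p.1 p.2|) bad0) => -[v w] /and4P /= [vS wS nvw nevw] maxK.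
have wfar : w \in far v by rewrite inE wS eq_sym nvw.
have Kfar x : x \in K v w -> x \in far v.
  by rewrite inE => /connect_within_mem; apply.
have wK : w \in K v w by rewrite inE connect0.
have ws : symmetric (within e (far v)) by apply: within_sym.
have Kstep x y : x \in K v w -> y \in far v -> e x y -> y \in K v w.
  move=> xK yf exy; rewrite inE; move: (xK); rewrite inE => /connect_trans; apply.
  by apply: connect1; apply/and3P; split=> //; apply: Kfar.
pose C := [set c in S :\: K v w | [exists k in K v w, e c k]].
have CP c : c \in C -> [/\ c \in S, c \notin K v w & exists2 k, k \in K v w & e c k].
  by rewrite !inE => /andP[/andP[cK cS] /exists_inP].
have vC c : c \in C -> e v c.
  move=> /CP[cS cK [k kK eck]]; have kf := Kfar _ kK.
  apply: contraNT cK => nevc; apply: Kstep kK _ _; last by rewrite e_sym.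
  rewrite inE cS nevc andbT /=; apply: contraTneq eck => ->.
  by move: kf; rewrite inE => /and3P[].
have linkK : linked e (K v w).
  have fromw x : x \in K v w -> connect (within e (K v w)) w x.
    rewrite inE => cx.
    suff : x \in K v w /\ connect (within e (K v w)) w x by case.
    apply: (connect_ind (P := fun z => z \in K v w /\ connect (within e (K v w)) w z)) cx _ => //.
    move=> y z /and3P[yf zf eyz] [yK cy]; have zK := Kstep _ _ yK zf eyz; split=> //.
    by apply: connect_trans cy (connect1 _); apply/and3P.
  have ws' : symmetric (within e (K v w)) by apply: within_sym.
  move=> a b aK bK; apply: connect_trans (fromw _ bK).
  by rewrite (sym_connect_sym ws'); apply: fromw.
have cliqueC a b : a \in C -> b \in C -> a != b -> e a b.
  move=> aC bC nab; have [aS aK ak] := CP _ aC; have [bS bK bk] := CP _ bC.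
  have va := vC _ aC; have vb := vC _ bC.
  apply: (@separator_clique [set v] (K v w)) => //.
  - by rewrite inE; apply: contraTneq va => ->; rewrite e_irr.
  - by rewrite inE; apply: contraTneq vb => ->; rewrite e_irr.
  - by move=> ? c /set1P-> /Kfar; rewrite inE eq_sym => /and3P[].
  - by exists v; rewrite ?inE // e_sym.
  - by exists v; rewrite ?inE // e_sym.
  - by move=> ? ? /set1P-> /set1P->; apply: connect0.
pose R := S :\: (K v w :|: C).
have RP x : x \in R -> [/\ x \in S, x \notin K v w & x \notin C].
  by rewrite in_setD in_setU negb_or => /andP[/andP[]].
have vR : v \in R.
  rewrite in_setD in_setU negb_or vS andbT; apply/andP; split.
    by apply/negP=> /Kfar; rewrite inE eqxx andbF.
  by apply/negP=> /vC; rewrite e_irr.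
have RK x k : x \in R -> k \in K v w -> ~~ e x k.
  move=> /RP[xS xK xC] kK; apply: contra xC => exk; rewrite inE in_setD xK xS /=.
  by apply/exists_inP; exists k.
(* Otherwise the component of [w] among the vertices far from [x] contains [K v w] and also [c],
   against maximality. *)
have RC x c : x \in R -> c \in C -> e x c.
  move=> xR cC; apply/negPn/negP => nexc.
  have [xS xK xC] := RP _ xR; have [cS cK [k kK eck]] := CP _ cC.
  have Kfx y : y \in K v w -> y \in far x.
    move=> yK; rewrite inE RK // andbT; have := Kfar _ yK; rewrite inE => /andP[-> _] /=.
    by apply: contraNneq xK => <-.
  have badxw : bad (x, w).
    by have := Kfx _ wK; rewrite /bad inE /= xS wS eq_sym => /and3P[_ -> ->].
  have := maxK _ badxw; rewrite /= leqNgt => /negP[]; apply: proper_card; apply/properP; split.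
    apply/subsetP=> y; rewrite [y \in K v w]inE => cy.
    suff : y \in K v w /\ y \in K x w by case.
    apply: (connect_ind (P := fun z => z \in K v w /\ z \in K x w)) cy _.
      move=> z t /and3P[zf tf ezt] [zK zK']; have tK := Kstep _ _ zK tf ezt; split=> //.
      move: zK'; rewrite !inE => /connect_trans; apply; apply: connect1; apply/and3P.
      by split=> //; apply: Kfx.
    by split=> //; rewrite inE connect0.
  exists c => //; rewrite inE.
  have : connect (within e (far x)) w k.
    have : k \in K v w := kK; rewrite [k \in K v w]inE => ck.
    suff : k \in K v w /\ k \in K x w by rewrite [k \in K x w]inE => -[].
    apply: (connect_ind (P := fun z => z \in K v w /\ z \in K x w)) ck _.
      move=> z t /and3P[zf tf ezt] [zK zK']; have tK := Kstep _ _ zK tf ezt; split=> //.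
      move: zK'; rewrite !inE => /connect_trans; apply; apply: connect1; apply/and3P.
      by split=> //; apply: Kfx.
    by split=> //; rewrite inE connect0.
  move/connect_trans; apply; apply: connect1; apply/and3P; split; first exact: Kfx.
    rewrite inE cS nexc andbT /=; apply: contraNneq xC => <- //.
  by rewrite e_sym.
have [||s sR hs] := IH R.
- rewrite -ltnS; apply: leq_trans leS; apply: proper_card; apply/properP; split.
    by apply/subsetP=> x /RP[].
  by exists w => //; rewrite in_setD in_setU wK.
- by apply/set0Pn; exists v.
have [sS _ _] := RP _ sR; exists s => // a b aS bS esa esb nab.
have part x : x \in S -> e s x -> (x \in R) || (x \in C).
  move=> xS esx; have [xK|xK] := boolP (x \in K v w).
    by move: esx; rewrite (negbTE (RK _ _ sR xK)).
  by rewrite in_setD in_setU xS (negbTE xK) /=; case: (x \in C).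
case/orP: (part _ aS esa) => aP; case/orP: (part _ bS esb) => bP.
- exact: hs.
- exact: RC.
- by rewrite e_sym RC.
- exact: cliqueC.
Qed.

End Chordal.

Lemma nocut_deg2 (T : finType) (e : rel T) s c : irreflexive e -> nocut e -> 3 <= #|T| ->
  e s c -> exists2 c', e s c' & c' != c.
Proof.
move=> e_irr nc T3 esc.
have [r] : exists r, r \notin [set s; c].
  apply/existsP; rewrite -negb_forall; apply: contraTN T3 => /forallP h.
  rewrite -ltnNge -cardsT; apply: leq_ltn_trans (_ : #|[set s; c]| < 3).
    by apply/subset_leq_card/subsetP=> x _; apply: h.
  by rewrite cards2; case: (_ != _).
rewrite !inE negb_or => /andP[rs rc].
have sc : s != c by apply: contraTneq esc => ->; rewrite e_irr.
have [|c' /and3P[esc' _ c'c] _] := connect_first (nc c s r sc rc); first by rewrite eq_sym.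
by exists c'.
Qed.

(** * Lines through a simplicial vertex *)

Section ChordalLines.
Variables (T : finType) (e : rel T).
Hypotheses (e_sym : symmetric e) (e_irr : irreflexive e) (e_conn : connected e).
Hypotheses (e_ch : chordal e) (e_nc : nocut e).
Implicit Types (a b c s x y z : T) (C : {set T}).
Local Notation d := (dist e).

Let dtri := dist_triangle e_conn.
Let dsym := dist_sym e_sym e_conn.
Let d1 := dist_edge e_irr e_conn.

Variable s : T.
Hypothesis s_simpl : forall a b, e s a -> e s b -> a != b -> e a b.

(** A walk through [s] is shortened by the edge between its two neighbours on the way, if these are
    distinct at all. *)
Lemma simplicial_not_between x z : x != s -> z != s -> d x z < d x s + d s z.
Proof.
move=> xs zs; rewrite (eq_sym x) in xs; rewrite (eq_sym z) in zs.
have [a esa da] := dist_step e_irr e_conn xs; have [b esb db] := dist_step e_irr e_conn zs.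
have dab : d a b <= 1.
  have [->|nab] := eqVneq a b; first by rewrite dist_xx.
  by rewrite d1 //; apply: s_simpl.
have := dtri x a z; have := dtri a b z; rewrite (dsym x s) (dsym x a); nlia.
Qed.

Lemma ball_linked n : 0 < n -> linked e [set v | d s v < n].
Proof.
move=> n0; set B := [set _ | _].
have ws : symmetric (within e B) by apply: within_sym.
suff h x : x \in B -> connect (within e B) x s.
  by move=> a b aB bB; apply: connect_trans (h _ aB) _; rewrite (sym_connect_sym ws); apply: h.
move: {2}(d x s) (leqnn (d x s)) => m; elim: m x => [|m IH] x.
  by rewrite leqn0 dist_eq0 // => /eqP->.
have [->//|nxs] := eqVneq x s.
have [c exc dc] := dist_step e_irr e_conn nxs => le xB.
have cB : c \in B by move: xB; rewrite !inE !(dsym s); nlia.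
apply: connect_trans (IH c _ cB); last by nlia.
by apply: connect1; apply/and3P.
Qed.

Lemma upper_connect i z c : d s c + d c z = d s z -> i < d s c ->
  connect (within e [set v | i < d s v]) c z.
Proof.
move: {2}(d c z) (leqnn (d c z)) => m; elim: m c => [|m IH] c.
  by rewrite leqn0 dist_eq0 // => /eqP->.
have [->//|ncz] := eqVneq c z.
have [c' ecc' dc'] := dist_step e_irr e_conn ncz => le E lti.
have := dtri s c c'; have := dtri s c' z; rewrite (d1 ecc') => t1 t2.
apply: connect_trans (IH c' _ _ _); try nlia.
by apply: connect1; apply/and3P; split=> //; rewrite inE; nlia.
Qed.

(** Let [i] be the distance from [s] to [x] and [C] the component of [z] beyond level [i]. A second
    vertex [x'] of level [i] touches [C]; it is adjacent to [x], and both have a common neighbour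
    [c] in [C], which lies on the line of [s] and [x]. If the lines were equal, [c] and then [x']
    would be on both, but [x'] is at the same level as its neighbour [x]. *)
Lemma simplicial_line_inj x z : x != s -> z != s -> x != z -> d s x + d x z = d s z ->
  line e s x <> line e s z.
Proof.
move=> xs zs xz E Lxz; set i := d s x.
have sx : s != x by rewrite eq_sym.
have sz : s != z by rewrite eq_sym.
have i0 : 0 < i by rewrite /i (dist_gt0 e_conn).
have dxz : 0 < d x z by rewrite (dist_gt0 e_conn).
pose U := [set v | i < d s v].
pose C := [set v | connect (within e U) z v].
have zU : z \in U by rewrite inE /i; nlia.
have zC : z \in C by rewrite inE connect0.
have CU v : v \in C -> i < d s v.
  by rewrite inE => /connect_within_mem/(_ zU); rewrite inE.
have Cstep u v : u \in C -> e u v -> i < d s v -> v \in C.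
  move=> uC euv lt; move: (uC); rewrite !inE => /connect_trans; apply.
  by apply: connect1; apply/and3P; split; rewrite // inE // CU.
have wUs : symmetric (within e U) by apply: within_sym.
have linkC : linked e C.
  have fromz v : v \in C -> connect (within e C) z v.
    rewrite inE => cv; suff : v \in C /\ connect (within e C) z v by case.
    apply: (connect_ind (P := fun v => v \in C /\ connect (within e C) z v)) cv _ => //.
    move=> u w /and3P[uU wU euw] [uC cu]; move: (wU); rewrite inE => wU'.
    have wC := Cstep _ _ uC euw wU'; split=> //.
    by apply: connect_trans cu (connect1 _); apply/and3P.
  have ws : symmetric (within e C) by apply: within_sym.
  move=> a b aC bC; apply: connect_trans (fromz _ bC).
  by rewrite (sym_connect_sym ws); apply: fromz.
have xC : x \notin C by apply/negP=> /CU; rewrite ltnn.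
have xnbr : exists2 a, a \in C & e x a.
  have [c exc dc] := dist_step e_irr e_conn xz.
  have := dtri s x c; have := dtri s c z; rewrite (d1 exc) => t1 t2.
  exists c => //; rewrite inE (sym_connect_sym wUs); apply: upper_connect; rewrite /i; nlia.
(* Otherwise [x] alone would separate [C] from [s]. *)
have [x' [xx' x'C dx' x'nbr]] : exists x',
    [/\ x' != x, x' \notin C, d s x' = i & exists2 a, a \in C & e x' a].
  have [/existsP[x' /and3P[xx' /eqP dx' /exists_inP[a aC ea]]]|no] :=
    boolP [exists x', [&& x' != x, d s x' == i & [exists a in C, e x' a]]].
    by exists x'; split=> //; [apply/negP=> /CU; rewrite dx' ltnn|exists a].
  exfalso; have zx : z != x by rewrite eq_sym.
  suff /CU : s \in C by rewrite dist_xx.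
  apply: (connect_ind (P := fun v => v \in C)) (e_nc zx sx) zC.
  move=> u v /and3P[euv ux vx] uC; apply: (Cstep _ _ uC euv).
  rewrite ltnNge; apply: contra no => le; apply/existsP; exists v; rewrite vx /=.
  have := CU _ uC; have := dtri s v u; rewrite (d1 (_ : e v u)) 1?e_sym // => t1 t2.
  apply/andP; split; first by apply/eqP; nlia.
  by apply/exists_inP; exists u; rewrite // e_sym.
pose B := [set v | d s v < i].
have down y : d s y = i -> exists2 a, a \in B & e y a.
  move=> dy; have ys : y != s by rewrite -(dist_gt0 e_conn) dsym dy.
  have [c eyc dc] := dist_step e_irr e_conn ys; exists c => //.
  by rewrite inE -dy !(dsym s) dc.
have exx' : e x x'.
  apply: (@separator_clique _ _ e_sym e_irr e_ch B C) => //; rewrite 1?eq_sym //.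
  - by rewrite inE /i ltnn.
  - by rewrite inE dx' ltnn.
  - move=> b c; rewrite inE => lt /CU lt'; split; first by apply: contraTneq lt' => <-; nlia.
    by apply/negP=> /d1 E1; have := dtri s b c; nlia.
  - exact: down.
  - exact: down.
  - exact: ball_linked.
have [c [cC exc ex'c]] := edge_apex e_sym e_irr e_ch exx' xC x'C xnbr x'nbr linkC.
have dc : d s c = i.+1.
  by have := CU _ cC; have := dtri s x c; rewrite (d1 exc) -/i; nlia.
have cs : c != s by rewrite -(dist_gt0 e_conn) dsym dc.
have cLx : c \in line e s x by rewrite in_line // (d1 exc) dc -/i addn1 eqxx.
(* Since [c] is on the line of [s] and [z] and [s] is never between, either [c = z] or [c] lies
   between [s] and [z]; in both cases the neighbour [x'] of [c], one level lower, lies between them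
   too. *)
have x'Lx : x' \in line e s x.
  rewrite Lxz in_line //; move: cLx; rewrite Lxz in_line //.
  have := simplicial_not_between cs zs; have := dtri s x' z; have := dtri x' c z.
  have := d1 ex'c; have := dist_eq0 e_conn z c; have := CU _ zC.
  move=> h1 h2 h3 h4 h5 h6 /or3P[] /eqP h7.
  - have z0 : d z c = 0 by nlia.
    by move: h2; rewrite z0 eqxx => /esym/eqP zc; move: h3; rewrite -zc; nlia.
  - by apply/orP; right; apply/orP; left; nlia.
  - by nlia.
move: x'Lx; rewrite in_line // (dsym x' s) dx' (d1 exx') (dsym x' x) (d1 exx') -/i; nlia.
Qed.

Lemma simplicial_lines : 3 <= #|T| -> #|T| <= num_lines e.
Proof.
move=> T3; have T0 : exists r, r != s.
  apply/existsP; rewrite -negb_forall; apply: contraTN T3 => /forallP h.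
  rewrite -ltnNge -cardsT; apply: leq_ltn_trans (_ : #|[set s]| < 3).
    by apply/subset_leq_card/subsetP=> x _; rewrite inE; apply: h.
  by rewrite cards1.
have [r rs] := T0; have sr : s != r by rewrite eq_sym.
have [a esa _] := dist_step e_irr e_conn sr.
have [b esb nba] := nocut_deg2 e_irr e_nc T3 esa.
have eab : e a b by apply: s_simpl; rewrite // eq_sym.
have nab : a != b by rewrite eq_sym.
have inj : {in [set~ s] &, injective (line e s)}.
  move=> x z; rewrite !inE => xs zs Lxz; apply/eqP/negPn/negP => xz.
  have sx : s != x by rewrite eq_sym.
  have sz : s != z by rewrite eq_sym.
  have : z \in line e s x by rewrite Lxz in_line_r.
  rewrite in_line //; case/or3P=> /eqP E.
  - exact: (simplicial_line_inj xs zs xz E).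
  - by apply: (@simplicial_line_inj z x) => //; rewrite 1?eq_sym // E.
  - by have := simplicial_not_between zs xs; rewrite E ltnn.
have -> : #|T| = #|line e a b |: line e s @: [set~ s]|.
  rewrite cardsU1 (card_in_imset inj) cardsC1.
  (* The vertices [s], [a], [b] form a triangle, so [s] is not on this line. *)
  have -> : line e a b \notin line e s @: [set~ s].
    apply/imsetP=> -[x]; rewrite !inE => xs E; have := in_line_l e s x.
    by rewrite -E in_line // (d1 eab) ![d s _]d1 // ![d _ s]dsym ![d s _]d1.
  by rewrite add1n prednK //; nlia.
apply/subset_leq_card; rewrite subUset sub1set mem_lines //.
apply/subsetP=> ? /imsetP[x]; rewrite !inE => xs ->; apply: mem_lines.
by rewrite eq_sym.
Qed.

End ChordalLines.

Lemma chordal_case (T : finType) (e : rel T) :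
  symmetric e -> irreflexive e -> connected e -> chordal e -> nocut e -> 3 <= #|T| ->
  #|T| <= num_lines e.
Proof.
move=> e_sym e_irr e_conn e_ch e_nc T3.
have [|s _ hs] := @simplicial_in _ _ e_sym e_irr e_ch setT.
  by rewrite -card_gt0 cardsT; nlia.
by apply: (simplicial_lines e_sym e_irr e_conn e_ch e_nc (s := s)) => // a b *; apply: hs.
Qed.

(** * Contracting a module *)

Definition nbrs (T : finType) (e : rel T) x : {set T} := [set z | e x z].

Lemma del_edge_sym (T : finType) (e : rel T) f : symmetric e -> symmetric (del_edge e f).
Proof. by move=> e_sym x y; rewrite /del_edge /= e_sym setUC. Qed.

Lemma del_edge_connected (T : finType) (e : rel T) p q : symmetric e -> connected e ->
  connect (del_edge e [set p; q]) p q -> connected (del_edge e [set p; q]).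
Proof.
move=> e_sym /connectedP cn cpq; apply/connectedP=> x y.
apply: connect_sub (cn x y) => u v euv.
have [E|nE] := eqVneq [set u; v] [set p; q]; last by apply: connect1; apply/andP.
have : u \in [set p; q] by rewrite -E !inE eqxx.
have : v \in [set p; q] by rewrite -E !inE eqxx orbT.
have cqp : connect (del_edge e [set p; q]) q p.
  by rewrite (sym_connect_sym (del_edge_sym _ e_sym)).
by rewrite !inE => /orP[]/eqP-> /orP[]/eqP->.
Qed.

Lemma bridge_no_triangle (T : finType) (e : rel T) p q w :
  symmetric e -> irreflexive e -> connected e -> e p q -> e p w -> e w q ->
  [set p; q] \notin bridges e.
Proof.
move=> e_sym e_irr cn epq epw ewq; rewrite inE negb_and negbK; apply/orP; right.
apply: del_edge_connected => //.
have ne x y : e x y -> x != y by move=> exy; apply: contraTneq exy => ->; rewrite e_irr.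
apply: (@connect_trans _ _ w); apply: connect1; apply/andP; split=> //.
  by apply: contraTneq (ne _ _ ewq) => /setP/(_ w); rewrite !inE eqxx orbT [w == p]eq_sym (negbTE (ne _ _ epw)) /= => <-.
by apply: contraTneq (ne _ _ epw) => /setP/(_ w); rewrite !inE eqxx /= [w == p]eq_sym (negbTE (ne _ _ ewq)) orbF => <-.
Qed.

Section Module.
Variables (T : finType) (e : rel T).
Hypotheses (e_sym : symmetric e) (e_irr : irreflexive e) (e_conn : connected e).
Implicit Types (a b c m x y z : T) (M : {set T}).
Local Notation d := (dist e).

Let dtri := dist_triangle e_conn.
Let dsym := dist_sym e_sym e_conn.
Let d1 := dist_edge e_irr e_conn.

Variables (M : {set T}).
Hypothesis modM : is_module e M.

Lemma moduleE a b u : a \in M -> b \in M -> u \notin M -> e a u = e b u.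
Proof.
move=> aM bM uM; move/forall_inP/(_ _ aM)/forall_inP/(_ _ bM)/forall_inP/(_ u): modM.
by rewrite inE => /(_ uM)/eqP.
Qed.

Lemma module_retract y : y \in M -> retract e (y |: ~: M) y.
Proof.
move=> yM; split=> [|x z]; first by rewrite !inE eqxx.
rewrite !inE negb_or negbK => /orP[/eqP->|xM] /andP[zy zM] exz; first by left.
by right; rewrite e_sym (@moduleE _ z) // e_sym.
Qed.

(** Collapsing [M] onto [u] sends [v] to [u], fixes [z], and does not increase distances. *)
Lemma module_dist m m' z : m \in M -> m' \in M -> z \notin M -> d m z = d m' z.
Proof.
suff le u v : u \in M -> v \in M -> z \notin M -> d u z <= d v z.
  by move=> mM m'M zM; apply/eqP; rewrite eqn_leq !le.
move=> uM vM zM; have r := module_retract uM.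
have := retract_le e_sym e_irr e_conn r v z.
rewrite (val_to_retract r (x := z)) ?inE ?zM ?orbT //.
have [->//|nvu] := eqVneq v u.
by rewrite to_retract_out // !inE negb_or nvu negbK.
Qed.

Section Proper.
Variable z0 : T.
Hypothesis z0M : z0 \notin M.

Lemma module_nbr y : y \in M -> exists2 u, u \notin M & e y u.
Proof.
move=> yM; have [/existsP[u /andP[uM eyu]]|no] := boolP [exists u, (u \notin M) && e y u].
  by exists u.
suff : z0 \in M by rewrite (negbTE z0M).
apply: (connect_ind (P := fun z => z \in M)) ((connectedP _ e_conn) y z0) (yM).
move=> u v euv uM; apply: contraNT no => vM; apply/existsP; exists v.
by rewrite vM (moduleE yM uM vM).
Qed.

Lemma module_dist2 a b : a \in M -> b \in M -> a != b -> ~~ e a b -> d a b = 2.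
Proof.
move=> aM bM nab neab; have [u uM eau] := module_nbr aM.
by apply: (@dist_eq2 _ _ e_irr e_conn _ _ u) => //; rewrite e_sym (@moduleE b a).
Qed.

End Proper.

Hypotheses (e_nc : nocut e).

(** Without cut vertices an edge of the contraction can be bypassed by walks avoiding its ends in
    turn, unless one end is [y]. For an edge from [y] to [b], a neighbour of [b] outside of [M] and
    [b] would start a detour to [y] that avoids [b]; hence the neighbourhood of [b] is [M]. *)
Lemma module_bridge y (f : {set {x | x \in y |: ~: M}}) : y \in M ->
  f \in bridges (induced e (y |: ~: M)) ->
  exists b, [/\ b \notin M, nbrs e b = M & val @: f = [set y; b]].
Proof.
move=> yM; rewrite inE => /andP[/imsetP[[p q]]]; rewrite inE /= => epq fE /negP nb.
have r := module_retract yM; set S := _ |: _ in f p q epq fE nb r *.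
have sI : symmetric (induced e S) := @induced_sym _ _ e_sym S.
have cI : connected (induced e S) := retract_connected e_sym e_conn r.
have imf : val @: f = [set val p; val q] by rewrite fE imsetU !imset_set1.
have npq : val p != val q by apply: contraTneq epq; rewrite /induced /= => ->; rewrite e_irr.
have outM (x : {x | x \in S}) : val x != y -> val x \notin M.
  by have := valP x; rewrite !inE => /orP[->|].
(* A walk avoiding a vertex of [f] other than [y] retracts to a walk avoiding [f]. *)
have lift w u v : w \in f -> val w != y -> connect (avoid e (val w)) u v ->
    connect (del_edge (induced e S) f) (to_retract r u) (to_retract r v).
  move=> wf wy; apply: connect_homo => x z /and3P[exz xw zw].
  case: (to_retract_edge e_sym r exz) => [->//|exz']; apply: connect1.
  apply/andP; split=> //; apply: contraTneq wf => <-.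
  have nw t : t != val w -> w != to_retract r t.
    move=> tw; apply: contraNneq tw => wE; rewrite wE.
    have [tS|tS] := boolP (t \in S); first by rewrite val_to_retract.
    by move: wy; rewrite wE to_retract_out ?eqxx.
  by rewrite !inE negb_or !nw.
have pf : p \in f by rewrite fE !inE eqxx.
have qf : q \in f by rewrite fE !inE eqxx orbT.
have cs := sym_connect_sym (del_edge_sym f sI).
have case_y (p' q' : {x | x \in S}) : f = [set p'; q'] -> e (val p') (val q') -> val p' = y ->
    val p' != val q' -> exists b, [/\ b \notin M, nbrs e b = M & val @: f = [set y; b]].
  move=> fE' epq' py npq'; have qy : val q' != y by rewrite -py eq_sym.
  have qM := outM _ qy; exists (val q'); split=> //; last first.
    by rewrite fE' imsetU !imset_set1 py.
  have q'f : q' \in f by rewrite fE' !inE eqxx orbT.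
  apply/setP=> c; rewrite inE; apply/idP/idP=> [eqc|cM]; last first.
    by rewrite e_sym (@moduleE _ (val p')) // py.
  apply: contra_notT nb => cM; rewrite fE'; apply: del_edge_connected => //; rewrite -fE' cs.
  have cS : c \in S by rewrite !inE cM orbT.
  have cq : c != val q' by apply: contraTneq eqc => ->; rewrite e_irr.
  apply: (@connect_trans _ _ (to_retract r c)).
    apply: connect1; apply/andP; split.
      by rewrite /induced /= val_to_retract.
    apply/eqP=> E; have : to_retract r c \in f by rewrite -E !inE eqxx orbT.
    rewrite fE' !inE -!(inj_eq val_inj) val_to_retract // (negbTE cq) orbF py => /eqP cy.
    by rewrite cy yM in cM.
  have yq : y != val q' by rewrite eq_sym.
  have <- : to_retract r y = p' by rewrite -(to_retract_val r p') py.
  exact: (lift _ _ _ q'f qy (e_nc cq yq)).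
have [py|py] := eqVneq (val p) y; first exact: case_y fE epq py npq.
have [qy|qy] := eqVneq (val q) y.
  by apply: (case_y q p) => //; rewrite 1?e_sym 1?eq_sym // setUC.
case: nb; rewrite fE; apply: del_edge_connected => //; rewrite -fE.
have yp : y != val p by rewrite eq_sym.
have yq : y != val q by rewrite eq_sym.
rewrite -(to_retract_val r p) -(to_retract_val r q).
apply: connect_trans (lift _ _ _ qf qy (e_nc npq yq)) _.
by apply: (lift p) => //; apply: e_nc; rewrite // eq_sym.
Qed.

Lemma module_num_bridges y : y \in M ->
  num_bridges (induced e (y |: ~: M)) <= #|[set b | nbrs e b == M]|.
Proof.
move=> yM; set S := _ |: _.
have vi : injective (fun f : {set {x | x \in S}} => val @: f : {set T}) by apply: imset_inj val_inj.
rewrite /num_bridges -(card_imset _ vi).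
apply: leq_trans (leq_imset_card (fun b => [set y; b]) _).
apply/subset_leq_card/subsetP=> ? /imsetP[f fb ->].
have [b [bM nb ->]] := module_bridge yM fb.
by apply: imset_f; rewrite inE nb.
Qed.

End Module.

(** * False twins *)

Definition false_twins (T : finType) (e : rel T) x y : bool :=
  (x != y) && (nbrs e x == nbrs e y).

Section TwinTables.

(* The table of [A] after vertex [r] has been given a false twin. *)
Definition twin_adj A r :=
  rcons [seq if adj A r i then rcons (nth [::] A i) (size A) else nth [::] A i | i <- iota 0 (size A)]
        (nth [::] A r).

Definition twin_adj_ok A r := allpair (size A).+1 (fun i j =>
  adj (twin_adj A r) i j ==
    if i == size A then (j != size A) && adj A r j
    else if j == size A then adj A r i else adj A i j).

(** Three outcomes of adding a false twin of [r]: [r] is adjacent to all other vertices, which the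
    vertex [c] of the application excludes; or there are enough lines; or [C4] turns into [K23]. The
    list [s] then puts the two neighbours of [r] first, followed by [r], its opposite vertex and the
    new twin. *)
Definition twin_check A r :=
  [&& twin_adj_ok A r, size (twin_adj A r) == (size A).+1, diam2 (twin_adj A r) &
    [|| all (fun j => (j == r) || adj A r j) (iota 0 (size A)),
        size A < size (line_codes (twin_adj A r)) |
      (A == adjC4) && allpair 5 (fun i j =>
        let s := [:: r.+1 %% 4; r.+3 %% 4; r; r.+2 %% 4; 4] in
        perm_eq s (iota 0 5) && (adj adjK23 i j == adj (twin_adj A r) (nth 0 s i) (nth 0 s j)))]].

Lemma adjF_twin_check A r : A \in adjF -> r < size A -> twin_check A r.
Proof.
move=> AF ltr; suff /allP/(_ r) : all (twin_check A) (iota 0 (size A)).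
  by apply; rewrite mem_iota.
by move: A AF {r ltr}; apply/allP; vm_compute.
Qed.

(** A contraction with a pendant vertex is therefore not exceptional. *)
Lemma adjF_degree A i : A \in adjF -> i < size A ->
  exists j k, [/\ j < size A, k < size A, j != k, adj A i j & adj A i k].
Proof.
move=> AF lti; suff : allpair (size A) (fun i _ =>
    has (fun j => has (fun k => [&& j != k, adj A i j & adj A i k]) (iota 0 (size A))) (iota 0 (size A))).
  move/allpairP/(_ i i lti lti)/hasP=> [j + /hasP[k + /and3P[]]].
  by rewrite !mem_iota => *; exists j, k.
by move: A AF {i lti}; apply/allP; vm_compute.
Qed.

Variables (T : finType) (e : rel T).

Lemma tab_reindex S t A x0 s A' : tab e S t A -> perm_eq s (iota 0 (size A)) ->
  size A' = size A ->
  allpair (size A) (fun i j => adj A' i j == adj A (nth 0 s i) (nth 0 s j)) ->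
  tab e S [seq nth x0 t i | i <- s] A'.
Proof.
case=> ut ct st at_ ps sA' /allpairP h.
have ss : size s = size A by rewrite (perm_size ps) size_iota.
have mem_s i : i \in s -> i < size A by rewrite (perm_mem ps) mem_iota.
have ns i : i < size A -> nth 0 s i < size A by move=> lti; apply/mem_s/mem_nth; rewrite ss.
split.
- rewrite map_inj_in_uniq; first by rewrite (perm_uniq ps) iota_uniq.
  move=> i j /mem_s lti /mem_s ltj /eqP; rewrite nth_uniq ?st // => /eqP //.
- move=> x; rewrite -ct; apply/mapP/idP=> [[i /mem_s lti ->]|xt].
    by apply: mem_nth; rewrite st.
  exists (index x t); last by rewrite nth_index.
  by rewrite (perm_mem ps) mem_iota /= add0n -st index_mem.
- by rewrite size_map ss sA'.
move=> x1 i j; rewrite sA' => lti ltj.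
rewrite !(nth_map 0) ?ss // at_ ?ns //; exact/esym/eqP/h.
Qed.

End TwinTables.

Section FalseTwins.
Variables (T : finType) (e : rel T).
Hypotheses (e_sym : symmetric e) (e_irr : irreflexive e) (e_conn : connected e).
Hypotheses (e_nc : nocut e) (IH : smaller_good e) (e_notF : ~ in_family_F e).
Implicit Types (a b c x y z : T) (X S : {set T}).
Local Notation d := (dist e).

Let dtri := dist_triangle e_conn.
Let dsym := dist_sym e_sym e_conn.
Let d1 := dist_edge e_irr e_conn.

Lemma family_degree S b : in_family_F (induced e S) -> b \in S ->
  exists c1 c2, [/\ c1 \in S, c2 \in S, c1 != c2, e b c1 & e b c2].
Proof.
move=> /induced_family_tab[A AF [t tA]] bS.
have [i lti ->] := tab_ex b tA bS.
have [j [k [ltj ltk njk aij aik]]] := adjF_degree AF lti.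
exists (nth b t j), (nth b t k).
by rewrite !(tab_in b tA) // (tab_eq b tA) // !(tab_adj b tA).
Qed.

Section Pair.
Variables (x y : T).
Hypothesis xy_tw : false_twins e x y.
Local Notation M := [set x; y].
Local Notation S := (y |: ~: M).

Lemma twin_neq : x != y. Proof. by case/andP: xy_tw. Qed.

Lemma twin_edge z : e x z = e y z.
Proof. by case/andP: xy_tw => _ /eqP/setP/(_ z); rewrite !inE. Qed.

Lemma twin_nonadj : ~~ e y x. Proof. by rewrite -twin_edge e_irr. Qed.

Lemma twin_module : is_module e M.
Proof.
apply/forall_inP=> a aM; apply/forall_inP=> b bM; apply/forall_inP=> u _.
by move: aM bM; rewrite !inE => /orP[]/eqP-> /orP[]/eqP->; rewrite ?twin_edge.
Qed.

Lemma twin_S : S = [set~ x].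
Proof. by apply/setP=> z; rewrite !inE negb_or; have [->|] := eqVneq z y; rewrite ?andbT // eq_sym twin_neq. Qed.

Lemma twin_cardS : #|S|.+1 = #|T|.
Proof. by rewrite twin_S cardsC1 prednK //; apply/card_gt0P; exists x. Qed.

Lemma twin_retract : retract e S y.
Proof. by apply: (module_retract e_sym twin_module); rewrite // !inE eqxx orbT. Qed.

Lemma twin_out z : z != x -> z != y -> z \notin M.
Proof. by move=> zx zy; rewrite !inE negb_or zx. Qed.

Lemma twin_dist z : z != x -> z != y -> d x z = d y z.
Proof.
move=> zx zy; apply: (module_dist e_sym e_irr e_conn twin_module); rewrite ?inE ?eqxx ?orbT //.
by rewrite negb_or zx.
Qed.

Lemma twin_lines X : X \in lines_in e S -> x \in X -> y \in X.
Proof.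
case/lines_inP=> a [b []]; rewrite twin_S !in_setC1 => ax bx nab ->.
have [->|ay] := eqVneq a y; first by rewrite in_line_l.
have [->|bby] := eqVneq b y; first by rewrite in_line_r.
by rewrite !in_line // !(dsym _ x) !(dsym _ y) !twin_dist.
Qed.

Section Far.
Variable c : T.
Hypotheses (cx : c != x) (cy : c != y) (neyc : ~~ e y c).

Lemma twin_dist2 : d x y = 2.
Proof.
have z0M := twin_out cx cy.
apply: (module_dist2 e_sym e_irr e_conn twin_module z0M); rewrite ?inE ?eqxx ?orbT ?twin_neq //.
by rewrite e_sym twin_nonadj.
Qed.

(** Both twins are at the same distance [k] from [c] and at distance 2 from each other, so only
    [k = 1] would put [y] on the line. *)
Lemma twin_far_line : y \notin line e x c.
Proof.
have xc : x != c by rewrite eq_sym.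
have yc : y != c by rewrite eq_sym.
have D2 := dist_ge2 e_irr e_conn yc neyc.
rewrite in_line // (dsym c y) (dsym y x) (twin_dist cx cy) twin_dist2; nlia.
Qed.

Lemma twin_new_line : line e x c \notin lines_in e S.
Proof. by apply/negP=> /twin_lines/(_ (in_line_l _ _ _)); apply/negP: twin_far_line. Qed.

Lemma twin_mem_line : line e x c \in lines e.
Proof. by apply: mem_lines; rewrite eq_sym. Qed.

Lemma twin_cardS2 : 2 <= #|S| /\ #|S| < #|T|.
Proof.
rewrite -twin_cardS ltnSn; split=> //; apply: leq_trans (_ : #|[set y; c]| <= _).
  by rewrite cards2 eq_sym cy.
by apply/subset_leq_card/subsetP=> z; rewrite !inE => /orP[]/eqP->; rewrite ?eqxx // negb_or cx cy orbT.
Qed.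

(** Removing [x] creates no bridge, so the induction hypothesis for the rest and the single new line
    through [x] and [c] suffice; an exceptional rest is settled by [adjF_twin_check]. *)
Lemma twin_case0 : (forall b, nbrs e b != M) -> #|T| <= num_lines e.
Proof.
move=> nob; apply: (@classic_EM (in_family_F (induced e S))) => -[FS|nFS]; last first.
  have [S2 ltS] := twin_cardS2; have := IH twin_retract ltS S2 nFS.
  have := @module_num_bridges _ _ e_sym e_irr e_conn _ twin_module e_nc y.
  have -> : [set b | nbrs e b == M] = set0.
    by apply/setP=> b; rewrite !inE (negbTE (nob b)).
  rewrite cards0 leqn0 !inE eqxx orbT => /(_ isT)/eqP->; rewrite addn0 => le.
  have new X : X \in [:: line e x c] ->
      [/\ X \in lines e, X \notin lines_in e S & X \notin set0].
    by rewrite inE => /eqP->; rewrite inE twin_mem_line twin_new_line.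
  have := extra_lines (lines_in_sub e S) (sub0set _) (ls := [:: line e x c]) isT new.
  by rewrite setI0 !cards0 -twin_cardS; move: le; card_lia.
have [A AF [t tA]] := induced_family_tab FS.
have [r ltr yr] : exists2 r, r < size A & y = nth x t r.
  by apply: (tab_ex x tA); rewrite !inE eqxx.
case/and4P: (adjF_twin_check AF ltr) => /allpairP ok /eqP sA' dA' chk.
have cT := twin_cardS; rewrite (tab_card tA) in cT.
have [ut ct st at_] := tA.
have tA' : tab e setT (rcons t x) (twin_adj A r).
  split.
  - by rewrite rcons_uniq ut andbT ct twin_S !inE eqxx.
  - by move=> z; rewrite mem_rcons inE ct twin_S !inE; case: (_ == _).
  - by rewrite size_rcons st sA'.
  move=> x0 i j; rewrite sA' => lti ltj; have /eqP-> := ok i j lti ltj.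
  have nthE k : k < (size A).+1 -> nth x0 (rcons t x) k = if k == size A then x else nth x t k.
    rewrite nth_rcons st ltnS leq_eqVlt; case: eqP => [->|_] /=; first by rewrite ltnn.
    by move=> ltk; rewrite ltk (set_nth_default x) // st.
  rewrite (nthE i) // (nthE j) //; move: lti ltj.
  rewrite ltnS [i <= _]leq_eqVlt ltnS [j <= _]leq_eqVlt.
  case: eqP => [_ _|_ /= lti]; case: eqP => [_ _|_ /= ltj] //=.
  - by rewrite twin_edge {1}yr at_.
  - by rewrite e_sym twin_edge {1}yr at_.
  - by rewrite at_.
case/or3P: chk => [/allP full|lt|/andP[/eqP AC4 /allpairP perm]].
- have [j ltj cj] : exists2 j, j < size A & c = nth x t j.
    by apply: (tab_ex x tA); rewrite twin_S !inE.
  have := full j; rewrite mem_iota => /(_ ltj); case/orP=> [/eqP jr|ajr].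
    by move: cy; rewrite cj jr -yr eqxx.
  by move: neyc; rewrite yr cj at_ // ajr.
- rewrite -cT; apply: leq_trans lt _.
  apply: leq_trans (line_codes_card e_irr e_conn x tA' dA') _.
  exact/subset_leq_card/lines_in_sub.
case: e_notF; apply/in_family_F_tab; exists adjK23; first by rewrite !inE eqxx orbT.
have s5 : size (twin_adj A r) = 5 by rewrite sA' AC4.
exists [seq nth x (rcons t x) i | i <- [:: r.+1 %% 4; r.+3 %% 4; r; r.+2 %% 4; 4]].
apply: (tab_reindex x tA'); rewrite ?s5 //.
  by have /andP[] := perm 0 0 isT isT.
by apply/allpairP=> i j lti ltj; have /andP[] := perm i j lti ltj.
Qed.

(** Removing [x] may create the bridge from [y] to [b], so one more new line is required. It is the
    line of the twins, formed by [x], [y] and their common neighbours; most of the proof shows that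
    no other pair avoiding [x] induces it. *)
Lemma twin_case1 b : nbrs e b = M -> (forall b', nbrs e b' = M -> b' = b) ->
  #|T| <= num_lines e.
Proof.
move=> nb ub; have bz z : e b z = (z == x) || (z == y).
  by move/setP/(_ z): nb; rewrite !inE.
have ebx : e b x by rewrite bz eqxx.
have eby : e b y by rewrite bz eqxx orbT.
have bx : b != x by apply: contraTneq ebx => ->; rewrite e_irr.
have b_y : b != y by apply: contraTneq eby => ->; rewrite e_irr.
have nFS : ~ in_family_F (induced e S).
  move/family_degree/(_ (_ : b \in S)); rewrite twin_S !inE bx => /(_ isT).
  case=> c1 [c2 []]; rewrite !inE !bz => /negbTE-> /negbTE-> /= n12 /eqP c1y /eqP c2y.
  by rewrite c1y c2y eqxx in n12.
have [S2 ltS] := twin_cardS2; have := IH twin_retract ltS S2 nFS.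
have := @module_num_bridges _ _ e_sym e_irr e_conn _ twin_module e_nc y.
have -> : [set b | nbrs e b == M] = [set b].
  apply/setP=> b'; rewrite !inE; apply/eqP/eqP=> [/ub//|->//].
rewrite cards1 !inE eqxx orbT => /(_ isT) brl le.
have dxy := twin_dist2; have nxy := twin_neq.
have inxy z : z != x -> z != y -> (z \in line e x y) = e y z.
  move=> zx zy; rewrite in_line // dxy (dsym z x) (twin_dist zx zy) (dsym z y).
  by rewrite -(dist_eq1 e_irr e_conn); have := dist_gt0 e_conn y z; rewrite eq_sym zy; nlia.
have xy_new : line e x y \notin lines_in e S.
  apply/lines_inP=> -[a [c' []]]; rewrite twin_S !in_setC1.
  (* [b] is a pendant vertex once [x] is removed, so [line y b] is everything. *)
  have case_y z : z != x -> z != y -> line e x y <> line e y z.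
    move=> zx zy E; have yz : y != z by rewrite eq_sym.
    have eyz : e y z by rewrite -inxy // E in_line_r.
    have nzM : nbrs e z = M.
      apply/setP=> w; rewrite !inE; apply/idP/idP=> [ezw|]; last first.
        by case/orP=> /eqP->; rewrite e_sym ?twin_edge.
      apply/negPn/negP; rewrite negb_or => /andP[wx wy].
      have : (w \in line e x y) = (w \in line e y z) by rewrite E.
      rewrite inxy // in_line // (d1 eyz) (d1 ezw) (dsym w z) (dsym w y) (d1 ezw).
      have yw : y != w by rewrite eq_sym.
      have := dtri y z w; rewrite (d1 eyz) (d1 ezw).
      have := dist_gt0 e_conn y w; rewrite yw.
      by rewrite -(dist_eq1 e_irr e_conn); nlia.
    have zb := ub _ nzM.
    have : c \in line e y z.
      rewrite zb in_line // 1?eq_sym // (d1 (_ : e y b)) 1?e_sym //.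
      have bc : b != c by apply: contraNneq neyc => <-; rewrite e_sym.
      have [w ebw dw] := dist_step e_irr e_conn bc.
      have dwy : d w c = d y c by move: ebw; rewrite bz => /orP[]/eqP->; rewrite ?twin_dist.
      by rewrite (dsym c b) dw dwy (dsym c y) addn1 eqxx !orbT.
    by rewrite -E inxy // (negbTE neyc).
  move=> ax c'x nac E.
  have [ay|ay] := eqVneq a y.
    apply: (case_y c') => //; last by rewrite E ay.
    by rewrite -ay eq_sym.
  have [c'y|c'y] := eqVneq c' y.
    by apply: (case_y a) => //; rewrite E c'y line_sym.
  have eya : e y a by rewrite -inxy // E in_line_l.
  have eyc' : e y c' by rewrite -inxy // E in_line_r.
  have : y \in line e a c' by rewrite -E in_line_r.
  rewrite in_line // (dsym a y) (dsym c' y) (d1 eya) (d1 eyc') => dac.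
  have dac2 : d a c' = 2.
    by have := dist_gt0 e_conn a c'; rewrite nac; move: dac; nlia.
  have dN w : e y w -> w != b -> d b w = 2.
    move=> eyw wb; apply: (@dist_eq2 _ _ e_irr e_conn _ _ y); rewrite 1?eq_sym //.
    rewrite bz negb_or; apply/andP; split; apply: contraTneq eyw => ->; rewrite ?e_irr ?twin_nonadj //.
  (* Three vertices pairwise at distance 2 are on no common line of two of them, so [b], at distance
     2 from all other neighbours of [y], must be [a] or [c']. *)
  have only w : e y w -> w != a -> w != c' -> d a w = 2 -> d c' w = 2 -> False.
    move=> eyw wa wc' daw dcw.
    have wx : w != x by apply: contraTneq eyw => ->; rewrite twin_nonadj.
    have wy : w != y by apply: contraTneq eyw => ->; rewrite e_irr.
    have : w \in line e a c' by rewrite -E inxy.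
    by rewrite in_line // (dsym w a) (dsym w c') (dsym c' w) (dsym w c') daw dcw dac2.
  have bIn : b = a \/ b = c'.
    have [->|ba] := eqVneq b a; first by left.
    have [->|bc'] := eqVneq b c'; first by right.
    exfalso; apply: (only b) => //; first by rewrite e_sym.
      by rewrite dsym dN // eq_sym.
    by rewrite dsym dN // eq_sym.
  (* The other end [a'] then has a neighbour outside of [x, y], and this
     neighbour is at distance 3 from [b]. *)
  have [a' [a'b eya' La']] : exists a', [/\ a' != b, e y a' & line e x y = line e b a'].
    case: bIn => bE; [exists c'|exists a]; rewrite bE; split=> //; first by rewrite eq_sym.
    by rewrite E line_sym.
  have a'x : a' != x by apply: contraTneq eya' => ->; rewrite twin_nonadj.
  have a'y : a' != y by apply: contraTneq eya' => ->; rewrite e_irr.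
  have [t ea't tM] : exists2 t, e a' t & t \notin M.
    have [/existsP[t /andP[]]|] := boolP [exists t, e a' t && (t \notin M)]; first by exists t.
    rewrite negb_exists => /forallP no; case/eqP: a'b; apply: ub; apply/setP=> t; rewrite in_set.
    apply/idP/idP=> [ea't|]; first by have := no t; rewrite ea't /= negbK.
    by rewrite !inE => /orP[]/eqP->; rewrite e_sym ?twin_edge.
  move: tM; rewrite !inE negb_or => /andP[tx ty].
  have ba' : b != a' by rewrite eq_sym.
  have tb : t != b by apply: contraTneq ea't => ->; rewrite e_sym bz negb_or a'x.
  have db := dN _ eya' a'b.
  have bt : b != t by rewrite eq_sym.
  have [w ebw dw] := dist_step e_irr e_conn bt.
  have dwy : d w t = d y t by move: ebw; rewrite bz => /orP[]/eqP->; rewrite ?twin_dist.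
  have yt : y != t by rewrite eq_sym.
  have : (t \in line e x y) = (t \in line e b a') by rewrite La'.
  rewrite inxy // in_line // db (d1 ea't) dw dwy (dsym t b) dw dwy (dsym t a') (d1 ea't).
  have := dtri y a' t; rewrite (d1 eya') (d1 ea't).
  rewrite -(dist_eq1 e_irr e_conn); have := dist_gt0 e_conn y t; rewrite yt; nlia.
have nxc : line e x y != line e x c.
  by apply: contraNneq twin_far_line => <-; rewrite in_line_r.
have new X : X \in [:: line e x y; line e x c] ->
    [/\ X \in lines e, X \notin lines_in e S & X \notin set0].
  rewrite !inE => /orP[]/eqP->; split=> //.
  - exact: mem_lines.
  - exact: twin_mem_line.
  - exact: twin_new_line.
have ul : uniq [:: line e x y; line e x c] by rewrite /= inE nxc.
have := extra_lines (lines_in_sub e S) (sub0set _) ul new.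
by rewrite setI0 !cards0 -twin_cardS; move: le brl; card_lia.
Qed.

End Far.
End Pair.

(** With two vertices [b1], [b2] of neighbourhood [{x, y}], these are false twins themselves, and
    [twin_case0] applies to them: a vertex with neighbourhood [{b1, b2}] would make [x], [b1], [y],
    [b2] the whole graph, leaving no room for [c]. *)
Lemma false_twin_case x y c : false_twins e x y -> c != x -> c != y -> ~~ e y c ->
  #|T| <= num_lines e.
Proof.
move=> tw cx cy neyc; set M := [set x; y].
have [/existsP[b1 /eqP nb1]|] := boolP [exists b, nbrs e b == M]; last first.
  by rewrite negb_exists => /forallP nob; apply: (twin_case0 tw cx cy neyc).
have [/existsP[b2 /andP[b12 /eqP nb2]]|] := boolP [exists b, (b != b1) && (nbrs e b == M)]; last first.
  rewrite negb_exists => /forallP nob; apply: (twin_case1 tw cx cy neyc nb1) => b' nb'.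
  by apply/eqP; have := nob b'; rewrite nb' eqxx andbT negbK.
have bz b z : nbrs e b = M -> e b z = (z == x) || (z == y).
  by move/setP/(_ z); rewrite !inE.
have yb b : nbrs e b = M -> e y b by move=> nb; rewrite e_sym (bz b) // eqxx orbT.
have tw' : false_twins e b1 b2 by rewrite /false_twins eq_sym b12 nb1 nb2 eqxx.
have cb b : nbrs e b = M -> c != b by move=> nb; apply: contraNneq neyc => ->; apply: yb.
apply: (twin_case0 tw' (c := c)); rewrite ?cb //.
  by rewrite (bz b2) // negb_or cx cy.
move=> b'; apply/eqP=> nb'.
have xyz z : e y z = (z == b1) || (z == b2).
  have : b1 \in nbrs e b' by rewrite nb' !inE eqxx.
  rewrite inE e_sym (bz b1) // => b'xy.
  have : e b' z = (z == b1) || (z == b2) by move/setP/(_ z): nb'; rewrite !inE.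
  by move: b'xy => /orP[]/eqP->; rewrite // (twin_edge tw).
pose Q := [set x; y; b1; b2].
suff : c \in Q by rewrite !inE (negbTE cx) (negbTE cy) !(negbTE (cb _ _)).
have yQ : y \in Q by rewrite !inE eqxx orbT.
apply: (connect_ind (P := fun z => z \in Q)) ((connectedP _ e_conn) y c) (yQ).
move=> u v euv; rewrite !inE -!orbA => /or4P[]/eqP uE; move: euv; rewrite uE.
- by rewrite (twin_edge tw) xyz => /orP[]->; rewrite ?orbT.
- by rewrite xyz => /orP[]->; rewrite ?orbT.
- by rewrite (bz b1) // => /orP[]->; rewrite ?orbT.
- by rewrite (bz b2) // => /orP[]->; rewrite ?orbT.
Qed.

End FalseTwins.

(** * Diameter two, and pairs of false twins complete to the rest *)

Section Diameter2.
Variables (T : finType) (e : rel T).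
Hypotheses (e_sym : symmetric e) (e_irr : irreflexive e) (e_conn : connected e).
Hypothesis diam : forall a b, dist e a b <= 2.

Lemma dist_diam2 a b : dist e a b = if a == b then 0 else if e a b then 1 else 2.
Proof.
have [->|nab] := eqVneq a b; first exact: dist_xx.
have [eab|neab] := boolP (e a b); first exact: dist_edge.
by apply/eqP; rewrite eqn_leq diam dist_ge2.
Qed.

Lemma line_adjacent a b x : e a b ->
  (x \in line e a b) = [|| x == a, x == b | e a x != e b x].
Proof.
move=> eab; have nab : a != b by apply: contraTneq eab => ->; rewrite e_irr.
have eba : e b a by rewrite e_sym.
rewrite in_line // !dist_diam2 (negbTE nab) eab ![x == _]eq_sym (e_sym x a) (e_sym x b).
have [ax|_] := eqVneq a x; first by rewrite -ax [b == a]eq_sym (negbTE nab) eba.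
have [bx|_] := eqVneq b x; first by rewrite -bx eab.
by case: (e a x); case: (e b x).
Qed.

Lemma line_nonadjacent a b x : a != b -> ~~ e a b ->
  (x \in line e a b) = [|| x == a, x == b | e a x && e b x].
Proof.
move=> nab neab; have neba : ~~ e b a by rewrite e_sym.
rewrite in_line // !dist_diam2 (negbTE nab) (negbTE neab) ![x == _]eq_sym (e_sym x a) (e_sym x b).
have [ax|_] := eqVneq a x; first by rewrite -ax [b == a]eq_sym (negbTE nab) (negbTE neba).
have [bx|_] := eqVneq b x; first by rewrite -bx (negbTE neab).
by case: (e a x); case: (e b x).
Qed.

End Diameter2.

Lemma tab_cone (T : finType) (e : rel T) (S : {set T}) t A A' d :
  symmetric e -> irreflexive e -> tab e S t A -> S = [set~ d] -> (forall z, z \in S -> e d z) ->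
  size A' = (size A).+1 ->
  allpair (size A).+1 (fun i j => adj A' i j ==
    if i == size A then j != size A else (j == size A) || adj A i j) ->
  tab e setT (rcons t d) A'.
Proof.
move=> e_sym e_irr tA SE ed sA' /allpairP ok; have [ut ct st at_] := tA; split.
- by rewrite rcons_uniq ut andbT ct SE !inE eqxx.
- by move=> z; rewrite mem_rcons inE ct SE !inE; case: (_ == _).
- by rewrite size_rcons st sA'.
move=> x0 i j; rewrite sA' => lti ltj; have /eqP-> := ok i j lti ltj.
have nthE k : k < (size A).+1 -> nth x0 (rcons t d) k = if k == size A then d else nth d t k.
  rewrite nth_rcons st ltnS leq_eqVlt; case: eqP => [->|_] /=; first by rewrite ltnn.
  by move=> ltk; rewrite ltk (set_nth_default d) // st.
rewrite (nthE i) // (nthE j) //; move: lti ltj.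
rewrite ltnS [i <= _]leq_eqVlt ltnS [j <= _]leq_eqVlt.
have inS k : k < size A -> e d (nth d t k) by move=> ltk; apply/ed/(tab_in d tA).
case: eqP => [_ _|_ /= lti]; case: eqP => [_ _|_ /= ltj] //=.
- by rewrite inS.
- by rewrite e_sym inS.
- exact: at_.
Qed.

Lemma adj_matchingE n i j : n \in [:: 4; 6; 8] -> i < n -> j < n ->
  adj (adj_matching n) i j = (i./2 != j./2).
Proof.
move=> n4 lti ltj; apply/eqP; move: i j lti ltj; apply/allpairP.
by move: n n4; apply/allP; vm_compute.
Qed.

Section CompleteTwins.
Variables (T : finType) (e : rel T).
Hypotheses (e_sym : symmetric e) (e_irr : irreflexive e) (e_conn : connected e).
Hypotheses (e_nc : nocut e) (T3 : 3 <= #|T|) (e_notF : ~ in_family_F e).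
Hypothesis full : forall x y, false_twins e x y -> forall c, c != x -> c != y -> e y c.
Hypothesis some : exists x y, false_twins e x y.
Implicit Types (a b c d x y z : T) (X Y : {set T}).

(** [P] consists of the vertices with a false twin and [D] of the others. The set [cl x] of
    non-neighbours, which includes [x], is the twin pair of [x] for [x] in [P], and determines [x]
    within [D]; so one notation serves for both. [PP] is the set of the [p] pairs. *)
Let P := [set x | [exists y, false_twins e x y]].
Let D := ~: P.
Let cl x := ~: nbrs e x.
Let PP := cl @: P.
Let p := #|PP|.
Let q := #|D|.

Lemma in_cl x z : (z \in cl x) = ~~ e x z.
Proof. by rewrite !inE. Qed.

Lemma cl_twins x y : false_twins e x y -> cl x = [set x; y].
Proof.
move=> tw; apply/setP=> z; rewrite in_cl !inE (twin_edge tw).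
have [->|zx] := eqVneq z x; first by rewrite (twin_nonadj e_irr tw).
have [->|zy] := eqVneq z y; first by rewrite e_irr.
by rewrite (full tw).
Qed.

Lemma twin_classP x : x \in P -> exists2 y, x != y & cl x = [set x; y] /\ cl y = [set x; y].
Proof.
rewrite inE => /existsP[y tw]; exists y; first by case/andP: tw.
split; first exact: cl_twins.
by rewrite /cl; case/andP: (tw) => _ /eqP <-; apply: cl_twins.
Qed.

Lemma cl_eq x z : x \in P -> z \in cl x -> cl z = cl x.
Proof. by case/twin_classP=> y _ [cx cy]; rewrite cx !inE => /orP[]/eqP->. Qed.

Lemma cl_in_P x z : x \in P -> z \in cl x -> z \in P.
Proof.
move=> xP zx; have [y nxy [cx cy]] := twin_classP xP.
have tw : false_twins e x y.
  by rewrite /false_twins nxy -[nbrs e x]setCK -[nbrs e y]setCK -/(cl x) -/(cl y) cx cy eqxx.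
move: zx; rewrite cx !inE => /orP[]/eqP->; apply/existsP; first by exists y.
by exists x; move: tw; rewrite /false_twins eq_sym [nbrs e x == _]eq_sym.
Qed.

Lemma cl_refl x : x \in cl x.
Proof. by rewrite in_cl e_irr. Qed.

Lemma mem_PP x : x \in P -> cl x \in PP.
Proof. exact: imset_f. Qed.

Lemma PP_mem X x : X \in PP -> x \in X -> x \in P /\ X = cl x.
Proof.
by case/imsetP=> y yP -> xy; split; [apply: cl_in_P xy|rewrite (cl_eq yP xy)].
Qed.

Lemma D_complete x z : x \in P -> z \in D -> e x z.
Proof.
move=> xP; rewrite in_setC => zD; apply: contraNT zD => nxz.
by apply: (cl_in_P xP); rewrite in_cl.
Qed.

Lemma card_P : #|P| = 2 * p.
Proof.
have partP : partition PP P.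
  apply/and3P; split.
  - apply/eqP/setP=> x; apply/bigcupP/idP=> [[X XP xX]|xP]; first by case: (PP_mem XP xX).
    by exists (cl x); [apply: mem_PP|apply: cl_refl].
  - apply/trivIsetP=> X Y XP YP nXY; rewrite -setI_eq0; apply: contraNT nXY => /set0Pn[z].
    by rewrite inE => /andP[/(PP_mem XP)[_ ->] /(PP_mem YP)[_ ->]].
  - by apply/imsetP=> -[x _ x0]; have := cl_refl x; rewrite -x0 inE.
rewrite (@card_uniform_partition _ 2 _ _ _ partP) 1?mulnC // => X /imsetP[x xP ->].
by have [y nxy [-> _]] := twin_classP xP; rewrite cards2 nxy.
Qed.

Lemma card_T : #|T| = 2 * p + q.
Proof. by rewrite -card_P /q /D cardsC. Qed.

Lemma diam_le2 a b : dist e a b <= 2.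
Proof.
have [->|nab] := eqVneq a b; first by rewrite dist_xx.
have [eab|neab] := boolP (e a b); first by rewrite dist_edge.
suff [c eac ecb] : exists2 c, e a c & e c b by rewrite (@dist_eq2 _ _ e_irr e_conn a b c).
have [x [y tw]] := some.
have tw' : false_twins e y x by move: tw; rewrite /false_twins eq_sym [nbrs e x == _]eq_sym.
have other u v : false_twins e u v -> u = a -> exists2 c, e a c & e c b.
  move=> twu ua; have bv : b = v.
    apply/eqP; apply: contraNT neab => bv; rewrite -ua (twin_edge twu) (full twu) //.
    by rewrite ua eq_sym.
  have [z] : exists z, z \notin [set a; b].
    apply/existsP; rewrite -negb_forall; apply: contraTN T3 => /forallP h.
    rewrite -ltnNge -cardsT; apply: leq_ltn_trans (_ : #|[set a; b]| < 3).
      by apply/subset_leq_card/subsetP=> w _; apply: h.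
    by rewrite cards2; case: (_ != _).
  rewrite !inE negb_or => /andP[za zb]; rewrite bv in zb.
  exists z; first by rewrite -ua (twin_edge twu) (full twu) ?ua.
  by rewrite e_sym bv (full twu) ?ua.
have [xa|xa] := eqVneq x a; first exact: (other _ _ tw).
have [ya|ya] := eqVneq y a; first exact: (other _ _ tw').
have [bx|bx] := eqVneq b x.
  by move: neab; rewrite bx e_sym (twin_edge tw) (full tw) // eq_sym.
have [b_y|b_y] := eqVneq b y.
  by move: neab; rewrite b_y e_sym (full tw) // eq_sym.
exists y; last by rewrite (full tw).
by rewrite e_sym (full tw) // eq_sym.
Qed.

(** In diameter two the line of an edge consists of its ends and the vertices adjacent to just one
    of them. No vertex misses both ends: one missing [x] belongs to its pair and is adjacent to
    [z]. *)
Lemma line_classes x z : x \in P -> e x z -> line e x z = cl x :|: cl z.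
Proof.
move=> xP exz; apply/setP=> w; rewrite (line_adjacent e_sym e_irr e_conn diam_le2) //.
rewrite inE !in_cl; have [->|_] := eqVneq w x; first by rewrite e_irr.
have [->|_] := eqVneq w z; first by rewrite e_irr /= ?orbT.
case exw: (e x w); case ezw: (e z w) => //=.
have wP : w \in P by apply: (cl_in_P xP); rewrite in_cl exw.
have wz : cl w = cl x by apply: (cl_eq xP); rewrite in_cl exw.
have : z \in cl w by rewrite in_cl e_sym ezw.
by rewrite wz in_cl exz.
Qed.

(** By [line_classes], [L1] holds the lines between two pairs and [L2] those between a pair and a
    vertex of [D]. *)
Let L1 := [set cover A | A in [set A : {set {set T}} | (A \subset PP) && (#|A| == 2)]].
Let L2 := [set (pr.1 :|: cl pr.2) | pr in setX PP D].

Lemma L1_card : #|L1| = 'C(p, 2).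
Proof.
rewrite card_in_imset ?cards_draws // => A B.
rewrite !inE => /andP[/subsetP AP _] /andP[/subsetP BP _] AB.
have sub (A' B' : {set {set T}}) : {subset A' <= PP} -> {subset B' <= PP} ->
    cover A' = cover B' -> A' \subset B'.
  move=> A'P B'P E; apply/subsetP=> X XA; have /imsetP[x xP XE] := A'P _ XA.
  have : x \in cover B' by rewrite -E; apply/bigcupP; exists X; rewrite // XE cl_refl.
  case/bigcupP=> Y YB xY; have [_ YE] := PP_mem (B'P _ YB) xY.
  by rewrite XE -YE.
by apply/eqP; rewrite eqEsubset !sub.
Qed.

Lemma cl_D_inj : {in D &, injective cl}.
Proof.
move=> c d cD _ cd; apply/eqP; apply: contraLR cD => ncd; rewrite in_setC negbK inE.
by apply/existsP; exists d; rewrite /false_twins ncd -[nbrs e c]setCK -/(cl c) cd setCK eqxx.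
Qed.

Lemma cl_D d : d \in D -> cl d :&: P = set0.
Proof.
move=> dD; apply/setP=> x; rewrite !inE; apply/negP=> /andP[nedx xP].
by move: nedx; rewrite e_sym D_complete // inE.
Qed.

Lemma PP_sub X : X \in PP -> X \subset P.
Proof. by move=> XP; apply/subsetP=> x /(PP_mem XP)[]. Qed.

Lemma PP_cl_D X c : X \in PP -> c \in D -> (X :|: cl c) :\: P = cl c.
Proof.
move=> XP cD; apply/setP=> z; rewrite in_setD in_setU.
have [zP|zP] := boolP (z \in P) => /=; last by rewrite (contraNF (subsetP (PP_sub XP) z) zP).
by have /setP/(_ z) := cl_D cD; rewrite in_setI zP andbT in_set0 => ->.
Qed.

Lemma L2_card : #|L2| = p * q.
Proof.
rewrite card_in_imset ?cardsX // => -[X c] [Y d]; rewrite !in_setX /= => /andP[XP cD] /andP[YP dD] E.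
have EP : X = Y.
  have : (X :|: cl c) :&: P = (Y :|: cl d) :&: P by rewrite E.
  rewrite !setIUl (cl_D cD) (cl_D dD) !setU0.
  by rewrite (setIidPl (PP_sub XP)) (setIidPl (PP_sub YP)).
have ED : cl c = cl d by rewrite -(PP_cl_D XP cD) E (PP_cl_D YP dD).
by rewrite EP (cl_D_inj cD dD ED).
Qed.

Lemma L1_sub : L1 \subset lines e.
Proof.
apply/subsetP=> ? /imsetP[A + ->]; rewrite inE => /andP[/subsetP AP /cards2P[X [Y [nXY AE]]]].
have XP : X \in PP by apply: AP; rewrite AE !inE eqxx.
have YP : Y \in PP by apply: AP; rewrite AE !inE eqxx orbT.
rewrite AE /cover bigcup_setU !big_set1; case/imsetP: XP nXY => x xP ->.
case/imsetP: YP => y yP -> nxy.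
have exy : e x y by apply: contraNT nxy => nexy; rewrite (cl_eq xP (z := y)) // in_cl.
rewrite -line_classes //; apply: mem_lines; apply: contraTneq exy => ->; by rewrite e_irr.
Qed.

Lemma L2_sub : L2 \subset lines e.
Proof.
apply/subsetP=> ? /imsetP[[X d] + ->]; rewrite in_setX /= => /andP[/imsetP[x xP ->] dD].
have exd := D_complete xP dD.
rewrite -line_classes //; apply: mem_lines; apply: contraTneq exd => ->; by rewrite e_irr.
Qed.

Lemma L1_P X : X \in L1 -> X \subset P.
Proof.
case/imsetP=> A; rewrite inE => /andP[/subsetP AP _] ->; apply/subsetP=> x /bigcupP[Y YA].
exact: (subsetP (PP_sub (AP _ YA))).
Qed.

Lemma L2_D X : X \in L2 -> exists x d, [/\ x \in P, d \in D & X = cl x :|: cl d].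
Proof. by case/imsetP=> -[Y d]; rewrite in_setX /= => /andP[/imsetP[x xP ->] dD] ->; exists x, d. Qed.

Lemma setT_line : setT \in lines e.
Proof.
have [x [y tw]] := some; apply/imsetP; exists (x, y); rewrite ?inE; first by case/andP: tw.
apply/setP=> z; rewrite inE /= (line_nonadjacent e_sym e_irr e_conn diam_le2); last first.
- by rewrite e_sym (twin_nonadj e_irr tw).
- by case/andP: tw.
rewrite (twin_edge tw) andbb; have [//|zx] := eqVneq z x; have [//|zy] := eqVneq z y.
by rewrite (full tw).
Qed.

(** The last line is universal, induced by a pair of twins. It is new unless the union of two pairs
    is already everything, which is the excluded case [p = 2], [q = 0]. *)
Lemma count_lines : 2 <= p -> 1 <= q \/ 3 <= p -> 'C(p, 2) + p * q + 1 <= num_lines e.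
Proof.
move=> p2 qp; rewrite -L1_card -L2_card.
have d12 : L1 :&: L2 = set0.
  apply/setP=> X; rewrite !inE; apply/negP=> /andP[/L1_P/subsetP sP /L2_D[x [d [_ dD XE]]]].
  by have := sP d; rewrite XE inE cl_refl orbT => /(_ isT) dP; move: dD; rewrite inE dP.
have nT : setT \notin L1 :|: L2.
  rewrite in_setU negb_or; apply/andP; split; last first.
    apply/negP=> /L2_D[x [d [xP dD E]]].
    have sub : PP \subset [set cl x].
      apply/subsetP=> ? /imsetP[y yP ->]; rewrite inE; apply/eqP.
      have : y \in cl x :|: cl d by rewrite -E inE.
      rewrite inE => /orP[/(cl_eq xP)//|yd].
      have : y \in cl d :&: P by rewrite in_setI yd.
      by rewrite cl_D // inE.
    by have := subset_leq_card sub; rewrite cards1; move: p2; rewrite /p; nlia.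
  apply/negP=> TL1; have := L1_P TL1; rewrite subTset => /eqP PT.
  have q0 : q = 0 by rewrite /q /D PT setCT cards0.
  case: qp => [|p3]; first by rewrite q0.
  case/imsetP: TL1 => A; rewrite inE => /andP[AP /eqP cA] E.
  suff /subset_leq_card : PP \subset A by rewrite cA; move: p3; rewrite /p; nlia.
  apply/subsetP=> ? /imsetP[x xP ->]; have : x \in cover A by rewrite -E inE.
  by case/bigcupP=> Y YA xY; have [_ <-] := PP_mem (subsetP AP _ YA) xY.
have -> : #|L1| + #|L2| + 1 = #|setT |: (L1 :|: L2)|.
  by rewrite cardsU1 nT cardsU d12 cards0 subn0 addnC.
by apply/subset_leq_card; rewrite !subUset L1_sub L2_sub sub1set setT_line.
Qed.

(** The vertices are listed pair by pair, so that halving a position gives the pair, as in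
    [complete_minus_matching]. *)
Lemma pair_list (Xs : seq {set T}) : uniq Xs -> {subset Xs <= PP} ->
  exists t, [/\ uniq t, forall x, (x \in t) = has (fun X => x \in X) Xs,
    size t = (size Xs).*2 & forall x0 i, i < size t -> nth x0 t i \in nth set0 Xs i./2].
Proof.
elim: Xs => [|X Xs IH] /=; first by exists [::].
case/andP=> XXs uXs sub.
have XP : X \in PP by apply: sub; rewrite inE eqxx.
have [|t [ut mt st ht]] := IH uXs; first by move=> Y YXs; apply: sub; rewrite inE YXs orbT.
have [x xP XE] : exists2 x, x \in P & X = cl x by case/imsetP: (XP) => x; exists x.
have [y nxy [cx cy]] := twin_classP xP.
have out z : z \in X -> z \notin t.
  move=> zX; rewrite mt; apply: contra XXs => /hasP[Y YXs zY].
  have [_ ->] := PP_mem XP zX; have [|_ <- //] := PP_mem _ zY.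
  by apply: sub; rewrite inE YXs orbT.
have xX : x \in X by rewrite XE cl_refl.
have yX : y \in X by rewrite XE cx !inE eqxx orbT.
exists [:: x, y & t]; split.
- by rewrite /= inE negb_or nxy !out.
- by move=> z; rewrite !inE mt {1}XE cx !inE orbA.
- by rewrite /= st doubleS.
by move=> x0 [|[|i]] //= lti; apply: ht.
Qed.

Lemma P_tab n : n \in [:: 4; 6; 8] -> p.*2 = n -> exists t, tab e P t (adj_matching n).
Proof.
move=> n4 pn; have sPP : size (enum PP) = p by rewrite -cardE.
have mPP X : X \in enum PP -> X \in PP by rewrite mem_enum.
have [t [ut mt st ht]] := pair_list (enum_uniq PP) mPP.
have sn : size (adj_matching n) = n by rewrite size_map size_iota.
rewrite sPP in st; exists t; split=> //.
- move=> x; rewrite mt; apply/hasP/idP=> [[X /mPP XP xX]|xP]; first by case: (PP_mem XP xX).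
  by exists (cl x); rewrite ?mem_enum ?mem_PP ?cl_refl.
- by rewrite st sn.
move=> x0 i j; rewrite sn => lti ltj; rewrite adj_matchingE //.
have lti' : i < size t by rewrite st pn.
have ltj' : j < size t by rewrite st pn.
have ltk k : k < n -> k./2 < size (enum PP) by rewrite sPP -pn; lia.
have iP := mPP _ (mem_nth set0 (ltk _ lti)); have jP := mPP _ (mem_nth set0 (ltk _ ltj)).
have [_ Ei] := PP_mem iP (ht x0 i lti'); have [Pj Ej] := PP_mem jP (ht x0 j ltj').
have [Pi _] := PP_mem iP (ht x0 i lti').
rewrite -(nth_uniq set0 (ltk _ lti) (ltk _ ltj) (enum_uniq PP)) Ei Ej.
apply/idP/idP=> [eij|]; last by apply: contraR => neij; rewrite (cl_eq Pi (z := nth x0 t j)) // in_cl.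
apply: contraTneq eij => E; have := cl_refl (nth x0 t j).
by rewrite -E in_cl.
Qed.

Lemma p_gt0 : 0 < p.
Proof.
have [x [y tw]] := some; apply/card_gt0P; exists (cl x); apply: mem_PP; rewrite inE.
by apply/existsP; exists y.
Qed.

Lemma P_full : q = 0 -> P = setT.
Proof. by move/eqP; rewrite cards_eq0 => /eqP DE; rewrite -[P]setCK -/D DE setC0. Qed.

(** For [p >= 2], the number ['C(p, 2) + p * q + 1] is below [2 * p + q] only for [q = 0] with
    [p = 2, 3, 4], and for [q = 1] with [p = 2]. These graphs are [C4], [K6'], [K8'] and [W4]. *)
Lemma many_twins : 2 <= p -> #|T| <= num_lines e.
Proof.
move=> p2; have inF A : A \in adjF -> (exists t, tab e setT t A) -> False.
  by move=> AF tA; apply: e_notF; apply/in_family_F_tab; exists A.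
have pF n : n \in [:: 6; 8] -> p.*2 = n -> q = 0 -> False.
  move=> n6 pn q0; have [|t tA] := P_tab (n := n) _ pn; first by rewrite inE n6 orbT.
  rewrite P_full // in tA; apply: (inF (adj_matching n)); last by exists t.
  by move: n6; rewrite !inE => /orP[]/eqP->; rewrite eqxx ?orbT.
have p2F : p = 2 -> q <= 1 -> False.
  move=> pE q1; have p4 : p.*2 = 4 by rewrite pE.
  have [t tA] := P_tab (n := 4) isT p4.
  have [x0 [_ _]] := some.
  have [q0|q0] := posnP q.
    rewrite P_full // in tA; apply: (inF adjC4) => //.
    (* The matching table has the twins side by side, the cycle has them opposite. *)
    exists [seq nth x0 t i | i <- [:: 0; 2; 1; 3]].
    by apply: (tab_reindex x0 tA); vm_compute.
  have /cards1P[d Dd] : #|D| == 1 by apply/eqP; move: q0 q1; rewrite /q; nlia.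
  have PE : P = [set~ d] by rewrite -Dd /D setCK.
  have dP z : z \in P -> e d z by move=> zP; rewrite e_sym D_complete // Dd inE.
  apply: (inF adjW4) => //.
  have tB := @tab_cone _ _ _ _ _ [:: [:: 2; 3; 4]; [:: 2; 3; 4]; [:: 0; 1; 4]; [:: 0; 1; 4]; [:: 0; 1; 2; 3]]
     d e_sym e_irr tA PE dP erefl.
  exists [seq nth x0 (rcons t d) i | i <- [:: 0; 2; 1; 3; 4]].
  by apply: (tab_reindex x0 (tB _)); vm_compute.
have := count_lines p2; rewrite card_T bin2.
have [q0|q0] := posnP q.
  have p3 : 3 <= p by rewrite ltn_neqAle p2 andbT; apply/eqP=> E; apply: p2F; rewrite ?q0.
  have n3 : p <> 3 by move=> E; apply: (pF 6); rewrite // E.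
  have n4 : p <> 4 by move=> E; apply: (pF 8); rewrite // E.
  move=> /(_ (or_intror p3)); apply: leq_trans; rewrite q0 muln0 !addn0.
  have : 5 <= p by move: p3 n3 n4; clear; lia.
  by clear; case: p => // m; rewrite -[_.+1.-1]/m; nia.
move=> /(_ (or_introl isT)); apply: leq_trans.
have [pE|np2] := eqVneq p 2.
  have q2 : 2 <= q by rewrite ltnNge; apply/negP; apply: p2F.
  by rewrite pE; move: q2; clear; lia.
have p3 : 3 <= p by rewrite ltn_neqAle p2 andbT eq_sym.
move: p3 q0; clear; case: p => // m; rewrite -[_.+1.-1]/m; nia.
Qed.

(** There are [q + 2] vertices and [L2] has [q] lines, all containing the pair, so two further lines
    are needed. Lines of edges inside [D] avoid the pair and are always new; the cases differ in
    where the second line comes from. *)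
Lemma one_pair : p = 1 -> #|T| <= num_lines e.
Proof.
move=> p1; have cT : #|T| = q.+2 by rewrite card_T p1.
have L2q : #|L2| = q by rewrite L2_card p1 mul1n.
have [x [y tw]] := some; have nxy : x != y by case/andP: tw.
have xP : x \in P by rewrite inE; apply/existsP; exists y.
have PE : P = cl x.
  apply/eqP; rewrite eq_sym eqEcard; apply/andP; split.
    by apply/subsetP=> z; apply: cl_in_P.
  by rewrite card_P p1 (cl_twins tw) cards2 nxy.
have PxyE z : (z \in P) = (z == x) || (z == y) by rewrite PE (cl_twins tw) !inE.
have yP : y \in P by rewrite PxyE eqxx orbT.
have inD z : (z \in D) = (z != x) && (z != y) by rewrite in_setC PxyE negb_or.
have L2E X : X \in L2 -> exists2 d, d \in D & X = P :|: cl d.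
  by case/L2_D=> u [d [uP dD ->]]; exists d => //; rewrite PE (cl_eq xP) // -PE.
have LP X : X \in L2 -> x \in X by move/L2E=> [d _ ->]; rewrite inE xP.
have eD d d' : d \in D -> d' \in D -> e d d' -> forall z, z \in P -> z \notin line e d d'.
  move=> dD d'D edd z zP; rewrite (line_adjacent e_sym e_irr e_conn diam_le2) //.
  rewrite !(e_sym _ z) !D_complete // eqxx orbF negb_or.
  by apply/andP; split; [apply: contraTneq dD|apply: contraTneq d'D] => <-; rewrite in_setC zP.
have newD d d' : d \in D -> d' \in D -> e d d' -> line e d d' \notin L2.
  by move=> dD d'D edd; apply/negP=> /LP; apply/negP/eD.
have lD d d' : e d d' -> line e d d' \in lines e.
  by move=> edd; apply: mem_lines; apply: contraTneq edd => ->; rewrite e_irr.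
have fin ls : uniq ls -> (forall X, X \in ls -> X \in lines e /\ X \notin L2) -> size ls = 2 ->
    #|T| <= num_lines e.
  move=> uls h sls; have new X : X \in ls -> [/\ X \in lines e, X \notin L2 & X \notin set0].
    by case/h=> h1 h2; rewrite inE.
  have := extra_lines L2_sub (sub0set _) uls new.
  by rewrite setI0 !cards0 L2q sls cT; card_lia.
have fin2 X Y : X \in lines e -> Y \in lines e -> X \notin L2 -> Y \notin L2 -> X != Y ->
    #|T| <= num_lines e.
  move=> Xl Yl X2 Y2 XY; apply: (fin [:: X; Y]) => //; first by rewrite /= inE XY.
  by move=> Z; rewrite !inE => /orP[]/eqP->.
(* If no vertex is isolated in [D], the universal line is not in [L2]. A vertex [d0] isolated in [D]
   is unique, as two of them would be false twins. *)
have [/exists_inP[d0 d0D /forall_inP iso]|] := boolP [exists d in D, [forall d' in D, ~~ e d d']]; last first.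
  rewrite negb_exists_in => /forall_inP noiso.
  have nbrD d : d \in D -> exists2 d', d' \in D & e d d'.
    by move/noiso; rewrite negb_forall_in => /exists_inP[d' d'D]; rewrite negbK; exists d'.
  have /card_gt0P[d dD] : 0 < #|D| by move: T3; rewrite cT /q; nlia.
  have [d' d'D edd] := nbrD _ dD.
  apply: (fin2 setT (line e d d')); rewrite ?setT_line ?lD ?newD //.
    apply/negP=> /L2E[c cD E]; have [c' c'D ecc] := nbrD _ cD.
    have : c' \in P :|: cl c by rewrite -E inE.
    by rewrite inE in_cl ecc orbF; move: c'D; rewrite in_setC => /negbTE->.
  by apply/negP=> /eqP/setP/(_ x); rewrite inE (negbTE (eD _ _ _ _ edd x xP)).
have d0z z : e d0 z = (z \in P).
  have [zP|] := boolP (z \in P); first by rewrite e_sym D_complete.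
  by rewrite -in_setC => /iso/negbTE.
have isoD d : d \in D -> d != d0 -> exists d', [/\ d' \in D, d' != d0 & e d d'].
  move=> dD dd0; have [/exists_inP[d' d'D edd']|] := boolP [exists d' in D, e d d'].
    by exists d'; split=> //; apply: contraTneq edd' => ->; rewrite e_sym iso.
  rewrite negb_exists_in => /forall_inP no.
  suff tw0 : false_twins e d d0.
    by move: dD; rewrite in_setC inE => /existsP[]; exists d0.
  rewrite /false_twins dd0; apply/eqP/setP=> z; rewrite !inE d0z.
  have [zP|zP] := boolP (z \in P); first by rewrite e_sym D_complete.
  by apply/negbTE/no; rewrite in_setC.
have [d1 exd1 d10] := nocut_deg2 e_irr e_nc T3 (D_complete xP d0D).
have d1D : d1 \in D.
  rewrite inD; apply/andP; split; apply: contraTneq exd1 => ->; rewrite ?e_irr //.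
  by rewrite e_sym (twin_nonadj e_irr) // /false_twins eq_sym nxy eq_sym; case/andP: tw.
have [d2 [d2D d20 e12]] := isoD _ d1D d10.
(* For nonadjacent [u], [u'] other than [d0], the line of [d0] and [u] meets [D] in these two
   vertices only, whereas [cl d0] and [cl u] also contain [u']. Without such a pair [D] is a clique
   and [d0]. *)
have [/existsP[u /existsP[u' /and5P[uD u'D uu' u0 /andP[u'0 neuu']]]]|] := boolP
  [exists u, exists u', [&& u \in D, u' \in D, u != u', u != d0 & (u' != d0) && ~~ e u u']].
  have d0u : d0 != u by rewrite eq_sym.
  have ned0u : ~~ e d0 u by apply: iso.
  apply: (fin2 (line e d0 u) (line e d1 d2) _ (lD _ _ e12) _ (newD _ _ d1D d2D e12)).
  - exact: mem_lines.
  - apply/negP=> /L2E[c cD E].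
    have cE z : z \in D -> (z \in cl c) = (z == d0) || (z == u).
      move=> zD; have : (z \in line e d0 u) = (z \in P :|: cl c) by rewrite E.
      rewrite (line_nonadjacent e_sym e_irr e_conn diam_le2) // d0z in_setU.
      by move: zD; rewrite in_setC => /negbTE-> /=; rewrite orbF => ->.
    have := cE c cD; rewrite cl_refl => /esym/orP[]/eqP cu.
      have := cE u' u'D; rewrite cu in_cl iso // (negbTE u'0) eq_sym (negbTE uu') //.
    by have := cE u' u'D; rewrite cu in_cl neuu' (negbTE u'0) eq_sym (negbTE uu').
  - apply/negP=> /eqP/setP/(_ x); rewrite (negbTE (eD _ _ _ _ e12 x xP)) //.
  by rewrite (line_nonadjacent e_sym e_irr e_conn diam_le2) // d0z xP e_sym D_complete ?orbT.
rewrite negb_exists => /forallP no.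
have clq u u' : u \in D -> u' \in D -> u != u' -> u != d0 -> u' != d0 -> e u u'.
  move=> uD u'D uu' u0 u'0; have := no u; rewrite negb_exists => /forallP/(_ u').
  by rewrite uD u'D uu' u0 u'0 /= negbK.
have ne12 : d1 != d2 by apply: contraTneq e12 => ->; rewrite e_irr.
have [/exists_inP[d3 d3D /and3P[d30 d31 d32]]|] :=
  boolP [exists d3 in D, [&& d3 != d0, d3 != d1 & d3 != d2]].
  have e13 : e d1 d3 by apply: clq; rewrite // eq_sym.
  apply: (fin2 (line e d1 d2) (line e d1 d3)); rewrite ?lD ?newD //.
  apply/negP=> /eqP/setP/(_ d3); rewrite in_line_r.
  rewrite (line_adjacent e_sym e_irr e_conn diam_le2) // (negbTE d31) (negbTE d32) e13 clq //.
  by rewrite eq_sym.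
rewrite negb_exists_in => /forall_inP only.
case: e_notF; apply/in_family_F_tab; exists adjW4'; first by rewrite !inE eqxx ?orbT.
have exD d : d \in D -> e x d := D_complete xP.
have eyD d : d \in D -> e y d := D_complete yP.
have eDx d : d \in D -> e d x by move=> dD; rewrite e_sym exD.
have eDy d : d \in D -> e d y by move=> dD; rewrite e_sym eyD.
have nPD z d : z \in P -> d \in D -> z != d.
  by move=> zP; apply: contraTneq => <-; rewrite in_setC zP.
have exy : e x y = false by rewrite e_sym (negbTE (twin_nonadj e_irr tw)).
have eyx : e y x = false by rewrite (negbTE (twin_nonadj e_irr tw)).
have e21 : e d2 d1 by rewrite e_sym.
have ed0 d : d \in D -> e d0 d = false by move/iso/negbTE.
have ed0' d : d \in D -> e d d0 = false by rewrite e_sym; apply: ed0.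
(* The first four form the cycle, and [d2] is adjacent to all of them but [d0]. *)
exists [:: x; d1; y; d0; d2]; split=> //.
- have [x0 x1 x2] := And3 (nPD _ _ xP d0D) (nPD _ _ xP d1D) (nPD _ _ xP d2D).
  have [y0 y1 y2] := And3 (nPD _ _ yP d0D) (nPD _ _ yP d1D) (nPD _ _ yP d2D).
  by rewrite /= !inE !negb_or nxy x0 x1 x2 y0 y2 d10 ne12 (eq_sym d1) y1 (eq_sym d0) d20.
- move=> z; rewrite !inE; have := only z; rewrite inD; case: eqP => //= _; case: eqP; rewrite ?orbT //= => _.
  by move/(_ isT); rewrite !negb_and !negbK => /or3P[]->; rewrite ?orbT.
have E := (e_irr, exy, eyx, e12, e21, (exD _ d0D, exD _ d1D, exD _ d2D),
  (eyD _ d0D, eyD _ d1D, eyD _ d2D), (eDx _ d0D, eDx _ d1D, eDx _ d2D),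
  (eDy _ d0D, eDy _ d1D, eDy _ d2D), (ed0 _ d1D, ed0 _ d2D, ed0' _ d1D, ed0' _ d2D)).
by move=> z [|[|[|[|[|i]]]]] [|[|[|[|[|j]]]]] //= _ _; rewrite E.
Qed.

Lemma complete_twin_case : #|T| <= num_lines e.
Proof.
have := p_gt0; rewrite leq_eqVlt => /orP[/eqP/esym|]; [exact: one_pair|exact: many_twins].
Qed.

End CompleteTwins.

(** * Modules of graphs without false twins *)

Definition tab_twins A i j :=
  (i != j) && all (fun k => adj A i k == adj A j k) (iota 0 (size A)).

Lemma adjF_twins A : A \in adjF -> exists i j,
  [/\ i < size A, j < size A, i != j & forall k, k < size A -> adj A i k = adj A j k].
Proof.
move=> AF; suff : has (fun i => has (tab_twins A i) (iota 0 (size A))) (iota 0 (size A)).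
  case/hasP=> i + /hasP[j + /andP[nij /allP h]]; rewrite !mem_iota => lti ltj.
  by exists i, j; split=> // k ltk; apply/eqP/h; rewrite mem_iota.
by move: A AF; apply/allP; vm_compute.
Qed.

(* Only [W4'] has all its pairs of false twins through a common vertex [r]. *)
Lemma adjF_other_twins A r : A \in adjF -> r < size A ->
  (exists i j, [/\ i < size A, j < size A, i != j, (i != r) && (j != r) &
     forall k, k < size A -> adj A i k = adj A j k]) \/
  (size A <= (size (line_codes A)).+1 /\ exists i j k,
     [/\ [/\ i < size A, j < size A & k < size A], adj A r i, adj A r j, k != r &
       ldd A r i k != ldd A r j k]).
Proof.
pose check A := all (fun r =>
  has (fun i => has (fun j => [&& tab_twins A i j, i != r & j != r]) (iota 0 (size A))) (iota 0 (size A))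
  || (size A <= (size (line_codes A)).+1) &&
  has (fun i => has (fun j => has (fun k =>
     [&& adj A r i, adj A r j, k != r & ldd A r i k != ldd A r j k])
    (iota 0 (size A))) (iota 0 (size A))) (iota 0 (size A))) (iota 0 (size A)).
move=> AF ltr; have /allP/(_ r) : check A by move: A AF {r ltr}; apply/allP; vm_compute.
rewrite mem_iota => /(_ ltr)/orP[/hasP[i + /hasP[j + /and3P[/andP[nij /allP h] ir jr]]]|].
  rewrite !mem_iota => lti ltj; left; exists i, j; split; rewrite ?ir // => k ltk.
  by apply/eqP/h; rewrite mem_iota.
case/andP=> sz /hasP[i + /hasP[j + /hasP[k + /and4P[ri rj kr nk]]]].
by rewrite !mem_iota => *; right; split=> //; exists i, j, k; do 2!split=> //.
Qed.

Section NoTwins.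
Variables (T : finType) (e : rel T).
Hypotheses (e_sym : symmetric e) (e_irr : irreflexive e) (e_conn : connected e).
Hypotheses (e_nc : nocut e) (T3 : 3 <= #|T|) (IH : smaller_good e).
Hypothesis no_twins : forall x y, ~~ false_twins e x y.
Implicit Types (a b c m w x y z : T) (X S : {set T}).
Local Notation d := (dist e).

Let dtri := dist_triangle e_conn.
Let dsym := dist_sym e_sym e_conn.
Let d1 := dist_edge e_irr e_conn.

Lemma nbrs_inj x y : nbrs e x = nbrs e y -> x = y.
Proof. by move=> E; apply/eqP; have := no_twins x y; rewrite /false_twins E eqxx andbT negbK. Qed.

Lemma family_twins S : in_family_F (induced e S) ->
  exists a b, [/\ a \in S, b \in S, a != b & forall z, z \in S -> e a z = e b z].
Proof.
move=> /induced_family_tab[A AF [t tA]]; have [i [j [lti ltj nij h]]] := adjF_twins AF.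
have [_ ct st _] := tA.
have x0 : T by case: t st {tA ct} => [|x ? _]; [move=> s0; move: lti; rewrite -s0|exact: x].
exists (nth x0 t i), (nth x0 t j).
rewrite !(tab_in x0 tA) // (tab_eq x0 tA) //; split=> // z /(tab_ex x0 tA)[k ltk ->].
by rewrite !(tab_adj x0 tA) // h.
Qed.

Variable M : {set T}.
Hypothesis modM : is_module e M.
Hypotheses (M2 : 2 <= #|M|) (M_small : #|M|.+2 <= #|T|).
Hypothesis M_niso : forall z, z \in M -> exists2 z', z' \in M & e z z'.

Let mE := moduleE modM.

Lemma outM : exists z, z \notin M.
Proof.
apply/existsP; rewrite -negb_forall; apply: contraTN M_small => /forallP h.
rewrite -ltnNge -cardsT ltnS; apply: leqW; apply/subset_leq_card/subsetP=> x _; exact: h.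
Qed.

Let dM2 a b : a \in M -> b \in M -> a != b -> ~~ e a b -> d a b = 2.
Proof. by have [z0 z0M] := outM; apply: (module_dist2 e_sym e_irr e_conn modM z0M). Qed.

Let dMo m m' z : m \in M -> m' \in M -> z \notin M -> d m z = d m' z.
Proof. exact: module_dist. Qed.

Section Representative.
Variables (y u : T).
Hypotheses (yM : y \in M) (uM : u \notin M) (eyu : e y u).
Hypothesis uniq_u : forall b, nbrs e b = M -> b = u.
Local Notation S := (y |: ~: M).
Local Notation H := (u |: M).

Let ye m z : m \in M -> z \notin M -> e m z = e y z.
Proof. by move=> mM zM; apply: mE. Qed.

Let mz_neq m z : m \in M -> z \notin M -> m != z.
Proof. by move=> mM; apply: contraNneq => <-. Qed.

Let dpos z : z \notin M -> 0 < d y z.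
Proof. by move=> zM; rewrite (dist_gt0 e_conn) mz_neq. Qed.

Let dM a b : a \in M -> b \in M -> d a b = if a == b then 0 else if e a b then 1 else 2.
Proof.
move=> aM bM; have [->|nab] := eqVneq a b; first exact: dist_xx.
by have [eab|neab] := boolP (e a b); [apply: d1|apply: dM2].
Qed.

Lemma H_retract : retract e H u.
Proof.
split=> [|x z]; first by rewrite !inE eqxx.
rewrite !inE => /orP[/eqP->|xM] _ _; first by left.
by right; rewrite ye.
Qed.

Lemma H_edge x z : x \in H -> z \in H -> e x z -> exists w, [/\ w \in H, e x w & e w z].
Proof.
have wlog_u q : q \in M -> exists w, [/\ w \in H, e u w & e w q].
  move=> qM; have [q' q'M eqq'] := M_niso qM; exists q'.
  split; first by rewrite !inE q'M orbT.
    by rewrite e_sym ye.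
  by rewrite e_sym.
rewrite ![_ \in H]inE => /orP[/set1P->|xM] /orP[/set1P->|zM] exz.
- by rewrite e_irr in exz.
- exact: wlog_u.
- by have [w [wH ewu exw]] := wlog_u _ xM; exists w; rewrite e_sym exw e_sym.
- exists u; split; first by rewrite !inE eqxx.
    by rewrite ye.
  by rewrite e_sym ye.
Qed.

Lemma H_bridges : num_bridges (induced e H) = 0.
Proof.
apply/eqP; rewrite cards_eq0; apply/eqP/setP=> f; rewrite in_set0; apply/negP=> fb.
have : f \in edges (induced e H) by move: fb; rewrite inE => /andP[].
case/imsetP=> -[p q]; rewrite inE /= => epq fE.
have [w [wH epw ewq]] := H_edge (valP p) (valP q) epq.
have := @bridge_no_triangle _ (induced e H) p q (Sub w wH) (@induced_sym _ _ e_sym H)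
  (@induced_irr _ _ e_irr H) (retract_connected e_sym e_conn H_retract) epq epw ewq.
by rewrite -fE fb.
Qed.

(** Every exceptional graph has false twins. Those of [H] lie in [M], as [u] is adjacent to all of
    it, and they remain twins in the whole graph because [M] is a module. *)
Lemma H_notF : ~ in_family_F (induced e H).
Proof.
case/family_twins=> a [b [aH bH nab h]].
have nadj : ~~ e a b by rewrite h // e_irr.
have inM x z : x \in H -> z \in H -> x != z -> ~~ e x z -> x \in M.
  rewrite in_setU1 => /orP[/eqP->|//]; rewrite !inE => /orP[/eqP->|zM]; first by rewrite eqxx.
  by rewrite e_sym ye // eyu.
have aM := inM _ _ aH bH nab nadj.
have bM : b \in M by apply: (inM b a); rewrite // 1?eq_sym // e_sym.
case/eqP: nab; apply: nbrs_inj; apply/setP=> z; rewrite !inE.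
by have [zM|zM] := boolP (z \in M); [apply: h; rewrite !inE zM orbT|apply: mE].
Qed.

Lemma trace_const a c m m' : a \notin M -> c \notin M -> a != c -> m \in M -> m' \in M ->
  (m \in line e a c) = (m' \in line e a c).
Proof.
by move=> aM cM nac mM m'M; rewrite !in_line // !(dsym _ m) !(dsym _ m') !(@dMo m m').
Qed.

Lemma trace_mixed z c m : z \in M -> c \notin M -> m \in M ->
  (m \in line e z c) = (m == z) || (e y c && ~~ e z m).
Proof.
move=> zM cM mM; have [->|mz] := eqVneq m z; first exact: in_line_l.
have nzc := mz_neq zM cM; rewrite in_line // (dsym c m) (dsym m z).
rewrite (@dMo z y c) // (@dMo m y c) // (@dM z m) // [z == m]eq_sym (negbTE mz).
have := dpos cM; rewrite -(dist_eq1 e_irr e_conn y c); case: (e z m) => /=; nlia.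
Qed.

Lemma trace_out z c w : z \in M -> c \notin M -> w \notin M ->
  (w \in line e z c) = (w \in line e y c).
Proof.
move=> zM cM wM; rewrite !in_line ?mz_neq // !(dsym w z) !(dsym w y).
by rewrite (@dMo z y c) // (@dMo z y w).
Qed.

Lemma line_in_adjacent a b w : a \in M -> b \in M -> e a b -> w \in line e a b -> w \in M.
Proof.
move=> aM bM eab; apply: contraLR => wM.
have nab : a != b by apply: contraTneq eab => ->; rewrite e_irr.
rewrite in_line // (d1 eab) (dsym w b) (dsym w a) (@dMo a y) // (@dMo b y) //.
by have := dpos wM; nlia.
Qed.

Lemma line_in_nonadjacent a b w : a \in M -> b \in M -> a != b -> ~~ e a b -> w \notin M ->
  (w \in line e a b) = e y w.
Proof.
move=> aM bM nab neab wM.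
rewrite in_line // (dM2 aM bM nab neab) (dsym w b) (dsym w a) (@dMo a y) // (@dMo b y) //.
by rewrite -(dist_eq1 e_irr e_conn y w); have := dpos wM; nlia.
Qed.

Lemma H_lines X : X \in lines_in e H ->
  [\/ X \subset M, (forall w, w \notin M -> (w \in X) = e y w) /\ (exists2 m, m \in M & m \in X)
    | exists2 z, z \in M & X = line e z u].
Proof.
case/lines_inP=> a [b [aH bH nab ->]].
move: aH bH; rewrite !in_setU1 => /orP[/eqP au|aM] /orP[/eqP bu|bM].
- by rewrite au bu eqxx in nab.
- by constructor 3; exists b; rewrite // au line_sym.
- by constructor 3; exists a; rewrite // bu.
have [eab|neab] := boolP (e a b).
  by constructor 1; apply/subsetP=> w; apply: line_in_adjacent.
constructor 2; split; first by move=> w wM; apply: line_in_nonadjacent.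
by exists a; rewrite ?in_line_l.
Qed.

Lemma S_lines X : X \in lines_in e S ->
  ((forall m m', m \in M -> m' \in M -> (m \in X) = (m' \in X)) /\ (exists2 w, w \notin M & w \in X))
  \/ (exists2 c, c \notin M & X = line e y c).
Proof.
case/lines_inP=> a [b [aS bS nab ->]].
move: aS bS; rewrite !in_setU1 !in_setC => /orP[/eqP ay|aM] /orP[/eqP b_y|bM].
- by rewrite ay b_y eqxx in nab.
- by right; exists b; rewrite // ay.
- by right; exists a; rewrite // b_y line_sym.
left; split; first by move=> m m' mM m'M; apply: trace_const.
by exists a; rewrite ?in_line_l.
Qed.

(* The trace of a line on [M] determines the neighbourhood in [M], and hence,
   without false twins, the vertex of [M] which induces it. *)
Lemma trace_inj z z' : z \in M -> z' \in M ->
  (forall m, m \in M -> (m == z) || ~~ e z m = (m == z') || ~~ e z' m) -> z = z'.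
Proof.
move=> zM z'M h; apply/eqP/negPn/negP => nzz.
have := h z zM; have := h z' z'M; rewrite !eqxx /= [z' == z]eq_sym (negbTE nzz) /=.
rewrite e_sym => nezz _; case/eqP: nzz; apply: nbrs_inj; apply/setP=> m; rewrite !inE.
have [mM|mM] := boolP (m \in M); last exact: mE.
have := h m mM; have [->|_] := eqVneq m z; first by rewrite e_irr (negbTE nezz).
have [->|_] := eqVneq m z'; last by move/negb_inj.
by rewrite e_irr [e z z']e_sym (negbTE nezz).
Qed.

(** The vertex [c] is adjacent to [y]. A neighbour of [c] outside of [M] would be on the line
    without being adjacent to [y], or complete a triangle with [y] and [c] and so be adjacent to [y]
    without being on the line. *)
Lemma line_nbrs c : c \notin M -> (forall w, w \notin M -> (w \in line e y c) = e y w) ->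
  nbrs e c = M.
Proof.
move=> cM h; have eyc : e y c by rewrite -h // in_line_r.
apply/setP=> w; rewrite inE; have [wM|wM] := boolP (w \in M).
  by rewrite e_sym ye.
apply/negP=> ecw; have := h w wM.
have nyc := mz_neq yM cM.
rewrite in_line // (dsym w c) (dsym w y) (d1 eyc) (d1 ecw) -(dist_eq1 e_irr e_conn y w).
have := dtri y c w; rewrite (d1 eyc) (d1 ecw); have := dpos wM; nlia.
Qed.

(** The two candidates are [M] with its outside neighbours, and the line of [y] and [u]. All other
    coincidences fail by comparing traces on [M] and outside; a line from [z] in [M] to [u] is never
    constant on [M], because [z] has a neighbour there. *)
Lemma lines_overlap : #|lines_in e S :&: lines_in e H| <= 2.
Proof.
pose N := [set w | (w \notin M) && e y w].
apply: leq_trans (_ : #|[set M :|: N; line e y u]| <= 2); last by rewrite cards2; case: (_ != _).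
apply/subset_leq_card/subsetP=> X; rewrite in_setI => /andP[XS XH].
case: (S_lines XS) => [[cst [w wM wX]]|[c cM XE]]; case: (H_lines XH) => [sM|[hN [m mM mX]]|[z zM XE']].
- by rewrite (subsetP sM _ wX) in wM.
- rewrite in_set2; apply/orP; left; apply/eqP/setP=> v; rewrite !inE.
  by have [vM|vM] /= := boolP (v \in M); [rewrite (cst _ m)|rewrite hN].
- have [z' z'M ezz'] := M_niso zM.
  have := cst z z' zM z'M; rewrite XE' in_line_l trace_mixed // ezz' andbF orbF => /esym/eqP zz.
  by rewrite zz e_irr in ezz'.
- by have := subsetP sM c; rewrite XE in_line_r (negbTE cM) => /(_ isT).
- have -> : X = line e y u.
    rewrite XE; congr line; apply: uniq_u; apply: line_nbrs => // w wM.
    by rewrite -XE hN.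
  by rewrite in_set2 eqxx orbT.
- suff zy : z = y by rewrite in_set2 XE' zy eqxx orbT.
  have h m : m \in M -> (m == z) || ~~ e z m = (m == y) || (e y c && ~~ e y m).
    by move=> mM; rewrite -(@trace_mixed y c) // -XE XE' trace_mixed // eyu.
  have [eyc|neyc] := boolP (e y c); last first.
    by have := h z zM; rewrite eqxx (negbTE neyc) /= orbF => /esym/eqP.
  by apply: trace_inj => // m mM; rewrite h // eyc.
Qed.

(** On [M] the trace of this line is neither constant nor that of a line through [y]; outside of [M]
    it agrees with the line of [y] and [c], which [w] tells apart from the lines between [M] and
    [u]. *)
Lemma new_line z c w : z \in M -> z != y -> c \notin M -> c != u -> w \notin M ->
  (w \in line e y c) != (w \in line e y u) ->
  line e z c \notin lines_in e S /\ line e z c \notin lines_in e H.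
Proof.
move=> zM zy cM cu wM nw; have [z' z'M ezz'] := M_niso zM.
have z'z : z' != z by apply: contraTneq ezz' => ->; rewrite e_irr.
split; apply/negP.
  case/S_lines=> [[cst _]|[c' c'M E]].
    have := cst z z' zM z'M; rewrite !trace_mixed // eqxx ezz' (negbTE z'z) andbF //.
  have h m : m \in M -> (m == z) || (e y c && ~~ e z m) = (m == y) || (e y c' && ~~ e y m).
    by move=> mM; rewrite -!trace_mixed // E.
  have := h z zM; have := h y yM; rewrite !eqxx /= eq_sym (negbTE zy) /=.
  move=> /andP[eyc _] /esym/andP[eyc' _]; case/eqP: zy; apply: trace_inj => // m mM.
  by have := h m mM; rewrite eyc eyc'.
case/H_lines=> [sM|[hN _]|[z1 z1M E]].
- by have := subsetP sM c; rewrite in_line_r (negbTE cM) => /(_ isT).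
- case/eqP: cu; apply: uniq_u; apply: line_nbrs => // v vM.
  by rewrite -(trace_out zM) // hN.
have h m : m \in M -> (m == z) || (e y c && ~~ e z m) = (m == z1) || ~~ e z1 m.
  by move=> mM; rewrite -trace_mixed // E trace_mixed // eyu.
have zz1 : z = z1.
  apply/eqP/negPn/negP => nzz; have := h z1 z1M; rewrite eqxx eq_sym (negbTE nzz) /=.
  case/andP=> eyc _; case/eqP: nzz; apply: trace_inj => // m mM; by rewrite -h // eyc.
by move: nw; rewrite -(trace_out zM cM wM) E -zz1 (trace_out zM uM wM) eqxx.
Qed.

Lemma M_other : exists2 z, z \in M & z != y.
Proof.
have [|z] := @card_gt0P _ (M :\ y) _; last by rewrite !inE => /andP[]; exists z.
by move: M2; rewrite (cardsD1 y M) yM; card_lia.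
Qed.

Lemma cards_SH : #|S| + #|H| = #|T|.+2.
Proof. by rewrite !cardsU1 !inE yM uM -(cardsC M) /=; card_lia. Qed.

Lemma H_good : #|H| <= #|lines_in e H|.
Proof.
have cH : #|H| = #|M|.+1 by rewrite cardsU1 uM.
have := IH H_retract; rewrite H_bridges addn0 cH; apply; last exact: H_notF.
  by move: M_small; card_lia.
by move: M2; card_lia.
Qed.

Lemma S_small : 2 <= #|S| /\ #|S| < #|T|.
Proof.
by move: M2 M_small; rewrite cardsU1 !inE yM -(cardsC M) /=; split; move: M2 M_small; rewrite -(cardsC M); card_lia.
Qed.

Lemma finish_plain : #|S| <= #|lines_in e S| -> #|T| <= num_lines e.
Proof.
have new X : X \in [::] -> [/\ X \in lines e, X \notin lines_in e S & X \notin lines_in e H] by [].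
have := extra_lines (lines_in_sub e _) (lines_in_sub e _) (ls := [::]) isT new.
move: H_good lines_overlap cards_SH; card_lia.
Qed.

Lemma finish_new c w : #|S| <= (#|lines_in e S|).+1 -> c \notin M -> c != u -> w \notin M ->
  (w \in line e y c) != (w \in line e y u) -> #|T| <= num_lines e.
Proof.
move=> leS cM cu wM nw; have [z zM zy] := M_other.
have new X : X \in [:: line e z c] ->
    [/\ X \in lines e, X \notin lines_in e S & X \notin lines_in e H].
  rewrite inE => /eqP->; have [n1 n2] := new_line zM zy cM cu wM nw.
  by split=> //; apply: mem_lines; apply: mz_neq.
have := extra_lines (lines_in_sub e _) (lines_in_sub e _) (ls := [:: line e z c]) isT new.
move: leS H_good lines_overlap cards_SH; card_lia.
Qed.

(** False twins of [S] other than [y] would be false twins of the whole graph. Otherwise [S] lacks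
    only one line, and the table gives two lines through [y] that differ at a vertex outside of [M];
    one of them differs there from the line of [y] and [u], which yields a new line. *)
Lemma S_family : in_family_F (induced e S) -> #|T| <= num_lines e.
Proof.
move=> /induced_family_tab[A AF [t tA]]; have dA := adjF_diam2 AF.
have [r ltr yr] : exists2 r, r < size A & y = nth y t r.
  by apply: (tab_ex y tA); rewrite !inE eqxx.
have inM k : k < size A -> k != r -> nth y t k \notin M.
  move=> ltk kr; have := tab_in y tA ltk; rewrite in_setU1 in_setC {2}yr (tab_eq y tA) //.
  by rewrite (negbTE kr).
have [[i [j [lti ltj nij /andP[ir jr] h]]]|[sz [i [j [k [[lti ltj ltk] ri rj kr nk]]]]]] :=
  adjF_other_twins AF ltr.
  have E z : z \in S -> e (nth y t i) z = e (nth y t j) z.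
    by move=> /(tab_ex y tA)[k ltk ->]; rewrite !(tab_adj y tA) // h.
  have iM := inM i lti ir; have jM := inM j ltj jr.
  have : nth y t i = nth y t j.
    apply: nbrs_inj; apply/setP=> z; rewrite !inE.
    have [zM|zM] := boolP (z \in M); last by apply: E; rewrite !inE zM orbT.
    rewrite ![e _ z]e_sym !(ye zM) // ![e y _]e_sym; apply: E; by rewrite !inE eqxx.
  by move/eqP; rewrite (tab_eq y tA) // (negbTE nij).
have leS : #|S| <= (#|lines_in e S|).+1.
  rewrite (tab_card tA); apply: leq_trans sz _; rewrite ltnS.
  exact: (line_codes_card e_irr e_conn y tA dA).
have wM := inM k ltk kr.
have nri i' : i' < size A -> adj A r i' -> i' != r /\ nth y t i' \notin M.
  move=> lt ai; have ir : i' != r.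
    by apply: contraTneq ai => ->; rewrite -(tab_adj y tA) // e_irr.
  by split=> //; apply: inM.
have [ir iM] := nri i lti ri; have [jr jM] := nri j ltj rj.
have lnE i' : i' < size A -> i' != r -> (nth y t k \in line e y (nth y t i')) = ldd A r i' k.
  by move=> lt i'r; rewrite {2}yr (tab_line e_irr e_conn y tA dA) // eq_sym.
have [eq_i|ne_i] := eqVneq (ldd A r i k) (nth y t k \in line e y u).
  have ne_j : (nth y t k \in line e y (nth y t j)) != (nth y t k \in line e y u).
    by rewrite lnE // -eq_i eq_sym.
  by apply: (finish_new leS jM _ wM ne_j); apply: contraNneq ne_j => ->.
have ne_i' : (nth y t k \in line e y (nth y t i)) != (nth y t k \in line e y u) by rewrite lnE.
by apply: (finish_new leS iM _ wM ne_i'); apply: contraNneq ne_i' => ->.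
Qed.

Lemma no_pendant_case : (forall b, nbrs e b <> M) -> #|T| <= num_lines e.
Proof.
move=> nob; apply: (@classic_EM (in_family_F (induced e S))) => -[FS|nFS]; first exact: S_family.
have [S2 ltS] := S_small; have := IH (module_retract e_sym modM yM) ltS S2 nFS.
have := module_num_bridges e_sym e_irr e_conn modM e_nc yM.
have -> : [set b | nbrs e b == M] = set0.
  by apply/setP=> b; rewrite !inE; apply/eqP/nob.
rewrite cards0 leqn0 => /eqP->; rewrite addn0; exact: finish_plain.
Qed.

(* All lines through [y] being universal outside of [M], distinct vertices at
   the same distance from [y] are as far from each other as possible; a vertex
   farthest from [y] then has a single neighbour or gives false twins. *)
Lemma pendant_far : nbrs e u = M ->
  exists c w, [/\ c \notin M, c != u, w \notin M & w \notin line e y c].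
Proof.
move=> nu; have [/existsP[c /existsP[w /and4P[]]]|no] :=
  boolP [exists c, exists w, [&& c \notin M, c != u, w \notin M & w \notin line e y c]].
  by exists c, w.
have euz z : e u z = (z \in M) by move/setP/(_ z): nu; rewrite inE.
have ezu z : e z u = (z \in M) by rewrite e_sym.
have key c c' : c \notin M -> c' \notin M -> c != u -> c != c' -> d y c = d y c' ->
    d c c' = 2 * d y c.
  move=> cM c'M cu ncc E; have : c' \in line e y c.
    move: no; rewrite negb_exists => /forallP/(_ c); rewrite negb_exists => /forallP/(_ c').
    by rewrite cM c'M cu /= negbK.
  have nyc := mz_neq yM cM; rewrite in_line // (dsym c' c) (dsym c' y) -E.
  have : 0 < d c c' by rewrite dist_gt0.
  by nlia.
have lvl z : z \notin M -> e y z = (d y z == 1) by rewrite (dist_eq1 e_irr e_conn).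
have [t0 t0P] : exists t0, (t0 \notin M) && (t0 != u).
  apply/existsP; rewrite -[X in is_true X]negbK negb_exists; apply: contraTN M_small => /forallP h.
  rewrite -ltnNge -cardsT; apply: leq_ltn_trans (_ : #|H| < _); last by rewrite cardsU1 uM.
  apply/subset_leq_card/subsetP=> x _; have := h x; rewrite negb_and !negbK !inE orbC //.
case: (@arg_maxnP _ t0 (fun t => (t \notin M) && (t != u)) (d y) t0P) => t /andP[tM tu] tmax.
have nbr_t w : e t w -> w \notin M -> [/\ w != u, d y w < d y t & d y t <= (d y w).+1].
  move=> etw wM; have wu : w != u by apply: contraTneq etw => ->; rewrite ezu.
  have ltw : d y w <= d y t by apply: tmax; rewrite wM wu.
  have := dtri y w t; rewrite (dsym w t) (d1 etw) => le.
  have ntw : t != w by apply: contraTneq etw => ->; rewrite e_irr.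
  split=> //; last by nlia.
  rewrite ltn_neqAle ltw andbT; apply/eqP=> E.
  have := key t w tM wM tu ntw (esym E); rewrite (d1 etw); nlia.
have yt : 0 < d y t := dpos tM.
have [i1|ni1] := eqVneq (d y t) 1.
  exfalso; case/eqP: tu; apply: uniq_u; apply/setP=> w; rewrite inE.
  have [wM|wM] := boolP (w \in M); first by rewrite e_sym ye // lvl // i1.
  apply/negP=> etw; have [_ lt _] := nbr_t w etw wM; have := dpos wM; nlia.
have out w : e t w -> w \notin M.
  by apply: contraTN => wM; rewrite e_sym ye // lvl.
have ty : t != y by rewrite eq_sym; apply: mz_neq.
have [w1 e1 _] := dist_step e_irr e_conn ty.
have [w2 e2 n12] := nocut_deg2 e_irr e_nc T3 e1.
have [u1 l1 g1] := nbr_t _ e1 (out _ e1); have [u2 l2 g2] := nbr_t _ e2 (out _ e2).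
have n12' : w1 != w2 by rewrite eq_sym.
(* Both neighbours of [t] have the same level and distance at most 2, which by [key] is twice that
   level. So they have level 1, [t] has level 2, and both turn out to have neighbourhood
   [t |: M]. *)
have := key w1 w2 (out _ e1) (out _ e2) u1 n12'.
have := dtri w1 t w2; rewrite (dsym w1 t) (d1 e1) (d1 e2) => le2 k12.
have E12 : d y w1 = d y w2 by nlia.
have d1w : d y w1 = 1 by move: (k12 E12) (dpos (out _ e1)); nlia.
have t2 : d y t = 2 by nlia.
have nbw w : e t w -> nbrs e w = t |: M.
  move=> etw; have wM := out _ etw; have [wu lw gw] := nbr_t _ etw wM.
  have dw : d y w = 1 by nlia.
  apply/setP=> v; rewrite !inE; have [vM|vM] := boolP (v \in M).
    by rewrite orbT e_sym ye // lvl // dw.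
  rewrite orbF; apply/idP/eqP=> [ewv|->]; last by rewrite e_sym.
  apply/eqP/negPn/negP => vt.
  have vu : v != u by apply: contraTneq ewv => ->; rewrite ezu.
  have nwv : w != v by apply: contraTneq ewv => ->; rewrite e_irr.
  have lev : d y v <= d y t by apply: tmax; rewrite vM vu.
  have := dpos vM; have := key w v wM vM wu nwv; rewrite dw (d1 ewv) => kwv v0.
  have dv : d y v = d y t.
    by have : d y v <> 1 by [move=> E; have := kwv (esym E)]; nlia.
  have := key v t vM tM vu vt dv; have := dtri v w t; rewrite (dsym v w) (d1 ewv) (dsym w t) (d1 etw); nlia.
by case/eqP: n12; apply: nbrs_inj; rewrite !nbw.
Qed.

(** In the contraction [u] hangs on [y]: this edge may be a bridge, which costs one line, but the
    line of [y] and [u] contains everything outside of [M], so any other line through [y] missing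
    some [w] gives a new line. *)
Lemma pendant_case : nbrs e u = M -> #|T| <= num_lines e.
Proof.
move=> nu; have euz z : e u z = (z \in M) by move/setP/(_ z): nu; rewrite inE.
have uS : u \in S by rewrite !inE uM orbT.
have nFS : ~ in_family_F (induced e S).
  move/family_degree/(_ uS) => [c1 [c2 [c1S c2S n12]]]; rewrite !euz => c1M c2M.
  by move: c1S c2S n12; rewrite !inE c1M c2M !orbF => /eqP-> /eqP->; rewrite eqxx.
have [S2 ltS] := S_small; have := IH (module_retract e_sym modM yM) ltS S2 nFS.
have := module_num_bridges e_sym e_irr e_conn modM e_nc yM.
have -> : [set b | nbrs e b == M] = [set u].
  by apply/setP=> b; rewrite !inE; apply/eqP/eqP=> [/uniq_u//|->].
rewrite cards1 => b1 leS.
have [c [w [cM cu wM wc]]] := pendant_far nu.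
apply: (@finish_new c w) => //; first by move: b1 leS; card_lia.
suff -> : w \in line e y u by rewrite (negbTE wc).
have [->|wu] := eqVneq w u; first exact: in_line_r.
have uw : u != w by rewrite eq_sym.
have [v euv dv] := dist_step e_irr e_conn uw.
have vM : v \in M by rewrite -euz.
have nyu := mz_neq yM uM.
by rewrite in_line // (dsym w u) dv (@dMo v y) // (d1 eyu) (dsym w y) addn1 eqxx !orbT.
Qed.

End Representative.

Lemma module_case : #|T| <= num_lines e.
Proof.
have /card_gt0P[y yM] : 0 < #|M| by apply: leq_trans M2.
have [z0 z0M] := outM.
have [/existsP[u /eqP nu]|nob] := boolP [exists u, nbrs e u == M].
  have uM : u \notin M by rewrite -nu inE e_irr.
  have eyu : e y u by rewrite e_sym; move: yM; rewrite -{1}nu inE.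
  by apply: (pendant_case yM uM eyu) => // b nb; apply: nbrs_inj; rewrite nb.
have nob' b : nbrs e b <> M.
  by move: nob; rewrite negb_exists => /forallP/(_ b)/eqP.
have [u uM eyu] := module_nbr e_conn modM z0M yM.
by apply: (no_pendant_case yM uM eyu) => // b /nob'.
Qed.

End NoTwins.

(** * A universal vertex *)

(** Only [W4] has a universal vertex, and one of its two pairs of false twins avoids [r], which will
    be the cut vertex [c]. *)
Lemma adjF_cone_twins A k r : A \in adjF -> k < size A -> r < size A ->
  (forall j, j < size A -> j != k -> adj A k j) ->
  exists i j, [/\ i < size A, j < size A, i != j, (i != r) && (j != r) &
     forall m, m < size A -> adj A i m = adj A j m].
Proof.
move=> AF ltk ltr univ; have ck : all (fun j => (j != k) ==> adj A k j) (iota 0 (size A)).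
  by apply/allP=> j; rewrite mem_iota => ltj; apply/implyP; apply: univ.
have : allpair (size A) (fun k r =>
  all (fun j => (j != k) ==> adj A k j) (iota 0 (size A)) ==>
  has (fun i => has (fun j => [&& tab_twins A i j, i != r & j != r]) (iota 0 (size A))) (iota 0 (size A))).
  by move: A AF {ltk ltr univ ck}; apply/allP; vm_compute.
move/allpairP/(_ k r ltk ltr); rewrite ck /=.
case/hasP=> i + /hasP[j + /and3P[/andP[nij /allP h] ir jr]].
rewrite !mem_iota => lti ltj; exists i, j; split; rewrite ?ir // => m ltm.
by apply/eqP/h; rewrite mem_iota.
Qed.

Section Universal.
Variables (T : finType) (e : rel T).
Hypotheses (e_sym : symmetric e) (e_irr : irreflexive e) (e_conn : connected e).
Hypotheses (e_nc : nocut e) (T3 : 3 <= #|T|) (IH : smaller_good e).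
Hypothesis no_twins : forall x y, ~~ false_twins e x y.
Implicit Types (a b c w x y z : T) (X S : {set T}).

Variable u : T.
Hypothesis univ : forall z, z != u -> e u z.

Lemma diam_universal a b : dist e a b <= 2.
Proof.
have le1 x : dist e x u <= 1.
  have [->|xu] := eqVneq x u; first by rewrite dist_xx.
  by rewrite (dist_edge e_irr e_conn) // e_sym univ.
have := dist_triangle e_conn a u b; have := le1 a; have := le1 b.
rewrite (dist_sym e_sym e_conn b); nlia.
Qed.

Let lineA := line_adjacent e_sym e_irr e_conn diam_universal.
Let lineN := line_nonadjacent e_sym e_irr e_conn diam_universal.

(* Away from [u], the vertex [c] separates [A] from [B]. *)
Definition cone_separation c (A B : {set T}) : Prop :=
  [/\ u != c, u \notin A /\ c \notin A, u \notin B /\ c \notin B,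
      forall x, [\/ x = u, x = c, x \in A | x \in B] &
      forall a b, a \in A -> b \in B -> a != b /\ ~~ e a b].

Lemma cone_separationC c A B : cone_separation c A B -> cone_separation c B A.
Proof.
case=> uc uA uB cov ne; split=> // [x|a b aB bA].
  by case: (cov x) => h; [constructor 1|constructor 2|constructor 4|constructor 3].
by have [n1 n2] := ne _ _ bA aB; rewrite eq_sym e_sym.
Qed.

Section Side.
Variables (c : T) (A B : {set T}).
Hypothesis sep : cone_separation c A B.
Hypotheses (A0 : A != set0) (B0 : B != set0).
Local Notation G := (u |: (c |: A)).

Let uc : u != c. Proof. by case: sep. Qed.
Let uA : u \notin A. Proof. by case: sep => _ []. Qed.
Let cA : c \notin A. Proof. by case: sep => _ []. Qed.
Let uB : u \notin B. Proof. by case: sep => _ _ []. Qed.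
Let cB : c \notin B. Proof. by case: sep => _ _ []. Qed.

Let Au a : a \in A -> a != u. Proof. by apply: contraTneq => ->. Qed.
Let Ac a : a \in A -> a != c. Proof. by apply: contraTneq => ->. Qed.
Let Bu b : b \in B -> b != u. Proof. by apply: contraTneq => ->. Qed.
Let Bc b : b \in B -> b != c. Proof. by apply: contraTneq => ->. Qed.
Let AB a b : a \in A -> b \in B -> e a b = false.
Proof. by move=> aA bB; case: sep => _ _ _ _ /(_ a b aA bB)[_ /negbTE]. Qed.
Let ABn a b : a \in A -> b \in B -> b != a.
Proof. by move=> aA bB; case: sep => _ _ _ _ /(_ a b aA bB)[+ _]; rewrite eq_sym. Qed.

Lemma cone_G x : (x \in G) = (x \notin B).
Proof.
rewrite !inE; case: sep => _ _ _ /(_ x) cov _.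
case: cov => [->|->|xA|xB].
- by rewrite eqxx uB.
- by rewrite eqxx orbT cB.
- by rewrite xA !orbT; apply/esym/negP=> /(ABn xA); rewrite eqxx.
- rewrite xB (negbTE (Bu xB)) (negbTE (Bc xB)) /=; apply/negP=> xA.
  by have := ABn xA xB; rewrite eqxx.
Qed.

Lemma cone_retract : retract e G u.
Proof.
split=> [|x z _ _ _]; first by rewrite !inE eqxx.
by have [->|xu] := eqVneq x u; [left|right; rewrite e_sym univ].
Qed.

(** Otherwise [u] would be a cut vertex separating [A] from [c]. *)
Lemma cone_c_nbr : exists2 a, a \in A & e c a.
Proof.
have [/exists_inP[a aA eca]|] := boolP [exists a in A, e c a]; first by exists a.
rewrite negb_exists_in => /forall_inP no; have /set0Pn[a aA] := A0.
have cu : c != u by rewrite eq_sym.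
suff : c \in A by rewrite (negbTE cA).
apply: (connect_ind (P := fun z => z \in A)) (e_nc (Au aA) cu) (aA) => x y /and3P[exy xu yu] xA.
case: sep => _ _ _ /(_ y)[yE|yE|//|yB] _.
- by rewrite yE eqxx in yu.
- by have := no x xA; rewrite e_sym -yE exy.
- by rewrite (AB xA yB) in exy.
Qed.

Lemma cone_edge x z : x \in G -> z \in G -> e x z -> exists w, [/\ w \in G, e x w & e w z].
Proof.
have uG : u \in G by rewrite !inE eqxx.
have wlog_u q : q \in G -> q != u -> exists w, [/\ w \in G, e u w & e w q].
  move=> qG qu; suff [w wG eqw] : exists2 w, w \in G :\ u & e q w.
    by move: wG; rewrite in_setD1 => /andP[wu wG]; exists w; rewrite univ // e_sym.
  have [qA|] := boolP (q \in A); last first.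
    move: qG; rewrite in_setU1 (negbTE qu) in_setU1 /= => /orP[/eqP->|->//] _.
    by have [a aA eca] := cone_c_nbr; exists a; rewrite // in_setD1 Au // !inE aA !orbT.
  have equ : e q u by rewrite e_sym univ.
  have [w eqw wu] := nocut_deg2 e_irr e_nc T3 equ; exists w => //.
  by rewrite in_setD1 wu cone_G; apply: contraTN eqw => wB; rewrite AB.
move=> xG zG exz; have [xu|xu] := eqVneq x u.
  rewrite xu; apply: wlog_u => //; apply: contraTneq exz => ->; by rewrite xu e_irr.
have [zu|zu] := eqVneq z u.
  by rewrite zu; have [w [wG euw ewx]] := wlog_u _ xG xu; exists w; rewrite e_sym ewx e_sym.
by exists u; rewrite univ // e_sym univ.
Qed.

Lemma cone_bridges : num_bridges (induced e G) = 0.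
Proof.
apply/eqP; rewrite cards_eq0; apply/eqP/setP=> f; rewrite in_set0; apply/negP=> fb.
have : f \in edges (induced e G) by move: fb; rewrite inE => /andP[].
case/imsetP=> -[p q]; rewrite inE /= => epq fE.
have [w [wG epw ewq]] := cone_edge (valP p) (valP q) epq.
have := @bridge_no_triangle _ (induced e G) p q (Sub w wG) (@induced_sym _ _ e_sym G)
  (@induced_irr _ _ e_irr G) (retract_connected e_sym e_conn cone_retract) epq epw ewq.
by rewrite -fE fb.
Qed.

Lemma cone_notF : ~ in_family_F (induced e G).
Proof.
move=> /induced_family_tab[tA AF [t tabG]].
have uG : u \in G by rewrite !inE eqxx.
have cG : c \in G by rewrite !inE eqxx orbT.
have [k ltk uk] := tab_ex u tabG uG; have [r ltr cr] := tab_ex u tabG cG.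
have tin := tab_in u tabG; have teq := tab_eq u tabG; have tadj := tab_adj u tabG.
have [|i [j [lti ltj nij /andP[ir jr] h]]] := adjF_cone_twins AF ltk ltr.
  by move=> j ltj jk; rewrite -tadj // -uk univ // {2}uk teq.
have eq_nbr z : z \in G -> e (nth u t i) z = e (nth u t j) z.
  by move=> /(tab_ex u tabG)[m ltm ->]; rewrite !tadj // h.
have nadj : ~~ e (nth u t i) (nth u t j) by rewrite eq_nbr ?tin // e_irr.
have inA i' j' : i' < size tA -> j' < size tA -> i' != r -> i' != j' ->
    ~~ e (nth u t i') (nth u t j') -> nth u t i' \in A.
  move=> lt lt' i'r nij' na; have := tin i' lt; rewrite !in_setU1.
  rewrite {1}cr teq // (negbTE i'r) /=; have [E|//] := eqVneq (nth u t i') u.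
  have ju : nth u t j' != u by rewrite -[X in _ != X]E teq // eq_sym.
  by move: na; rewrite E univ.
have iA := inA _ _ lti ltj ir nij nadj.
have jA : nth u t j \in A.
  by apply: (inA j i); rewrite // 1?eq_sym // e_sym.
have : false_twins e (nth u t i) (nth u t j).
  rewrite /false_twins teq // nij; apply/eqP/setP=> z; rewrite !inE.
  have [zG|] := boolP (z \in G); first exact: eq_nbr.
  by rewrite cone_G negbK => zB; rewrite !AB.
by rewrite (negbTE (no_twins _ _)).
Qed.

Lemma cone_small : 2 <= #|G| /\ #|G| < #|T|.
Proof.
have /set0Pn[b bB] := B0; split.
  by rewrite cardsU1 !inE negb_or uc uA cardsU1 cA; clear; lia.
rewrite -cardsT; apply: proper_card; apply/properP; split; first exact: subsetT.
by exists b; [rewrite inE|rewrite cone_G bB].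
Qed.

Lemma cone_good : #|G| <= #|lines_in e G|.
Proof.
have [G2 ltG] := cone_small.
by have := IH cone_retract ltG G2 cone_notF; rewrite cone_bridges addn0.
Qed.

Lemma cone_lines X : X \in lines_in e G ->
  [\/ X = line e u c, (forall b, b \in B -> b \notin X),
      exists2 a, a \in A & X = line e u a |
      exists a, [/\ a \in A, e c a & X = line e c a]].
Proof.
have uG a : a \in A -> exists2 a', a' \in A & line e u a = line e u a' by exists a.
have cG a : a \in A -> [\/ line e c a = line e u c, (forall b, b \in B -> b \notin line e c a),
      exists2 a', a' \in A & line e c a = line e u a' |
      exists a', [/\ a' \in A, e c a' & line e c a = line e c a']].
  move=> aA; have [eca|neca] := boolP (e c a); first by constructor 4; exists a.
  have ca : c != a by rewrite eq_sym Ac.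
  constructor 2 => b bB; rewrite lineN // (AB aA bB) andbF orbF negb_or.
  by rewrite Bc // ABn.
case/lines_inP=> p [q [pG qG npq ->]].
move: pG qG; rewrite !in_setU1 => /or3P[/eqP pu|/eqP pc|pA] /or3P[/eqP qu|/eqP qc|qA].
- by rewrite pu qu eqxx in npq.
- by constructor 1; rewrite pu qc.
- by constructor 3; exists q; rewrite ?pu.
- by constructor 1; rewrite pc qu line_sym.
- by rewrite pc qc eqxx in npq.
- by rewrite pc; apply: cG.
- by constructor 3; exists p; rewrite // qu line_sym.
- by rewrite qc line_sym //; apply: cG.
constructor 2 => b bB; have [epq|nepq] := boolP (e p q).
  by rewrite lineA // !AB // eqxx orbF negb_or !ABn.
by rewrite lineN // !AB // orbF negb_or !ABn.
Qed.

End Side.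

(** A line of [u] or of [c] with a neighbour [a] determines the neighbourhood of [a]; if a vertex of
    [A] and one of [B] gave the same line, they would be false twins. *)
Lemma cone_overlap c A B : cone_separation c A B ->
  #|lines_in e (u |: (c |: A)) :&: lines_in e (u |: (c |: B))| <= 1.
Proof.
move=> sep; have sepC := cone_separationC sep.
rewrite -(cards1 (line e u c)); apply/subset_leq_card/subsetP=> X.
rewrite in_setI in_set1 => /andP[XA XB]; apply/eqP.
have twin a b : a \in A -> b \in B -> (forall z, e a z = e b z) -> False.
  move=> aA bB h; have := no_twins a b; case: sep => _ _ _ _ /(_ a b aA bB)[nab _].
  by rewrite /false_twins nab => /eqP[]; apply/setP=> z; rewrite !inE h.
have meets C D : cone_separation c C D -> X \in lines_in e (u |: (c |: C)) ->
    X = line e u c \/ exists2 a, a \in C & a \in X.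
  move=> _ /lines_inP[p [q [pG qG npq ->]]].
  move: pG qG; rewrite !in_setU1 => /or3P[/eqP pu|/eqP pc|pC] /or3P[/eqP qu|/eqP qc|qC];
    try by right; exists p; rewrite ?in_line_l.
  - by rewrite pu qu eqxx in npq.
  - by left; rewrite pu qc.
  - by right; exists q; rewrite ?in_line_r.
  - by left; rewrite pc qu line_sym.
  - by rewrite pc qc eqxx in npq.
  - by right; exists q; rewrite ?in_line_r.
have [uc _ _ _ _] := sep; have [_ [uA' cA'] [uB' cB'] _ _] := sep.
have nbr_u x (C : {set T}) : u \notin C -> x \in C -> e u x.
  by move=> uC xC; apply: univ; apply: contraTneq xC => ->.
have cu : e c u by rewrite e_sym univ // eq_sym.
have lineu (C : {set T}) x z : u \notin C -> x \in C -> (z \in line e u x) = (z == u) || ~~ e x z.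
  move=> uC xC; rewrite (lineA _ (nbr_u _ _ uC xC)); have [//|zu] := eqVneq z u.
  by rewrite univ //; have [->|_] /= := eqVneq z x; rewrite ?e_irr //; case: (e x z).
have linec : forall v z, e c v -> (z \in line e c v) = (e c z != e v z).
  move=> x z ecx; rewrite lineA //; have [->|_] := eqVneq z c; first by rewrite e_irr e_sym ecx.
  by have [->|_] := eqVneq z x; rewrite ?e_irr ?ecx.
have uNc x (C : {set T}) : u \notin C -> x \in C -> e c x -> u \notin line e c x.
  by move=> uC xC ecx; rewrite linec // cu e_sym (nbr_u x C).
case: (cone_lines sep XA) => [//|noB|[a aA Xa]|[a [aA eca Xa]]].
- case: (meets _ _ sepC XB) => // -[b bB bX].
  by have := noB b bB; rewrite bX.
- case: (cone_lines sepC XB) => [//|noA|[b bB Xb]|[b [bB ecb Xb]]].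
  + by have := noA a aA; rewrite Xa in_line_r.
  + case: (twin a b aA bB) => z; have [->|zu] := eqVneq z u.
      by rewrite ![e _ u]e_sym (nbr_u a A) // (nbr_u b B).
    have : (z \in line e u a) = (z \in line e u b) by rewrite -Xa Xb.
    by rewrite (lineu A) // (lineu B) // (negbTE zu) => /negb_inj.
  + by have := uNc b B uB' bB ecb; rewrite -Xb Xa in_line_l.
- case: (cone_lines sepC XB) => [//|noA|[b bB Xb]|[b [bB ecb Xb]]].
  + by have := noA a aA; rewrite Xa in_line_r.
  + by have := uNc a A uA' aA eca; rewrite -Xa Xb in_line_l.
  + case: (twin a b aA bB) => z.
    have : (z \in line e c a) = (z \in line e c b) by rewrite -Xa Xb.
    by rewrite !linec //; case: (e c z); case: (e a z); case: (e b z).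
Qed.

Lemma universal_case c A B : cone_separation c A B -> A != set0 -> B != set0 ->
  #|T| <= num_lines e.
Proof.
move=> sep A0 B0; have sepC := cone_separationC sep.
have gA := cone_good sep A0 B0; have gB := cone_good sepC B0 A0.
have cT : #|u |: (c |: A)| + #|u |: (c |: B)| = #|T|.+2.
  rewrite -cardsUI.
  have -> : (u |: (c |: A)) :|: (u |: (c |: B)) = setT.
    by apply/setP=> x; rewrite in_setU (cone_G sep) (cone_G sepC) inE; case: sep => _ _ _ _ ne;
      have [xB|//] := boolP (x \in B); rewrite /=; apply/negP=> xA; have [/eqP] := ne x x xA xB.
  have -> : (u |: (c |: A)) :&: (u |: (c |: B)) = [set u; c].
    case: sep => _ _ _ _ ne; apply/setP=> x; rewrite !inE.
    case: (x == u); case: (x == c) => //=; apply/negP=> /andP[xA xB].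
    by have [/eqP] := ne x x xA xB.
  by rewrite cards2 cardsT; case: sep => ->; rewrite addn2.
have new X : X \in [::] -> [/\ X \in lines e, X \notin lines_in e (u |: (c |: A))
    & X \notin lines_in e (u |: (c |: B))] by [].
have := extra_lines (lines_in_sub e _) (lines_in_sub e _) (ls := [::]) isT new.
move: gA gB (cone_overlap sep) cT; card_lia.
Qed.

End Universal.

(** * The induction *)

Lemma two_vertices (T : finType) (e : rel T) : irreflexive e -> connected e -> #|T| = 2 ->
  #|T| <= num_lines e + num_bridges e.
Proof.
move=> e_irr e_conn T2; have /card_gt0P[a _] : 0 < #|T| by rewrite T2.
have [b ba] : exists b, b != a.
  apply/existsP; rewrite -negb_forall; apply: contra_eqN T2 => /forallP h.
  rewrite neq_ltn -cardsT; apply/orP; left; rewrite ltnS -(cards1 a).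
  by apply/subset_leq_card/subsetP=> x _; rewrite inE; apply: h.
have ab : a != b by rewrite eq_sym.
have cov x : (x == a) || (x == b).
  have : [set a; b] == setT by rewrite eqEcard subsetT cardsT T2 cards2 ab.
  by move/eqP/setP/(_ x); rewrite !inE.
have [c eac _] := connect_first ((connectedP _ e_conn) a b) ab.
have eab : e a b by move: (cov c) (eac) => /orP[]/eqP-> //; rewrite e_irr.
have l1 : 0 < num_lines e by apply/card_gt0P; exists (line e a b); apply: mem_lines.
suff b1 : 0 < num_bridges e by rewrite T2; move: l1 b1; clear; lia.
apply/card_gt0P; exists [set a; b]; rewrite inE; apply/andP; split.
  by apply/imsetP; exists (a, b); rewrite // inE.
apply/negP=> /connectedP/(_ a b)/connect_first/(_ ab)[w /andP[eaw /negP nE] _]; apply: nE.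
by case/orP: (cov w) => /eqP wE; [rewrite wE e_irr in eaw|rewrite wE].
Qed.

(** A cycle of length at least 4 through [u] has a vertex other than [u] and its two cycle
    neighbours, and a chord from [u] to it. *)
Lemma chordal_cone (T : finType) (e : rel T) u : symmetric e -> irreflexive e ->
  (forall z, z != u -> e u z) -> chordal (induced e [set~ u]) -> chordal e.
Proof.
move=> e_sym e_irr univ ch s cs ss; have us := ucycle_uniq cs.
have [us'|nus] := boolP (u \in s).
  have [w] : exists w, w \in [set w in s] :\: [set u; next s u; prev s u].
    apply/set0Pn; rewrite -card_gt0 cardsD subn_gt0.
    have -> : #|[set w in s]| = size s.
      by rewrite -(card_uniqP us); apply: eq_card => x; rewrite inE.
    apply: leq_ltn_trans ss; apply: leq_trans (subset_leq_card (subsetIr _ _)) _.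
    apply: leq_trans (leq_card_setU _ _) _; rewrite cards1.
    by rewrite cards2; case: (_ != _).
  rewrite !inE !negb_or -!andbA => /and4P[wu wn wp ws].
  exists u, w; split=> //; first exact: univ.
  by apply: contraNneq wp => ->; rewrite prev_next.
have [s' sE] : exists s' : seq {x | x \in [set~ u]}, s = map val s'.
  have : forall x, x \in s -> x \in [set~ u].
    by move=> x xs; rewrite !inE; apply: contraNneq nus => <-.
  elim: (s) => [|x l IH] h; first by exists [::].
  have [|l' ->] := IH; first by move=> y yl; apply: h; rewrite inE yl orbT.
  have xu : x \in [set~ u] by apply: h; rewrite inE eqxx.
  by exists (Sub x xu :: l').
have us2 : uniq s' by rewrite -(map_inj_uniq val_inj) -sE.
have [||x [y [xs ys exy n1 n2]]] := ch s'.
- rewrite /ucycle us2 andbT; case/andP: cs => + _; rewrite sE.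
  by rewrite (mono_cycle (e := induced e [set~ u])).
- by rewrite -(size_map val) -sE.
exists (val x), (val y); rewrite sE !(next_map val_inj us2) !(inj_eq val_inj) !(mem_map val_inj).
by split.
Qed.

Section Step.
Variables (T : finType) (e : rel T).
Hypotheses (e_sym : symmetric e) (e_irr : irreflexive e) (e_conn : connected e).
Hypotheses (e_class : hclass e) (e_notF : ~ in_family_F e) (IH : smaller_good e).
Hypotheses (e_nc : nocut e) (T3 : 3 <= #|T|).

(** [module_case] wants every vertex of the module to have a neighbour inside. Two vertices isolated
    in [M] would be false twins, so at most one has to be dropped, and the rest is still a
    module. *)
Lemma small_module_case (M : {set T}) : (forall x y, ~~ false_twins e x y) ->
  is_module e M -> 2 <= #|M| -> #|M|.+2 <= #|T| -> #|T| <= num_lines e.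
Proof.
move=> nt modM M2 Ms.
have iso_eq z z' : z \in M -> z' \in M -> (forall w, w \in M -> ~~ e z w) ->
    (forall w, w \in M -> ~~ e z' w) -> z = z'.
  move=> zM z'M nz nz'; apply: (nbrs_inj nt); apply/setP=> w; rewrite !inE.
  have [wM|wM] := boolP (w \in M); last exact: (moduleE modM).
  by rewrite (negbTE (nz _ wM)) (negbTE (nz' _ wM)).
have [/exists_inP[z zM /forall_inP iso]|] := boolP [exists z in M, [forall w in M, ~~ e z w]]; last first.
  rewrite negb_exists_in => /forall_inP h.
  apply: (module_case e_sym e_irr e_conn e_nc T3 IH nt modM) => // z /h.
  by rewrite negb_forall_in => /exists_inP[w wM]; rewrite negbK; exists w.
have cM : #|M| = #|M :\ z|.+1 by rewrite (cardsD1 z M) zM.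
have niso w : w \in M -> w != z -> exists2 w', w' \in M :\ z & e w w'.
  move=> wM wz; have [/exists_inP[w' w'M eww]|] := boolP [exists w' in M, e w w'].
    exists w' => //; rewrite !inE w'M andbT; apply: contraTneq eww => ->.
    by rewrite e_sym iso.
  by rewrite negb_exists_in => /forall_inP no; case/eqP: wz; apply: iso_eq.
have /card_gt0P[w] : 0 < #|M :\ z| by move: M2; rewrite cM.
rewrite !inE => /andP[wz wM]; have [w' w'M' eww] := niso w wM wz.
apply: (module_case e_sym e_irr e_conn e_nc T3 IH nt (M := M :\ z)).
- apply/forall_inP=> a /setD1P[_ aM]; apply/forall_inP=> b /setD1P[_ bM].
  apply/forall_inP=> v; rewrite !inE negb_and !negbK => /orP[/eqP->|vM].
    by rewrite ![e _ z]e_sym !(negbTE (iso _ _)).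
  by rewrite (moduleE modM aM bM).
- have nww : w != w' by apply: contraTneq eww => ->; rewrite e_irr.
  rewrite (cardsD1 w) !inE wz wM (cardsD1 w') !inE eq_sym nww.
  by move: w'M'; rewrite !inE => ->; clear; lia.
- by move: Ms; rewrite cM; apply: leq_trans; rewrite ltnS.
- by move=> v /setD1P[vz vM]; apply: niso.
Qed.

(** If the module misses a single vertex [u], then [M] and [u] make up the whole graph and
    contraction gains nothing. But [u] is universal, and the class is applied again to the rest: it
    is chordal and so is the graph, or it has a cut vertex, or it has a module, which is one of the
    graph and misses at least two vertices. *)
Lemma nocut_case : #|T| <= num_lines e.
Proof.
have idi : injective (id : T -> T) by [].
case: (e_class idi e_conn) => [ch|//|[M [modM' /andP[M2 MT]]]].
  exact: (chordal_case e_sym e_irr e_conn ch).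
have modM : is_module e M := modM'.
have [/existsP[x /existsP[y tw]]|] := boolP [exists x, exists y, false_twins e x y].
  have [/existsP[x' /existsP[y' /existsP[c /and4P[tw' cx cy nec]]]]|] :=
    boolP [exists x', exists y', exists c, [&& false_twins e x' y', c != x', c != y' & ~~ e y' c]].
    exact: (false_twin_case e_sym e_irr e_conn e_nc IH e_notF tw' cx cy nec).
  rewrite negb_exists => /forallP no.
  apply: (complete_twin_case e_sym e_irr e_conn e_nc T3 e_notF); last by exists x, y.
  move=> x' y' tw' c cx cy; have := no x'; rewrite negb_exists => /forallP/(_ y').
  by rewrite negb_exists => /forallP/(_ c); rewrite tw' cx cy /= negbK.
rewrite negb_exists => /forallP no.
have nt x y : ~~ false_twins e x y.
  by have := no x; rewrite negb_exists => /forallP.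
have [Ms|MT'] := leqP #|M|.+2 #|T|; first exact: small_module_case Ms.
have cM : #|M|.+1 = #|T| by apply/eqP; rewrite eqn_leq MT.
have /cards1P[u uM] : #|~: M| == 1 by rewrite -(eqn_add2l #|M|) cardsC addn1 cM.
have ME : M = [set~ u] by rewrite -uM setCK.
have univ z : z != u -> e u z.
  move=> zu; have zM : z \in M by rewrite ME !inE.
  have uM' : u \notin M by rewrite ME !inE eqxx.
  rewrite eq_sym in zu; have [c euc _] := connect_first ((connectedP _ e_conn) u z) zu.
  have cM' : c \in M by rewrite ME !inE; apply: contraTneq euc => ->; rewrite e_irr.
  by rewrite e_sym (moduleE modM zM cM') // e_sym.
case: (e_class (h := fun x : {x | x \in [set~ u]} => val x) val_inj (nocut_connected u e_nc)).
- move=> ch; exact: (chordal_case e_sym e_irr e_conn (chordal_cone e_sym e_irr univ ch)).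
- move=> nc; case: (nocut_or_separation (@induced_sym _ _ e_sym [set~ u])) => [//|].
  case=> v [A [B [[vA vB dis cov ne] A0 B0]]].
  have uS (C : {set {x | x \in [set~ u]}}) : u \notin val @: C.
    by apply/negP=> /imsetP[x _ E]; have := valP x; rewrite -E !inE eqxx.
  have vS (C : {set {x | x \in [set~ u]}}) : v \notin C -> val v \notin val @: C.
    by move=> vC; rewrite mem_imset //; apply: val_inj.
  apply: (universal_case e_sym e_irr e_conn e_nc T3 IH nt univ (c := val v)
    (A := val @: A) (B := val @: B)); rewrite ?imset_eq0 //.
  split; first by have := valP v; rewrite !inE eq_sym.
  - by split; [apply: uS|apply: vS].
  - by split; [apply: uS|apply: vS].
  - move=> x; have [->|xu] := eqVneq x u; first by constructor 1.
    have xS : x \in [set~ u] by rewrite !inE.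
    have [E|xv] := eqVneq (Sub x xS) v; first by constructor 2; rewrite -E.
    have /orP[h|h] := cov _ xv; [constructor 3|constructor 4];
      by apply/imsetP; exists (Sub x xS).
  move=> ? ? /imsetP[a aA ->] /imsetP[b bB ->]; split; last exact: ne.
  rewrite (inj_eq val_inj); apply: contraTneq aA => ->.
  by rewrite (disjointFl dis).
- case=> N [modN /andP[N2]]; rewrite card_induced => NM.
  have {}NM : #|N| < #|M| by rewrite ME.
  have cN : #|val @: N| = #|N| by rewrite card_imset //; apply: val_inj.
  apply: (@small_module_case (val @: N)) => //; rewrite ?cN //; last by move: NM cM; card_lia.
  apply/forall_inP=> ? /imsetP[a aN ->]; apply/forall_inP=> ? /imsetP[b bN ->].
  apply/forall_inP=> w; rewrite inE => wN.
  have [->|wu] := eqVneq w u.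
    have uv (x : {x | x \in [set~ u]}) : e (val x) u.
      by rewrite e_sym univ //; have := valP x; rewrite !inE.
    by rewrite !uv.
  have wS : w \in [set~ u] by rewrite !inE.
  have wN' : Sub w wS \notin N.
    by apply: contra wN => wN; apply/imsetP; exists (Sub w wS).
  by rewrite -[w]/(val (Sub w wS : {x | x \in [set~ u]})); apply/eqP/(moduleE modN).
Qed.

End Step.

(** The induction is on a bound [n], because the vertex type changes with the subgraph. *)
Lemma hclass_bound n (T : finType) (e : rel T) : #|T| <= n ->
  symmetric e -> irreflexive e -> connected e -> 2 <= #|T| -> hclass e -> ~ in_family_F e ->
  #|T| <= num_lines e + num_bridges e.
Proof.
elim: n T e => [|n IHn] T e leT e_sym e_irr e_conn T2 e_class e_notF.
  by have := leq_trans T2 leT.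
have IH : smaller_good e.
  move=> S y rS ltS S2 nFS.
  have cS : #|{: {x | x \in S}}| = #|S| := card_induced S.
  have := IHn _ (induced e S); rewrite cS.
  have leS : #|S| <= n by rewrite -ltnS; apply: leq_trans leT.
  move=> /(_ leS (@induced_sym _ _ e_sym S) (@induced_irr _ _ e_irr S)).
  move=> /(_ (retract_connected e_sym e_conn rS) S2 (hclass_embed val_inj e_class) nFS).
  move=> le; apply: leq_trans le _; rewrite leq_add2r.
  exact: (retract_lines e_sym e_irr e_conn rS).
case: (nocut_or_separation e_sym) => [e_nc|[v [A [B [sep A0 B0]]]]]; last first.
  exact: (cut_vertex_case e_sym e_irr e_conn IH sep A0 B0).
have [T2'|T3] := eqVneq #|T| 2; first exact: two_vertices.
apply: leq_trans (leq_addr _ _); apply: nocut_case => //.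
by rewrite ltn_neqAle eq_sym T3.
Qed.

Theorem theorem2p1 (T : finType) (e : rel T)
  (e_sym : symmetric e) (e_irr : irreflexive e)
  (e_conn : connected e) (card_ge2 : 2 <= #|T|)
  (e_C : in_class_C e) (e_notF : ~ in_family_F e) :
  num_lines e + num_bridges e >= #|T|.
Proof.
exact: (hclass_bound (leqnn _) e_sym e_irr e_conn card_ge2 (in_class_C_hclass e_sym e_C)).
Qed.
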